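(* (Local Ryll-Nardzewski.) Let $T$ be a theory in a separable language, and let $\sim$ be an invariant equivalence relation on models of $T$. Then the following are equivalent: (1) The pair $(T, \sim)$ is locally $\aleph_0$-categorical. (2) The theory $T$ is complete, all types of $T$ are locally isolated, and for all $a,b$ in models of $T$, $a \sim b$ if and only if $\mathrm{tp}(a,b)$ is isolated. If these equivalent conditions hold, then, in addition: the isolated types in $\mathrm{S}_n(T)$ form a dense open set for each $n$; a model of $T$ is local if and only if it is atomic, and in particular the unique local separable model of $T$ is its prime model; and the isomorphism type of any model of $T$ is determined by the isomorphism types of its local components and their multiplicities.
   Context: Continuous (metric) logic, with formulas allowed to take values in $[-\infty,\infty]$. $\mathrm{S}_n(T)$ is the compact space of $n$-types. A type $p\in \mathrm{S}_n(T)$ of a complete theory is isolated if the logic topology and the topology of the type metric ($d(p,q)=\inf\max_i d(a_i,b_i)$ over realisations $a\models p$, $b\models q$ in a common model) coincide at $p$; a model is atomic if it realises only isolated types; a prime model is one that embeds elementarily into every model. An invariant equivalence relation on models of $T$ is a set $R\subseteq \mathrm{S}_2(T)$ such that in every model the relation $a\sim b \iff \mathrm{tp}(a,b)\in R$ is an equivalence relation. $(T,\sim)$ is weakly local if: for every $M\models T$, each $\sim$-class of $M$ (a local component) is an elementary substructure of $M$; and a map between models of $T$ is elementary iff it is elementary on each $\sim$-class and sends distinct $\sim$-classes into distinct $\sim$-classes. A model with a single local component is local. $(T,\sim)$ is locally $\aleph_0$-categorical if it is weakly local, has a separable language, and admits a unique separable local model up to isomorphism. For a complete theory $T$ and $p=\mathrm{tp}(a)\in\mathrm{S}_n(T)$,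 write $i\sim_p j$ ($i,j<n$) if $\mathrm{tp}(a_i,a_j)$ is isolated; $p$ is locally isolated if $\sim_p$ is an equivalence relation on $\{0,\dots,n-1\}$, for each $\sim_p$-class $I$ the restriction $p_I=\mathrm{tp}(a_i:i\in I)$ is isolated, and any $q\in\mathrm{S}_n(T)$ with $\sim_q=\sim_p$ and $q_I=p_I$ for each class $I$ equals $p$. *)

(* Defs.v *)
From HB Require Import structures.
From mathcomp Require Import all_boot all_order all_algebra.
From mathcomp Require Import all_classical all_reals all_analysis.
From Stdlib Require Import RelationClasses.

Set Implicit Arguments.
Unset Strict Implicit.
Unset Printing Implicit Defensive.

Import Order.TTheory GRing.Theory Num.Theory.

Local Open Scope classical_set_scope.
Local Open Scope ring_scope.

(** * Languages, structures, formulas *)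

(* Every symbol carries a modulus of uniform continuity. *)
Record language (R : realType) := Language {
  fsym : Type;
  far : fsym -> nat;
  fmodulus : fsym -> R -> R;
  fmodulus_gt0 : forall s e, 0 < e -> 0 < fmodulus s e;
  psym : Type;
  par : psym -> nat;
  pmodulus : psym -> R -> R;
  pmodulus_gt0 : forall s e, 0 < e -> 0 < pmodulus s e }.

(* The compact metric on [-oo, +oo] underlying the library's pseudometric
   structure on \bar R. *)
Definition egap (R : realType) (x y : \bar R) : R := `|contract x - contract y|.

(* Since formulas take values in [-oo, +oo], the distance (which is itself a
   formula) may take the value +oo. In the two continuity axioms the conclusion
   is a non-strict inequality, so that they are closed conditions. *)
Record structure (R : realType) (L : language R) := Structure {
  carrier :> Type;
  carrier_inhabited : inhabited carrier;
  dist : carrier -> carrier -> \bar R;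
  finterp : forall s : fsym L, ('I_(far s) -> carrier) -> carrier;
  pinterp : forall s : psym L, ('I_(par s) -> carrier) -> \bar R;
  dist_ge0 : forall x y, (0 <= dist x y)%E;
  dist_eq0 : forall x y, dist x y = 0%E <-> x = y;
  dist_sym : forall x y, dist x y = dist y x;
  dist_triangle : forall x y z, (dist x z <= dist x y + dist y z)%E;
  dist_complete : forall u : nat -> carrier,
    (forall e : R, 0 < e -> exists N, forall m n, (N <= m)%N -> (N <= n)%N ->
       (dist (u m) (u n) < e%:E)%E) ->
    exists l, forall e : R, 0 < e -> exists N, forall n, (N <= n)%N ->
       (dist (u n) l < e%:E)%E;
  finterp_ucont : forall (s : fsym L) (e : R) x y, 0 < e ->
    (forall i, (dist (x i) (y i) < (fmodulus s e)%:E)%E) ->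
    (dist (@finterp s x) (@finterp s y) <= e%:E)%E;
  pinterp_ucont : forall (s : psym L) (e : R) x y, 0 < e ->
    (forall i, (dist (x i) (y i) < (pmodulus s e)%:E)%E) ->
    egap (@pinterp s x) (@pinterp s y) <= e }.

Arguments finterp {R L} M s x : rename.
Arguments pinterp {R L} M s x : rename.

Inductive term (R : realType) (L : language R) (n : nat) : Type :=
| Tvar of 'I_n
| Tapp (s : fsym L) of ('I_(far s) -> term L n).

(* [fml L n]: formulas with free variables among x_0, ..., x_{n-1}. The
   quantifiers bind variable 0 and shift the others. All continuous functions
   [-oo, +oo]^k -> [-oo, +oo] are connectives. *)
Inductive fml (R : realType) (L : language R) (n : nat) : Type :=
| Fdist of term L n & term L n
| Fpred (s : psym L) of ('I_(par s) -> term L n)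
| Fconn (k : nat) (u : {ptws 'I_k -> \bar R} -> \bar R) of
    continuous u & ('I_k -> fml L n)
| Fsup of fml L n.+1
| Finf of fml L n.+1.

Definition scons (X : Type) (n : nat) (x : X) (a : 'I_n -> X) : 'I_n.+1 -> X :=
  fun i => if unlift ord0 i is Some j then a j else x.

Fixpoint teval (R : realType) (L : language R) (M : structure L) (n : nat)
    (a : 'I_n -> M) (t : term L n) : M :=
  match t with
  | Tvar i => a i
  | Tapp s ts => finterp M s (fun i => teval a (ts i))
  end.

Fixpoint eval (R : realType) (L : language R) (M : structure L) (n : nat)
    (phi : fml L n) : ('I_n -> M) -> \bar R :=
  match phi with
  | Fdist t1 t2 => fun a => dist (teval a t1) (teval a t2)
  | Fpred s ts => fun a => pinterp M s (fun i => teval a (ts i))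
  | Fconn k u _ args => fun a => u (fun i => eval (args i) a)
  | Fsup psi => fun a => ereal_sup [set eval psi (scons x a) | x in [set: M]]
  | Finf psi => fun a => ereal_inf [set eval psi (scons x a) | x in [set: M]]
  end.

(* Substitution of variables along s. *)
Fixpoint trename (R : realType) (L : language R) (m n : nat) (s : 'I_m -> 'I_n)
    (t : term L m) : term L n :=
  match t with
  | Tvar i => Tvar L (s i)
  | Tapp f ts => Tapp (fun i => trename s (ts i))
  end.

Definition lift_ren (m n : nat) (s : 'I_m -> 'I_n) : 'I_m.+1 -> 'I_n.+1 :=
  scons ord0 (fun i => lift ord0 (s i)).

Fixpoint rename (R : realType) (L : language R) (m : nat) (phi : fml L m) :
    forall n, ('I_m -> 'I_n) -> fml L n :=
  match phi with
  | Fdist t1 t2 => fun n s => Fdist (trename s t1) (trename s t2)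
  | Fpred P ts => fun n s => Fpred (fun i => trename s (ts i))
  | Fconn k u cu args => fun n s => Fconn cu (fun i => rename (args i) s)
  | Fsup psi => fun n s => Fsup (rename psi (lift_ren s))
  | Finf psi => fun n s => Finf (rename psi (lift_ren s))
  end.

(* Density of a countable set of formulas, in each number of variables, for the
   distance of uniform convergence over all structures. *)
Definition separable_language (R : realType) (L : language R) : Prop :=
  forall n, exists f : nat -> fml L n,
    forall (psi : fml L n) (e : R), 0 < e -> exists k,
    forall (M : structure L) (a : 'I_n -> M),
      egap (eval psi a) (eval (f k) a) <= e.

Definition separable_structure (R : realType) (L : language R)
    (M : structure L) : Prop :=
  exists D : set M, countable D /\
    forall (x : M) (e : R), 0 < e -> exists2 y, D y & (dist x y < e%:E)%E.

(** * Theories and types *)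

(* A theory is a set of conditions "sigma = 0", for sentences sigma. *)
Definition theory (R : realType) (L : language R) := set (fml L 0).

Definition models (R : realType) (L : language R) (M : structure L)
    (T : theory L) : Prop :=
  forall sigma, T sigma -> forall a : 'I_0 -> M, eval sigma a = 0%E.

Definition complete_theory (R : realType) (L : language R) (T : theory L) :
    Prop :=
  (exists M : structure L, models M T) /\
  forall M N : structure L, models M T -> models N T ->
  forall (sigma : fml L 0) (a : 'I_0 -> M) (b : 'I_0 -> N),
    eval sigma a = eval sigma b.

(* A type is the function sending a formula to its value; the topology of
   pointwise convergence induces the logic topology on each S_n(T). *)
Definition typ (R : realType) (L : language R) (n : nat) : Type :=
  {ptws fml L n -> \bar R}.

Definition tp (R : realType) (L : language R) (M : structure L) (n : nat)
    (a : 'I_n -> M) : typ L n := fun phi => eval phi a.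

Definition types (R : realType) (L : language R) (T : theory L) (n : nat) :
    set (typ L n) :=
  [set p | exists M : structure L, models M T /\ exists a : 'I_n -> M, p = tp a].

Arguments types {R L} T n _.

Definition dist_typ (R : realType) (L : language R) (T : theory L) (n : nat)
    (p q : typ L n) : \bar R :=
  ereal_inf [set r | exists M : structure L, models M T /\
    exists a b : 'I_n -> M, [/\ tp a = p, tp b = q &
      r = \big[maxe/0%E]_(i < n) dist (a i) (b i)]].

(* The neighbourhoods of p in S_n(T) are the same for both topologies. *)
Definition isolated_typ (R : realType) (L : language R) (T : theory L) (n : nat)
    (p : typ L n) : Prop :=
  types T n p /\
  forall U : set (typ L n),
    within (types T n) (nbhs p) U <->
    exists2 e : R, 0 < e &
      forall q, types T n q -> (dist_typ T p q < e%:E)%E -> U q.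

Definition pair2 (X : Type) (x y : X) : 'I_2 -> X :=
  fun i => if i == ord0 then x else y.

Definition restr_typ (R : realType) (L : language R) (m n : nat)
    (s : 'I_m -> 'I_n) (p : typ L n) : typ L m := fun phi => p (rename phi s).

Lemma teval_rename (R : realType) (L : language R) (M : structure L) (m n : nat)
    (s : 'I_m -> 'I_n) (t : term L m) (a : 'I_n -> M) :
  teval a (trename s t) = teval (a \o s) t.
Proof.
by elim: t => //= f ts IH; congr (finterp M f _); apply: funext => i.
Qed.

Lemma scons_lift_ren (X : Type) (m n : nat) (s : 'I_m -> 'I_n) (x : X)
    (a : 'I_n -> X) : scons x a \o lift_ren s = scons x (a \o s).
Proof.
apply: funext => i; rewrite /lift_ren /scons /=.
by case: (unlift ord0 i) => [j|]; rewrite ?liftK ?unlift_none.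
Qed.

Lemma eval_rename (R : realType) (L : language R) (M : structure L) (m : nat)
    (phi : fml L m) (n : nat) (s : 'I_m -> 'I_n) (a : 'I_n -> M) :
  eval (rename phi s) a = eval phi (a \o s).
Proof.
elim: phi n s a => {m} /= [m t1 t2|m P ts|m k u cu args IH|m psi IH|m psi IH] n s a.
- by rewrite !teval_rename.
- by congr (pinterp M P _); apply: funext => i; rewrite teval_rename.
- by congr (u _); apply: funext => i; rewrite IH.
- by congr (ereal_sup _); apply: eq_imagel => x _; rewrite IH scons_lift_ren.
- by congr (ereal_inf _); apply: eq_imagel => x _; rewrite IH scons_lift_ren.
Qed.

(* This determines [restr_typ s p] for any type p of a tuple. *)
Lemma restr_tp (R : realType) (L : language R) (M : structure L) (m n : nat)
    (s : 'I_m -> 'I_n) (a : 'I_n -> M) : restr_typ s (tp a) = tp (a \o s).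
Proof. by apply: funext => phi; exact: eval_rename. Qed.

Definition typ_rel (R : realType) (L : language R) (T : theory L) (n : nat)
    (p : typ L n) (i j : 'I_n) : Prop :=
  isolated_typ T (restr_typ (pair2 i j) p).

Definition typ_class (R : realType) (L : language R) (T : theory L) (n : nat)
    (p : typ L n) (i : 'I_n) : {set 'I_n} :=
  [set j | `[< typ_rel T p i j >]]%SET.

(* p_I, with I enumerated increasingly. *)
Definition restr_set (R : realType) (L : language R) (n : nat) (I : {set 'I_n})
    (p : typ L n) : typ L #|I| := restr_typ (fun k => enum_val k) p.

Arguments restr_set {R L n} I p _.

Definition locally_isolated (R : realType) (L : language R) (T : theory L)
    (n : nat) (p : typ L n) : Prop :=
  [/\ types T n p,
      Equivalence (typ_rel T p),
      forall i, isolated_typ T (restr_set (typ_class T p i) p) &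
      forall q, types T n q ->
        (forall i j, typ_rel T q i j <-> typ_rel T p i j) ->
        (forall i, restr_set (typ_class T p i) q =
                   restr_set (typ_class T p i) p) ->
        q = p].

(** * Maps and substructures *)

Definition elementary_on (R : realType) (L : language R) (M N : structure L)
    (f : M -> N) (A : set M) : Prop :=
  forall n (phi : fml L n) (a : 'I_n -> M), (forall i, A (a i)) ->
    eval phi (f \o a) = eval phi a.

Definition elementary (R : realType) (L : language R) (M N : structure L)
    (f : M -> N) : Prop := elementary_on f [set: M].

Definition isomorphic (R : realType) (L : language R) (M N : structure L) :
    Prop :=
  exists f : M -> N,
    [/\ forall y, exists x, f x = y,
        forall x y, dist (f x) (f y) = dist x y,
        forall (s : fsym L) a, f (finterp M s a) = finterp N s (f \o a) &
        forall (s : psym L) a, pinterp N s (f \o a) = pinterp M s a].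

Definition atomic (R : realType) (L : language R) (T : theory L)
    (M : structure L) : Prop :=
  forall n (a : 'I_n -> M), isolated_typ T (tp a).

Definition prime_model (R : realType) (L : language R) (T : theory L)
    (M : structure L) : Prop :=
  models M T /\
  forall N : structure L, models N T -> exists f : M -> N, elementary f.

Definition is_substructure (R : realType) (L : language R) (M : structure L)
    (A : set M) : Prop :=
  [/\ A !=set0,
      forall (s : fsym L) a, (forall i, A (a i)) -> A (finterp M s a) &
      forall (u : nat -> M) l, (forall n, A (u n)) ->
        (forall e : R, 0 < e -> exists N, forall n, (N <= n)%N ->
           (dist (u n) l < e%:E)%E) ->
        A l].

Section Substructure.
Variables (R : realType) (L : language R) (M : structure L) (A : set M).
Hypothesis subA : is_substructure A.

Definition sub_finterp (s : fsym L) (a : 'I_(far s) -> {x : M | A x}) :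
    {x : M | A x} :=
  let: And3 _ funA _ := subA in
  exist A (finterp M s (fun i => sval (a i)))
    (funA s (fun i => sval (a i)) (fun i => svalP (a i))).

Fact sub_inhabited : inhabited {x : M | A x}.
Proof. by case: subA => -[x Ax] _ _; exists; exists x. Qed.

Fact sub_dist_eq0 (x y : {x : M | A x}) : dist (sval x) (sval y) = 0%E <-> x = y.
Proof.
split=> [/dist_eq0|-> //]; last exact/dist_eq0.
by move=> /eq_sig_hprop; apply=> z; exact: Prop_irrelevance.
Qed.

Fact sub_dist_complete (u : nat -> {x : M | A x}) :
  (forall e : R, 0 < e -> exists N, forall m n, (N <= m)%N -> (N <= n)%N ->
     (dist (sval (u m)) (sval (u n)) < e%:E)%E) ->
  exists l : {x : M | A x}, forall e : R, 0 < e -> exists N,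
    forall n, (N <= n)%N -> (dist (sval (u n)) (sval l) < e%:E)%E.
Proof.
move=> /(dist_complete (u := fun n => sval (u n)))[l ul].
have Al : A l by case: subA => _ _; apply; [move=> n; exact: svalP (u n)|].
by exists (exist A l Al).
Qed.

Fact sub_finterp_ucont (s : fsym L) (e : R) (x y : 'I_(far s) -> {x : M | A x}) :
  0 < e ->
  (forall i, (dist (sval (x i)) (sval (y i)) < (fmodulus s e)%:E)%E) ->
  (dist (sval (sub_finterp x)) (sval (sub_finterp y)) <= e%:E)%E.
Proof. by rewrite /sub_finterp; case: subA => _ ? _ e0 xy; exact: finterp_ucont. Qed.

Definition substructure : structure L :=
  {| carrier := {x : M | A x};
     carrier_inhabited := sub_inhabited;
     dist := fun x y => dist (sval x) (sval y);
     finterp := sub_finterp;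
     pinterp := fun s a => pinterp M s (fun i => sval (a i));
     dist_ge0 := fun x y => dist_ge0 (sval x) (sval y);
     dist_eq0 := sub_dist_eq0;
     dist_sym := fun x y => dist_sym (sval x) (sval y);
     dist_triangle := fun x y z => dist_triangle (sval x) (sval y) (sval z);
     dist_complete := sub_dist_complete;
     finterp_ucont := sub_finterp_ucont;
     pinterp_ucont := fun s e x y =>
       @pinterp_ucont R L M s e (fun i => sval (x i)) (fun i => sval (y i)) |}.

End Substructure.

Definition elementary_substructure (R : realType) (L : language R)
    (M : structure L) (A : set M) : Prop :=
  exists subA : is_substructure A,
    @elementary R L (substructure subA) M (fun x => sval x).

(** * Invariant equivalence relations and local components *)

Definition sim (R : realType) (L : language R) (E : set (typ L 2))
    (M : structure L) (x y : M) : Prop := E (tp (pair2 x y)).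

Definition invariant_equivalence (R : realType) (L : language R)
    (T : theory L) (E : set (typ L 2)) : Prop :=
  E `<=` types T 2 /\
  forall M : structure L, models M T -> Equivalence (@sim R L E M).

Definition component (R : realType) (L : language R) (E : set (typ L 2))
    (M : structure L) (x : M) : set M := [set y | sim E x y].

Definition components (R : realType) (L : language R) (E : set (typ L 2))
    (M : structure L) : set (set M) := range (component E (M := M)).

Arguments components {R L} E M _.

Definition weakly_local (R : realType) (L : language R) (T : theory L)
    (E : set (typ L 2)) : Prop :=
  (forall M : structure L, models M T ->
     forall C, components E M C -> elementary_substructure C) /\
  (forall M N : structure L, models M T -> models N T -> forall f : M -> N,
     elementary f <->
     (forall C, components E M C -> elementary_on f C) /\
     (forall x y, sim E (f x) (f y) <-> sim E x y)).

Definition local (R : realType) (L : language R) (E : set (typ L 2))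
    (M : structure L) : Prop := exists C, components E M = [set C].

Definition locally_aleph0_categorical (R : realType) (L : language R)
    (T : theory L) (E : set (typ L 2)) : Prop :=
  [/\ weakly_local T E,
      separable_language L &
      exists M : structure L,
        [/\ models M T, separable_structure M, local E M &
            forall N : structure L, models N T -> separable_structure N ->
              local E N -> isomorphic M N]].

(* The local components of M that are isomorphic to K. *)
Definition components_iso_to (R : realType) (L : language R) (E : set (typ L 2))
    (M K : structure L) : set (set M) :=
  [set C | components E M C /\
     exists subC : is_substructure C, isomorphic (substructure subC) K].

Arguments components_iso_to {R L} E M K _.

(* Main.v *)
(* (2) => (1): in a type that is not isolated, classes can be merged by an
   arbitrarily small perturbation, so isolated types are dense. Merging the class
   of a point with that of a tuple in a given component shows that components
   satisfy the Tarski-Vaught test, hence are elementary; they are atomic because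
   equivalent elements have isolated type, and separable atomic models are
   isomorphic by back-and-forth.

   (1) => (2): a type of pairwise equivalent elements is realised in the unique
   separable local model, which embeds in every model, so it cannot be omitted and
   is isolated. By weak locality the components of a model can be permuted and
   moved independently of one another; hence a type is determined by the
   partition into classes and the restrictions to them. *)
From HB Require Import structures.
From mathcomp Require Import all_boot all_order all_algebra.
From mathcomp Require Import all_classical all_reals all_analysis.
From mathcomp Require Import ring lra zify.
From Stdlib Require Import RelationClasses.
Require Import Defs.

Set Implicit Arguments.
Unset Strict Implicit.
Unset Printing Implicit Defensive.

Import Order.TTheory GRing.Theory Num.Theory.

Local Open Scope classical_set_scope.
Local Open Scope ring_scope.

(** * The compact metric on [-oo, +oo] *)

(** Isolation is an equality of two neighbourhood filters, hard to verify directly. The workable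
    form is [almost_isolated]: each metric ball around the type contains some nonempty open set. A
    Cauchy argument shows that such a type is realised in every model, near every tuple whose type
    is close to it, and this gives isolation back. The price is that every realisation moves its
    parameters a little. So back-and-forth matches only approximations, which agree in the limit,
    and types are proved equal through copies at arbitrarily small distance ([tp_close]).

    Compactness is replaced by completeness of [T] together with ultrapowers over [nat] of a single
    model: completeness provides approximate realisations in that model, and the ultrapower turns a
    sequence of them into an exact one. Omitting types follows this pattern too, which is why its
    requirements must survive limits.

    In (2) => (1), small moves must not leave a component. This rests on a distance below which
    points are equivalent, found first for two points of the same 1-type and then for one of them
    arbitrary. *)

Section Contract.
Variable R : realType.
Implicit Types (x y z : \bar R) (r s e : R).

Lemma egap_sym x y : egap x y = egap y x.
Proof. by rewrite /egap distrC. Qed.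

Lemma egapxx x : egap x x = 0.
Proof. by rewrite /egap subrr normr0. Qed.

Lemma egap_triangle x y z : egap x z <= egap x y + egap y z.
Proof. by rewrite /egap -[X in X - _](subrK (contract y)) -addrA ler_normD. Qed.

Lemma egap_eq x y : (forall e, 0 < e -> egap x y <= e) -> x = y.
Proof.
move=> xy; apply/contract_inj/eqP; rewrite -subr_eq0 -normr_le0.
by apply/ler_addgt0Pr => e e0; rewrite add0r; exact: xy.
Qed.

Lemma nbhs_ereal x (A : set (\bar R)) :
  nbhs x A <-> exists2 e, 0 < e & forall y, egap x y < e -> A y.
Proof. by split=> [/nbhs_ballP[e e0 xA]|[e e0 xA]]; [|apply/nbhs_ballP]; exists e. Qed.

Lemma contract_lt0 x : (contract x < 0) = (x < 0)%E.
Proof. by rewrite -(contract0 R) lt_contract. Qed.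

Lemma contract_EFin_lip r s : `|contract r%:E - contract s%:E| <= `|r - s|.
Proof.
wlog rs : r s / r <= s.
  by move=> H; case: (leP r s) => [/H //|/ltW /H]; rewrite distrC [leRHS]distrC.
rewrite distrC ger0_norm ?subr_ge0 ?le_contract ?lee_fin//.
rewrite distrC (ger0_norm (_ : 0 <= s - r)) ?subr_ge0//= lerBlDr.
rewrite ler_pdivrMr ?ltr_wpDr//.
have r1 : 0 < 1 + `|r| by rewrite ltr_wpDr.
have -> : (s - r + r / (1 + `|r|)) * (1 + `|s|) =
  (s - r) * (1 + `|s|) + r * ((1 + `|s|) / (1 + `|r|)) by ring.
have -> : (1 + `|s|) / (1 + `|r|) = 1 + (`|s| - `|r|) / (1 + `|r|).
  by field; rewrite gt_eqF.
(* This is the claim with its denominators [1 + |r|] and [1 + |s|] cleared and [s - r] subtracted;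
   it is then checked by signs. *)
suff : s * `|r| - r * `|s| <= (s - r) * (1 + `|r|) * (1 + `|s|) - (s - r).
  move=> H.
  have : 0 <= ((s - r) * (1 + `|s|) + r * (1 + (`|s| - `|r|) / (1 + `|r|)) - s) * (1 + `|r|).
    have -> : ((s - r) * (1 + `|s|) + r * (1 + (`|s| - `|r|) / (1 + `|r|)) - s) * (1 + `|r|) =
       (s - r) * (1 + `|s|) * (1 + `|r|) + r * (1 + `|r|) + r * (`|s| - `|r|) - s * (1 + `|r|).
      by field; rewrite gt_eqF.
    by lra.
  by rewrite pmulr_lge0// subr_ge0.
have nr := normr_ge0 r; have ns := normr_ge0 s.
have -> : (s - r) * (1 + `|r|) * (1 + `|s|) - (s - r) =
  (s - r) * (`|r| + `|s|) + (s - r) * (`|r| * `|s|) by ring.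
have : 0 <= (s - r) * (`|r| * `|s|) by rewrite mulr_ge0 ?subr_ge0 ?mulr_ge0.
have : 0 <= (s - r) * (`|r| + `|s|) by rewrite mulr_ge0 ?subr_ge0 ?addr_ge0.
have [r0|r0] := ler0P r; have [s0|s0] := ler0P s; nra.
Qed.

(* Distances may be infinite, hence this form of the triangle inequality. *)
Lemma contract_shift x y r : 0 <= r -> (x <= y + r%:E)%E ->
  contract x <= contract y + r.
Proof.
case: y => [y| |] r0.
- move=> xy; have : contract x <= contract (y + r)%:E by rewrite le_contract.
  move/le_trans; apply; rewrite -lerBlDl.
  apply: le_trans (ler_norm _) _; apply: le_trans (contract_EFin_lip _ _) _.
  by rewrite addrAC subrr add0r ger0_norm.
- move=> _; apply: (@le_trans _ _ 1); last by rewrite lerDl.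
  by have := contract_le1 x; rewrite ler_norml => /andP[].
- by rewrite addNye leeNy_eq => /eqP ->; rewrite lerDl.
Qed.

(** * Neighbourhoods for pointwise convergence *)

Section Ptws.
Variable I : Type.

Lemma ptws_cvgP (F : set_system {ptws I -> \bar R}) (p : {ptws I -> \bar R}) :
  Filter F ->
  F --> p <-> forall i e, 0 < e -> F [set q | egap (p i) (q i) < e].
Proof.
move=> FF; split=> [Fp i e e0|Fp].
  have ie : nbhs (p i) [set y | egap (p i) y < e] by apply/nbhs_ereal; exists e.
  exact/Fp/(@proj_continuous {classic I} (fun=> \bar R) i p _ ie).
apply/cvg_sup => i A [B [[W oW <-] Wp] WA].
have : nbhs (p i) W by rewrite nbhsE; exists W.
move=> /nbhs_ereal[e e0 WE].
by apply: filterS (Fp i e e0) => q /WE; exact: WA.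
Qed.

(** The filter generated by the finite boxes around [p] converges to [p], so it contains every
    neighbourhood. Membership is [List.In] because the index type, later a type of formulas, has no
    boolean equality. *)
Lemma ptws_nbhsP (p : {ptws I -> \bar R}) (A : set {ptws I -> \bar R}) :
  nbhs p A <-> exists (s : seq I) (e : R), 0 < e /\
    forall q, (forall i, List.In i s -> egap (p i) (q i) < e) -> A q.
Proof.
pose bas (s : seq I) (e : R) : set {ptws I -> \bar R} :=
  [set q | forall i, List.In i s -> egap (p i) (q i) < e].
split=> [pA|[s [e [e0 sA]]]].
  pose F : set_system {ptws I -> \bar R} :=
    [set B | exists (s : seq I) (e : R), 0 < e /\ bas s e `<=` B].
  have FF : Filter F.
    split.
    - by exists [::], 1.
    - move=> B C [s [e [e0 sB]]] [t [d [d0 tC]]]; exists (s ++ t), (Num.min e d).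
      split=> [|q qst]; first by rewrite lt_min e0.
      split.
        apply: sB => i si; have := qst i (List.in_or_app _ _ _ (or_introl si)).
        by rewrite lt_min => /andP[].
      apply: tC => i ti; have := qst i (List.in_or_app _ _ _ (or_intror ti)).
      by rewrite lt_min => /andP[].
    - by move=> B C BC [s [e [e0 sB]]]; exists s, e; split=> // q /sB/BC.
  have : F --> p.
    apply/ptws_cvgP => i e e0; exists [:: i], e; split=> // q; apply.
    by left.
  by move=> /(_ _ pA).
have FF : Filter (nbhs p) := @nbhs_filter {ptws I -> \bar R} p.
have H : forall i, nbhs p [set q : {ptws I -> \bar R} | egap (p i) (q i) < e].
  by move=> i; exact: (iffLR (@ptws_cvgP (nbhs p) p FF) (@cvg_id _ (nbhs p)) i e e0).
suff ps : nbhs p (bas s e) by exact: (@filterS _ _ FF _ _ sA ps).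
elim: s {sA} => [|i s IH].
  have -> : bas [::] e = setT by apply/seteqP; split=> // q _ j [].
  exact: (@filterT _ _ FF).
have -> : bas (i :: s) e =
    [set q : {ptws I -> \bar R} | egap (p i) (q i) < e] `&` bas s e.
  apply/seteqP; split=> [q H1|q [iq sq] j [<-//|]]; last exact: sq.
  by split=> [|j sj]; apply: H1; [left|right].
exact: (@filterI _ _ FF _ _ (H i) IH).
Qed.

End Ptws.

Lemma continuous_egapP k (u : {ptws 'I_k -> \bar R} -> \bar R) :
  (forall p e, 0 < e -> exists2 d, 0 < d & forall q,
     (forall i, egap (p i) (q i) < d) -> egap (u p) (u q) < e) ->
  continuous u.
Proof.
move=> H p A /nbhs_ereal[e e0 uA].
have [d d0 {}H] := H p e e0.
rewrite nbhs_simpl; apply/ptws_nbhsP; exists (enum 'I_k), d; split=> // q qd.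
apply: uA; apply: H => i; apply: qd.
have : i \in enum 'I_k by rewrite mem_enum.
by elim: (enum 'I_k) => //= j s IH; rewrite in_cons => /predU1P[->|/IH]; [left|right].
Qed.

(** The connectives below apply a real function to contracted values: infinite values become bounded
    reals, and [contract] keeps signs. *)
Lemma real_conn_continuous k (h : ('I_k -> R) -> R) :
  (forall a e, 0 < e -> exists2 d, 0 < d & forall b,
     (forall i, `|a i - b i| < d) -> `|h a - h b| < e) ->
  continuous (fun v : {ptws 'I_k -> \bar R} => (h (fun i => contract (v i)))%:E).
Proof.
move=> H; apply: continuous_egapP => p e e0.
have [d d0 {}H] := H (fun i => contract (p i)) e e0.
exists d => // q qd; apply: le_lt_trans (contract_EFin_lip _ _) _.
exact: H.
Qed.

End Contract.

Lemma fin_min_pos (R : realType) k (P : 'I_k -> R -> Prop) :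
  (forall i d d', d' <= d -> P i d -> P i d') ->
  (forall i, exists2 d, 0 < d & P i d) -> exists2 d, 0 < d & forall i, P i d.
Proof.
move=> Pmono H.
have /choice[f fP] : forall i, exists d, 0 < d /\ P i d.
  by move=> i; have [d] := H i; exists d.
exists (\big[Order.min/1]_(i < k) f i).
  by apply: lt_bigmin => // i _; have [] := fP i.
by move=> i; apply: Pmono (fP i).2; exact: bigmin_le.
Qed.

(** * Open conditions *)

Section OpenConditions.
Variables (R : realType) (L : language R).
Implicit Types (M N : structure L) (n m k : nat).

Lemma max_conn_continuous :
  continuous (fun v : {ptws 'I_2 -> \bar R} =>
    (Num.max (contract (v ord0)) (contract (v ord_max)))%:E).
Proof.
apply: (@real_conn_continuous R 2 (fun v => Num.max (v ord0) (v ord_max))) => a e e0.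
exists e => // b ab; have := ab ord0; have := ab ord_max.
rewrite !ltr_norml /Num.max => /andP[? ?] /andP[? ?].
by case: (ltP (a ord0)) => ?; case: (ltP (b ord0)) => ?; apply/andP; split; lra.
Qed.

Lemma lt_conn_continuous (s : R) :
  continuous (fun v : {ptws 'I_1 -> \bar R} => (contract (v ord0) - s)%:E).
Proof.
apply: (@real_conn_continuous R 1 (fun v => v ord0 - s)) => a e e0.
by exists e => // b ab; rewrite opprB subrKA.
Qed.

Lemma gt_conn_continuous (s : R) :
  continuous (fun v : {ptws 'I_1 -> \bar R} => (s - contract (v ord0))%:E).
Proof.
apply: (@real_conn_continuous R 1 (fun v => s - v ord0)) => a e e0.
exists e => // b ab; rewrite opprB addrC subrKA distrC; exact: ab.
Qed.

Definition Fmax n (phi psi : fml L n) : fml L n :=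
  Fconn max_conn_continuous (fun i => if i == ord0 then phi else psi).
Definition Flt n (phi : fml L n) (s : R) : fml L n :=
  Fconn (@lt_conn_continuous s) (fun=> phi).
Definition Fgt n (phi : fml L n) (s : R) : fml L n :=
  Fconn (@gt_conn_continuous s) (fun=> phi).

Lemma eval_Fmax n (phi psi : fml L n) M (a : 'I_n -> M) :
  (eval (Fmax phi psi) a < 0)%E <-> (eval phi a < 0)%E /\ (eval psi a < 0)%E.
Proof.
rewrite /= lte_fin gt_max !contract_lt0.
by split=> [/andP[]|[-> ->]].
Qed.

Lemma eval_Flt n (phi : fml L n) s M (a : 'I_n -> M) :
  (eval (Flt phi s) a < 0)%E = (contract (eval phi a) < s).
Proof. by rewrite /= lte_fin subr_lt0. Qed.

Lemma eval_Fgt n (phi : fml L n) s M (a : 'I_n -> M) :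
  (eval (Fgt phi s) a < 0)%E = (s < contract (eval phi a)).
Proof. by rewrite /= lte_fin subr_lt0. Qed.

Lemma eval_Finf_lt n (phi : fml L n.+1) M (a : 'I_n -> M) s :
  (eval (Finf phi) a < s)%E <-> exists x, (eval phi (scons x a) < s)%E.
Proof.
split=> [/ereal_inf_lt[_ [x _ <-] xs]|[x xs]]; first by exists x.
by apply: le_lt_trans xs; apply: ereal_inf_lbound; exists x.
Qed.

(* Conditions [psi < 0] stand for the basic open sets of types. *)
Definition condition n := forall M, ('I_n -> M) -> Prop.

Definition is_open n (P : condition n) := exists psi : fml L n,
  forall M (a : 'I_n -> M), P M a <-> (eval psi a < 0)%E.

Lemma open_ext n (P Q : condition n) :
  (forall M a, P M a <-> Q M a) -> is_open P -> is_open Q.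
Proof. by move=> PQ [psi psiP]; exists psi => M a; rewrite -PQ. Qed.

Lemma open_tp n (P : condition n) M N (a : 'I_n -> M) (b : 'I_n -> N) :
  is_open P -> tp a = tp b -> P M a -> P N b.
Proof.
move=> [psi psiP] ab /psiP aP; apply/psiP.
by rewrite -[eval _ _]/(tp b psi) -ab.
Qed.

Lemma open_lt n (phi : fml L n) s :
  is_open (fun M (a : 'I_n -> M) => contract (eval phi a) < s).
Proof. by exists (Flt phi s) => M a; rewrite eval_Flt. Qed.

Lemma open_gt n (phi : fml L n) s :
  is_open (fun M (a : 'I_n -> M) => s < contract (eval phi a)).
Proof. by exists (Fgt phi s) => M a; rewrite eval_Fgt. Qed.

Lemma open_and n (P Q : condition n) : is_open P -> is_open Q ->
  is_open (fun M a => P M a /\ Q M a).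
Proof.
by move=> [p pP] [q qQ]; exists (Fmax p q) => M a; rewrite eval_Fmax pP qQ.
Qed.

Lemma open_true n : is_open (fun M (a : 'I_n -> M) => True).
Proof.
have conn0 : continuous (fun v : {ptws 'I_0 -> \bar R} => (-1)%:E : \bar R).
  by apply: continuous_egapP => p e e0; exists 1 => // q _; rewrite egapxx.
exists (Fconn conn0 (fun i => match notF (ltn_ord i) with end)) => M a.
by rewrite /= lte_fin oppr_lt0 ltr01.
Qed.

Lemma open_forall n k (P : 'I_k -> condition n) : (forall i, is_open (P i)) ->
  is_open (fun M a => forall i, P i M a).
Proof.
elim: k P => [|k IH] P oP.
  by apply: open_ext (open_true n) => M a; split=> // _ [].
apply: open_ext (open_and (oP ord0) (IH (fun i => P (lift ord0 i)) (fun i => oP _))).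
move=> M a; split=> [[P0 PS] i|H]; last by split.
by case: (unliftP ord0 i) => [j ->|->].
Qed.

Lemma open_gap n (phi : fml L n) x e :
  is_open (fun M (a : 'I_n -> M) => egap x (eval phi a) < e).
Proof.
apply: open_ext (open_and (open_lt phi (contract x + e)) (open_gt phi (contract x - e))).
by move=> M a; rewrite /egap ltr_distlC andbC; split=> [[-> ->]|/andP[]].
Qed.

Lemma open_ren m n (s : 'I_m -> 'I_n) (P : condition m) : is_open P ->
  is_open (fun M (a : 'I_n -> M) => P M (a \o s)).
Proof. by move=> [p pP]; exists (rename p s) => M a; rewrite pP eval_rename. Qed.

Lemma open_ex n (P : condition n.+1) : is_open P ->
  is_open (fun M (a : 'I_n -> M) => exists x, P M (scons x a)).
Proof.
move=> [p pP]; exists (Finf p) => M a.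
by rewrite eval_Finf_lt; split=> -[x xP]; exists x; apply/pP.
Qed.

Lemma open_distt n (t t' : term L n) (e : R) :
  is_open (fun M (a : 'I_n -> M) => (dist (teval a t) (teval a t') < e%:E)%E).
Proof.
apply: open_ext (open_lt (Fdist t t') (contract e%:E)) => M a.
by rewrite -(lt_contract (dist (teval a t) (teval a t')) e%:E).
Qed.

Lemma open_dist n (i j : 'I_n) (e : R) :
  is_open (fun M (a : 'I_n -> M) => (dist (a i) (a j) < e%:E)%E).
Proof. exact: (open_distt (Tvar L i) (Tvar L j)). Qed.

Definition tcat (X : Type) m n (y : 'I_m -> X) (a : 'I_n -> X) (i : 'I_(m + n)) : X :=
  match fintype.split i with inl j => y j | inr k => a k end.

Lemma tcat_lshift (X : Type) m n (y : 'I_m -> X) (a : 'I_n -> X) i :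
  tcat y a (lshift n i) = y i.
Proof. by rewrite /tcat (unsplitK (inl _ i)). Qed.

Lemma tcat_rshift (X : Type) m n (y : 'I_m -> X) (a : 'I_n -> X) i :
  tcat y a (rshift m i) = a i.
Proof. by rewrite /tcat (unsplitK (inr _ i)). Qed.

Lemma scons0 (X : Type) n (x : X) (a : 'I_n -> X) : scons x a ord0 = x.
Proof. by rewrite /scons unlift_none. Qed.

Lemma scons_lift (X : Type) n (x : X) (a : 'I_n -> X) i :
  scons x a (lift ord0 i) = a i.
Proof. by rewrite /scons liftK. Qed.

Lemma tcat_scons (X : Type) m n x (y : 'I_m -> X) (a : 'I_n -> X) :
  tcat (scons x y) a = scons x (tcat y a).
Proof.
apply: funext => i; case: (split_ordP (i : 'I_(m.+1 + n))) => j ->.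
  rewrite tcat_lshift; case: (unliftP ord0 j) => [k ->|->].
    rewrite scons_lift (_ : lshift n (lift ord0 k) = lift ord0 (lshift n k)); last exact/val_inj.
    by rewrite scons_lift tcat_lshift.
  rewrite scons0 (_ : lshift n ord0 = ord0); last exact/val_inj.
  by rewrite scons0.
rewrite tcat_rshift (_ : rshift m.+1 j = lift ord0 (rshift m j)); last exact/val_inj.
by rewrite scons_lift tcat_rshift.
Qed.

Lemma scons_eta (X : Type) n (a : 'I_n.+1 -> X) :
  a = scons (a ord0) (fun i => a (lift ord0 i)).
Proof.
apply: funext => i; case: (unliftP ord0 i) => [j ->|->].
  by rewrite scons_lift.
by rewrite scons0.
Qed.

Lemma open_exn m n (P : condition (m + n)) : is_open P ->
  is_open (fun M (a : 'I_n -> M) => exists y : 'I_m -> M, P M (tcat y a)).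
Proof.
elim: m P => [|m IH] P oP.
  apply: open_ext oP => M a.
  have aE (y : 'I_0 -> M) : tcat y a = a.
    by apply: funext => i; rewrite -[RHS](tcat_rshift y); congr tcat; exact/val_inj.
  by split=> [aP|[y]]; rewrite ?aE//; exists (fun i : 'I_0 => match notF (ltn_ord i) with end); rewrite aE.
apply: open_ext (IH _ (open_ex (oP : @is_open (m + n).+1 P))) => M a.
split=> [[y [x xyP]]|[y yP]].
  by exists (scons x y); rewrite tcat_scons.
by exists (fun i => y (lift ord0 i)), (y ord0); rewrite -tcat_scons -scons_eta.
Qed.

(** Metric enlargements of open conditions are open, so a nearby witness can be transported to any
    tuple of the same type. The maps [s] and [t] select the entries to be compared; the other
    entries of the witness are free. *)
Lemma open_near m n k (P : condition m) (s : 'I_k -> 'I_m) (t : 'I_k -> 'I_n) (e : R) :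
  is_open P ->
  is_open (fun M (a : 'I_n -> M) => exists y : 'I_m -> M,
    P M y /\ forall i, (dist (y (s i)) (a (t i)) < e%:E)%E).
Proof.
move=> oP.
pose Q : condition (m + n) := fun M z => P M (z \o lshift n) /\
  forall i, (dist (z (lshift n (s i))) (z (rshift m (t i))) < e%:E)%E.
have oQ : is_open Q.
  apply: open_and; first exact: open_ren.
  by apply: open_forall => i; exact: open_dist.
apply: open_ext (open_exn oQ) => M a.
have E (y : 'I_m -> M) : tcat y a \o lshift n = y.
  by apply: funext => i /=; rewrite tcat_lshift.
split=> -[y [yP yd]]; exists y; rewrite /Q ?E in yP *; split=> // i.
  by have := yd i; rewrite tcat_lshift tcat_rshift.
by rewrite tcat_lshift tcat_rshift.
Qed.

End OpenConditions.

(** * Uniform continuity of formulas *)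

Section UniformContinuity.
Variables (R : realType) (L : language R).
Implicit Types (M N : structure L) (n m k : nat).

Lemma dist_xx M (x : M) : dist x x = 0%E.
Proof. exact/dist_eq0. Qed.

Lemma teval_ucont n (t : term L n) (e : R) : 0 < e ->
  exists2 d : R, 0 < d & forall M (a b : 'I_n -> M),
    (forall i, (dist (a i) (b i) < d%:E)%E) ->
    (dist (teval a t) (teval b t) < e%:E)%E.
Proof.
elim: t e => [i|s ts IH] e e0 /=; first by exists e.
(* The continuity axiom concludes with a non-strict inequality; halving [e] makes the bound
   strict. *)
have e20 : 0 < e / 2 by rewrite divr_gt0.
have [|i|d d0 H] := @fin_min_pos R _ (fun i d => forall M (a b : 'I_n -> M),
    (forall i, (dist (a i) (b i) < d%:E)%E) ->
    (dist (teval a (ts i)) (teval b (ts i)) < (fmodulus s (e / 2))%:E)%E).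
- move=> i d d' d'd H M a b ab; apply: H => j; apply: lt_le_trans (ab j) _.
  by rewrite lee_fin.
- exact/IH/fmodulus_gt0.
exists d => // M a b ab.
apply: (@le_lt_trans _ _ (e / 2)%:E); last by rewrite lte_fin; lra.
by apply: finterp_ucont => // i; exact: H.
Qed.

Lemma egap_le (x y : \bar R) (e : R) :
  contract x <= contract y + e -> contract y <= contract x + e -> egap x y <= e.
Proof. by move=> xy yx; rewrite /egap ler_distl; apply/andP; split; lra. Qed.

Lemma egap_le_expand (x y : \bar R) (e : R) : egap x y <= e ->
  contract x <= contract y + e /\ contract y <= contract x + e.
Proof. by rewrite /egap ler_distl => /andP[]; split; lra. Qed.

Lemma dist_gap M (x x' y y' : M) (e : R) :
  (dist x x' < e%:E)%E -> (dist y y' < e%:E)%E ->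
  egap (dist x y) (dist x' y') <= 2 * e.
Proof.
have half (u u' v v' : M) : (dist u u' < e%:E)%E -> (dist v v' < e%:E)%E ->
    contract (dist u v) <= contract (dist u' v') + 2 * e.
  move=> uu' vv'.
  have e0 : 0 <= e by rewrite -lee_fin (le_trans (dist_ge0 u u')) ?ltW.
  apply: contract_shift; first by rewrite mulr_ge0.
  apply: le_trans (dist_triangle u u' v) _.
  apply: (@le_trans _ _ (dist u u' + (dist u' v' + dist v' v))%E).
    by rewrite leeD2l ?dist_triangle.
  rewrite addeCA leeD2l// mulr_natl mulr2n EFinD; apply: leeD; first exact: ltW.
  by rewrite dist_sym; exact: ltW.
move=> xx' yy'; apply: egap_le; first exact: half.
by apply: half; rewrite dist_sym.
Qed.

Lemma egap_sup (T : Type) (f g : T -> \bar R) (e : R) : 0 <= e ->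
  inhabited T -> (forall x, egap (f x) (g x) <= e) ->
  egap (ereal_sup [set f x | x in [set: T]]) (ereal_sup [set g x | x in [set: T]]) <= e.
Proof.
move=> e0 [x0] fg.
have ne (h : T -> \bar R) : [set h x | x in [set: T]] !=set0 by exists (h x0), x0.
have half (h k : T -> \bar R) : (forall x, contract (h x) <= contract (k x) + e) ->
    contract (ereal_sup [set h x | x in [set: T]]) <=
    contract (ereal_sup [set k x | x in [set: T]]) + e.
  move=> hk; rewrite [leLHS]contract_sup//; apply: ge_sup; first by case: (ne h) => y ?; exists (contract y), y.
  move=> _ [_ [x _ <-] <-]; apply: le_trans (hk x) _; rewrite lerD2r le_contract.
  by apply: ereal_sup_ubound; exists x.
by apply: egap_le; apply: half => x; have [] := egap_le_expand (fg x).
Qed.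

Lemma egap_opp (x y : \bar R) : egap (- x)%E (- y)%E = egap x y.
Proof. by rewrite /egap !contractN -opprD normrN. Qed.

Lemma ereal_inf_opp (T : Type) (f : T -> \bar R) :
  ereal_inf [set f x | x in [set: T]] = (- ereal_sup [set (- f x) | x in [set: T]])%E.
Proof.
rewrite /ereal_inf; congr (- ereal_sup _)%E; apply/seteqP; split.
  by move=> _ [_ [x _ <-] <-]; exists x.
by move=> _ [x _ <-]; exists (f x) => //; exists x.
Qed.

Lemma egap_inf (T : Type) (f g : T -> \bar R) (e : R) : 0 <= e ->
  inhabited T -> (forall x, egap (f x) (g x) <= e) ->
  egap (ereal_inf [set f x | x in [set: T]]) (ereal_inf [set g x | x in [set: T]]) <= e.
Proof.
move=> e0 T0 fg; rewrite !ereal_inf_opp egap_opp; apply: egap_sup => // x.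
by rewrite egap_opp.
Qed.

(* An ultralimit exists because [-oo, +oo] is a complete linear order. *)
Lemma ultra_ereal_cvg (T : Type) (U : set_system T) (f : T -> \bar R) :
  UltraFilter U -> exists l, forall e, 0 < e -> U [set k | egap l (f k) < e].
Proof.
move=> UU; have PU : ProperFilter U by exact: ultra_proper.
pose S := [set r : \bar R | U [set k | (r <= f k)%E]].
exists (ereal_sup S) => e e0; set l := ereal_sup S.
have up : U [set k | contract l - e < contract (f k)].
  have [cl|cl] := leP (contract l - e) (-1 - e / 2).
    apply: filterS (@filterT _ U _) => k _ /=; apply: le_lt_trans cl _.
    by have := contract_le1 (f k); rewrite ler_norml => /andP[]; lra.
  have cl1 := contract_le1 l; rewrite ler_norml in cl1; case/andP: cl1 => cl1 cl2.
  (* [expand] inverts [contract] only on [-1, 1], hence the truncation at -1. If [contract l] is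
     itself -1, the lower bound is automatic. *)
  pose r := Num.max (-1) (contract l - e / 2).
  have r1 : `|r| <= 1.
    by rewrite ler_norml /r le_max lexx/= ge_max; apply/andP; split; lra.
  have [lN|lN] := eqVneq (contract l) (-1).
    apply: filterS (@filterT _ U _) => k _ /=.
    by have := contract_le1 (f k); rewrite ler_norml => /andP[]; lra.
  have rl : (expand r < l)%E.
    rewrite -(contractK l) lt_expand ?inE ?contract_le1//.
    by rewrite /r gt_max lt_neqAle eq_sym lN cl1/=; lra.
  have [s Ss rs] := ereal_sup_gt rl.
  apply: filterS Ss => k /= sk; have : contract s <= contract (f k) by rewrite le_contract.
  have : contract (expand r) < contract s by rewrite lt_contract.
  rewrite expandK ?inE//; have : contract l - e / 2 <= r by rewrite /r le_max lexx orbT.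
  lra.
have dn : U [set k | contract (f k) < contract l + e].
  have cl1 := contract_le1 l; rewrite ler_norml in cl1; case/andP: cl1 => cl1 cl2.
  pose r := Num.min 1 (contract l + e / 2).
  have r1 : `|r| <= 1.
    by rewrite ler_norml /r ge_min lexx/= le_min; apply/andP; split; lra.
  have [l1|l1] := eqVneq (contract l) 1.
    apply: filterS (@filterT _ U _) => k _ /=.
    by have := contract_le1 (f k); rewrite ler_norml => /andP[]; lra.
  have lr : (l < expand r)%E.
    rewrite -(contractK l) lt_expand ?inE ?contract_le1//.
    by rewrite /r lt_min lt_neqAle l1 cl2/=; lra.
  have [Sr|Sr] := in_ultra_setVsetC [set k | (expand r <= f k)%E] UU.
    have : (expand r <= l)%E by exact: ereal_sup_ubound.
    by rewrite leNgt lr.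
  apply: filterS Sr => k /= /negP; rewrite -ltNge => sk.
  have : contract (f k) < contract (expand r) by rewrite lt_contract.
  rewrite expandK ?inE//; have : r <= contract l + e / 2 by rewrite /r ge_min lexx orbT.
  lra.
apply: filterS (filterI up dn) => k /= [? ?].
by rewrite /egap ltr_distl; apply/andP; split; lra.
Qed.

Lemma ultra_eventually : exists2 U : set_system nat, UltraFilter U &
  forall k0, U [set k | (k0 <= k)%N].
Proof.
have [U [UU sU]] := @ultraFilterLemma nat \oo _.
by exists U => // k0; apply: sU; exists k0.
Qed.

(** Heine-Cantor on the compact cube: counterexamples at distance tending to 0 have a common limit
    along an ultrafilter, where continuity of [u] makes both values close to the same one. *)
Lemma conn_ucont k (u : {ptws 'I_k -> \bar R} -> \bar R) (e : R) :
  continuous u -> 0 < e -> exists2 d, 0 < d & forall p q,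
    (forall i, egap (p i) (q i) < d) -> egap (u p) (u q) <= e.
Proof.
move=> cu e0; apply: contrapT => nH.
have {}nH (m : nat) : exists pq : {ptws 'I_k -> \bar R} * {ptws 'I_k -> \bar R},
    (forall i, egap (pq.1 i) (pq.2 i) < m.+1%:R^-1) /\ e < egap (u pq.1) (u pq.2).
  apply: contrapT => nm; apply: nH; exists m.+1%:R^-1; first by rewrite invr_gt0.
  move=> p q pq; rewrite leNgt; apply/negP => epq; apply: nm; by exists (p, q).
have [f fP] := choice nH.
have [U UU Uoo] := ultra_eventually; have PU : ProperFilter U by exact: ultra_proper.
have [l lP] := choice (fun i => ultra_ereal_cvg (fun m => (f m).1 i) UU).
have close (g : nat -> {ptws 'I_k -> \bar R}) :
    (forall i e, 0 < e -> U [set m | egap (l i) (g m i) < e]) ->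
    U [set m | egap (u l) (u (g m)) < e / 2].
  move=> gl.
  have gl' : g @ U --> (l : {ptws 'I_k -> \bar R}).
    by apply/ptws_cvgP => i d d0; exact: gl.
  have nl : nbhs (u l) [set y | egap (u l) y < e / 2].
    by apply/nbhs_ereal; exists (e / 2) => //; rewrite divr_gt0.
  exact: (gl' _ (cu l _ nl)).
have U1 : U [set m | egap (u l) (u (f m).1) < e / 2] by exact: close.
have U2 : U [set m | egap (u l) (u (f m).2) < e / 2].
  apply: close => i d d0.
  have d20 : 0 < d / 2 by rewrite divr_gt0.
  have [k0 k0d] : exists k0, k0.+1%:R^-1 < d / 2.
    have [k0 _ H] := near_infty_natSinv_lt (PosNum d20).
    by exists k0; apply: (H k0 (leqnn k0)).
  apply: filterS (filterI (lP i _ d20) (Uoo k0)) => m /= [H1 H2].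
  apply: le_lt_trans (egap_triangle _ ((f m).1 i) _) _.
  have [/(_ i) H3 _] := fP m.
  have H4 : m.+1%:R^-1 <= k0.+1%:R^-1 :> R by rewrite lef_pV2 ?posrE// ler_nat.
  rewrite [ltRHS]splitr; apply: ltrD => //; apply: lt_trans H3 _.
  exact: le_lt_trans k0d.
have [m [m1 m2]] := filter_ex (filterI U1 U2).
have [_ H] := fP m; have := egap_triangle (u (f m).1) (u l) (u (f m).2).
by rewrite (egap_sym (u (f m).1) (u l)); move: m1 m2 H => /=; lra.
Qed.

(** The bound [d] serves all structures at once because the moduli belong to the language. This is
    what lets copies of a tuple in different models be compared. *)
Lemma eval_ucont n (phi : fml L n) (e : R) : 0 < e ->
  exists2 d : R, 0 < d & forall M (a b : 'I_n -> M),
    (forall i, (dist (a i) (b i) < d%:E)%E) ->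
    egap (eval phi a) (eval phi b) <= e.
Proof.
have scons_close m M (a b : 'I_m -> M) x (d : R) : 0 < d ->
    (forall i, (dist (a i) (b i) < d%:E)%E) ->
    forall i, (dist (scons x a i) (scons x b i) < d%:E)%E.
  move=> d0 ab i; case: (unliftP ord0 i) => [j ->|->].
    by rewrite !scons_lift.
  by rewrite !scons0 dist_xx lte_fin.
elim: phi e => {n} [n t1 t2|n s ts|n k u cu args IH|n psi IH|n psi IH] e e0 /=.
- have e40 : 0 < e / 2 by rewrite divr_gt0.
  have [d d0 dP] := teval_ucont t1 e40; have [d' d'0 d'P] := teval_ucont t2 e40.
  exists (Num.min d d'); first by rewrite lt_min d0.
  move=> M a b ab; have -> : e = 2 * (e / 2) by rewrite mulrCA divff// mulr1.
  apply: dist_gap; [apply: dP|apply: d'P] => i; apply: lt_le_trans (ab i) _.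
    by rewrite lee_fin ge_min lexx.
  by rewrite lee_fin ge_min lexx orbT.
- have [|i|d d0 H] := @fin_min_pos R _ (fun i d => forall M (a b : 'I_n -> M),
      (forall i, (dist (a i) (b i) < d%:E)%E) ->
      (dist (teval a (ts i)) (teval b (ts i)) < (pmodulus s e)%:E)%E).
  + move=> i d d' d'd H M a b ab; apply: H => j; apply: lt_le_trans (ab j) _.
    by rewrite lee_fin.
  + exact/teval_ucont/pmodulus_gt0.
  by exists d => // M a b ab; apply: pinterp_ucont => // i; exact: H.
- have [d d0 dP] := conn_ucont cu e0.
  have [|i|d' d'0 H] := @fin_min_pos R _ (fun i d' => forall M (a b : 'I_n -> M),
      (forall i, (dist (a i) (b i) < d'%:E)%E) ->
      egap (eval (args i) a) (eval (args i) b) < d).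
  + move=> i d1 d' d'd H M a b ab; apply: H => j; apply: lt_le_trans (ab j) _.
    by rewrite lee_fin.
  + have d20 : 0 < d / 2 by rewrite divr_gt0.
    have [d' d'0 d'P] := IH i _ d20; exists d' => // M a b ab.
    by apply: le_lt_trans (d'P _ _ _ ab) _; lra.
  by exists d' => // M a b ab; apply: dP => i; exact: H.
- have [d d0 dP] := IH e e0; exists d => // M a b ab.
  apply: egap_sup => [|| x]; [exact: ltW|exact: carrier_inhabited|].
  exact/dP/scons_close.
- have [d d0 dP] := IH e e0; exists d => // M a b ab.
  apply: egap_inf => [|| x]; [exact: ltW|exact: carrier_inhabited|].
  exact/dP/scons_close.
Qed.

End UniformContinuity.

(** * Isolated types *)

Section Types.
Variables (R : realType) (L : language R).
Implicit Types (M N : structure L) (n m k : nat) (T : theory L).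

Lemma dist_lt_triangle M (x y z : M) (e d : R) :
  (dist x y < e%:E)%E -> (dist y z < d%:E)%E -> (dist x z < (e + d)%:E)%E.
Proof.
move=> xy yz; apply: le_lt_trans (dist_triangle x y z) _.
by rewrite EFinD; exact: lteD.
Qed.

Lemma dist_lt_trans M (x y : M) (e d : R) :
  (dist x y < e%:E)%E -> e <= d -> (dist x y < d%:E)%E.
Proof. by move=> xy ed; apply: lt_le_trans xy _; rewrite lee_fin. Qed.

Lemma dist_small_eq M (x y : M) :
  (forall e : R, 0 < e -> (dist x y < e%:E)%E) -> x = y.
Proof.
move=> xy; apply/dist_eq0/eqP; rewrite eq_le dist_ge0 andbT.
by apply/lee_addgt0Pr => e e0; rewrite add0e ltW// xy.
Qed.

Definition close M n (a b : 'I_n -> M) (e : R) : Prop :=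
  forall i, (dist (a i) (b i) < e%:E)%E.

Lemma close_refl M n (a : 'I_n -> M) e : 0 < e -> close a a e.
Proof. by move=> e0 i; rewrite dist_xx lte_fin. Qed.

Lemma close_sym M n (a b : 'I_n -> M) e : close a b e -> close b a e.
Proof. by move=> ab i; rewrite dist_sym. Qed.

Lemma close_trans M n (a b c : 'I_n -> M) e d :
  close a b e -> close b c d -> close a c (e + d).
Proof. by move=> ab bc i; exact: dist_lt_triangle (ab i) (bc i). Qed.

Lemma close_le M n (a b : 'I_n -> M) e d : close a b e -> e <= d -> close a b d.
Proof. by move=> ab ed i; exact: dist_lt_trans (ab i) ed. Qed.

Lemma half_pow_small (e d : R) : 0 < d -> exists k, e / 2 ^+ k < d.
Proof.
move=> d0; have [e0|e0] := leP e 0.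
  by exists 0; rewrite expr0 divr1; exact: le_lt_trans d0.
have ed0 : 0 < d / e by rewrite divr_gt0.
have [k _ kP] := near_infty_natSinv_expn_lt (PosNum ed0).
exists k; have := kP k (leqnn k); rewrite /= -div1r => H.
by rewrite mulrC -ltr_pdivlMr// -div1r.
Qed.

Lemma cauchy_limit M (u : nat -> M) (e : R) : 0 < e ->
  (forall k, (dist (u k) (u k.+1) < (e / 2 ^+ k)%:E)%E) ->
  exists l, forall k, (dist (u k) l < (3 * e / 2 ^+ k)%:E)%E.
Proof.
move=> e0 uP.
have e2 k : 0 < e / 2 ^+ k by rewrite divr_gt0// exprn_gt0.
have far j k : (dist (u k) (u (k + j)%N) < (2 * e / 2 ^+ k)%:E)%E.
  elim: j k => [|j IH] k.
    by rewrite addn0 dist_xx lte_fin -mulrA mulr_gt0.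
  apply: dist_lt_trans (dist_lt_triangle (uP k) _) _.
    by rewrite -addSnnS; exact: IH.
  rewrite exprS invfM mulrACA divff// mul1r.
  lra.
have [|l lP] := @dist_complete _ _ M u.
  move=> d d0; have [k kd] := half_pow_small (4 * e) d0.
  exists k => m n km kn; have := far (m - k)%N k; have := far (n - k)%N k.
  rewrite !subnKC// => kn' km'; rewrite dist_sym in km'.
  by apply: dist_lt_trans (dist_lt_triangle km' kn') _; lra.
exists l => k; have [n0 n0P] := lP _ (e2 k).
have := far (maxn n0 k - k)%N k; rewrite subnKC ?leq_maxr// => H.
apply: dist_lt_trans (dist_lt_triangle H (n0P _ (leq_maxl n0 k))) _; lra.
Qed.

Lemma cauchy_limit_tuple M n (u : nat -> 'I_n -> M) (e : R) : 0 < e ->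
  (forall k, close (u k) (u k.+1) (e / 2 ^+ k)) ->
  exists l, forall k, close (u k) l (3 * e / 2 ^+ k).
Proof.
move=> e0 uP.
have /choice[l lP] : forall i, exists l, forall k,
    (dist (u k i) l < (3 * e / 2 ^+ k)%:E)%E.
  by move=> i; apply: (@cauchy_limit M (fun k => u k i)) => // k; exact: uP.
by exists l => k i.
Qed.

Lemma tp_eqP M N n (a : 'I_n -> M) (b : 'I_n -> N) :
  tp a = tp b <-> forall phi : fml L n, eval phi a = eval phi b.
Proof.
split=> [ab phi|ab]; last exact: funext.
by rewrite -[LHS]/(tp a phi) ab.
Qed.

Lemma tp_comp M N m n (a : 'I_n -> M) (b : 'I_n -> N) (s : 'I_m -> 'I_n) :
  tp a = tp b -> tp (a \o s) = tp (b \o s).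
Proof.
move=> /tp_eqP ab; apply/tp_eqP => phi.
by rewrite -(eval_rename phi s a) -(eval_rename phi s b).
Qed.

Lemma tp_dist M N n (a : 'I_n -> M) (b : 'I_n -> N) i j :
  tp a = tp b -> dist (a i) (a j) = dist (b i) (b j).
Proof. by move=> /tp_eqP /(_ (Fdist (Tvar L i) (Tvar L j))). Qed.

Lemma pair2_comp (X : Type) n (a : 'I_n -> X) i j :
  a \o pair2 i j = pair2 (a i) (a j).
Proof. by apply: funext => k; rewrite /pair2 /=; case: ifP. Qed.

Lemma tp_pair2 M N n (a : 'I_n -> M) (b : 'I_n -> N) i j :
  tp a = tp b -> tp (pair2 (a i) (a j)) = tp (pair2 (b i) (b j)).
Proof. by move=> ab; rewrite -!pair2_comp; exact: tp_comp. Qed.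

(** The copies may live in a structure that depends on [e]: uniform continuity bounds the gap
    between the values of each formula in terms of [e] alone. *)
Lemma tp_close M N n (a : 'I_n -> M) (b : 'I_n -> N) :
  (forall e, 0 < e -> exists N' (a' b' : 'I_n -> N'),
     [/\ tp a' = tp a, tp b' = tp b & close a' b' e]) -> tp a = tp b.
Proof.
move=> H; apply/tp_eqP => phi; apply: egap_eq => e e0.
have [d d0 dP] := eval_ucont phi e0; have [N' [a' [b' [aa bb ab]]]] := H d d0.
by rewrite -(iffLR (tp_eqP _ _) aa) -(iffLR (tp_eqP _ _) bb); exact: dP.
Qed.

(** The defining formula is negative at [a]. Asking for half of its contracted value there leaves a
    margin, which uniform continuity converts into a distance valid in all structures. *)
Lemma open_shrink n (P : condition L n) M (a : 'I_n -> M) :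
  is_open P -> P M a -> exists (P0 : condition L n) (d : R),
  [/\ is_open P0, 0 < d, P0 M a &
      forall N (b b' : 'I_n -> N), P0 N b -> close b b' d -> P N b'].
Proof.
move=> [psi psiP] /psiP Pa; set c := contract (eval psi a).
have c0 : c < 0 by rewrite /c contract_lt0.
have [|d d0 dP] := @eval_ucont R L n psi (- c / 4); first by lra.
exists (fun N b => contract (eval psi b) < c / 2), d.
split=> //; [exact: open_lt|by rewrite -/c; lra|].
move=> N b b' bc bb'; apply/psiP; rewrite -contract_lt0.
by have [_] := egap_le_expand (dP N b b' bb'); lra.
Qed.

(** This says that the metric topology on types refines the logic topology. *)
Lemma open_stable n (P : condition L n) M (a : 'I_n -> M) :
  is_open P -> P M a -> exists2 d : R, 0 < d &
  forall N (a' b : 'I_n -> N), tp a = tp a' -> close a' b d -> P N b.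
Proof.
move=> oP Pa; have [P0 [d [oP0 d0 P0a dP]]] := open_shrink oP Pa.
exists d => // N a' b aa'; apply: dP; exact: (open_tp oP0 aa').
Qed.

Lemma open_list n (s : seq (fml L n)) (p : typ L n) e :
  is_open (fun M (a : 'I_n -> M) =>
    forall phi, List.In phi s -> egap (p phi) (eval phi a) < e).
Proof.
elim: s => [|phi s IH]; first by apply: open_ext (open_true L n) => M a; split.
apply: open_ext (open_and (open_gap phi (p phi) e) IH) => M a.
split=> [[pa sa] psi [<-//|]|H]; first exact: sa.
by split=> [|psi ps]; apply: H; [left|right].
Qed.

Lemma nbhs_open n M (a : 'I_n -> M) (U : set (typ L n)) T :
  within (types T n) (nbhs (tp a : typ L n)) U <->
  exists P : condition L n, [/\ is_open P, P M a &
    forall N (b : 'I_n -> N), models N T -> P N b -> U (tp b)].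
Proof.
split=> [/ptws_nbhsP[s [e [e0 sU]]]|[P [[psi psiP] Pa PU]]].
  exists (fun N b => forall phi, List.In phi s -> egap (tp a phi) (eval phi b) < e).
  split; [exact: open_list|by move=> phi _; rewrite egapxx|].
  by move=> N b NT H; apply: (sU (tp b)) => //; exists N; split=> //; exists b.
apply/ptws_nbhsP; exists [:: psi], (- contract (eval psi a)); split.
  by rewrite oppr_gt0 contract_lt0; exact/psiP.
move=> q /(_ psi (or_introl erefl)) + [N [NT [b qb]]]; rewrite qb => H.
apply: PU => //; apply/psiP; rewrite -contract_lt0.
by move: H; rewrite /egap /tp ltr_distlC => /andP[_]; lra.
Qed.

Lemma dist_typ_ltP T n (p q : typ L n) (e : R) : 0 < e ->
  (dist_typ T p q < e%:E)%E <-> exists M, models M T /\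
    exists a b : 'I_n -> M, [/\ tp a = p, tp b = q & close a b e].
Proof.
move=> e0; split=> [/ereal_inf_lt[_ [M [MT [a [b [ap bq ->]]]]] abe]|].
  exists M; split=> //; exists a, b; split=> // i; apply: le_lt_trans abe.
  exact: (le_bigmax _ (fun i => dist (a i) (b i))).
move=> [M [MT [a [b [ap bq ab]]]]].
apply: (@le_lt_trans _ _ (\big[maxe/0%E]_(i < n) dist (a i) (b i))).
  by apply: ereal_inf_lbound; exists M; split=> //; exists a, b.
by apply: bigmax_lt => [|i _]; [rewrite lte_fin|exact: ab].
Qed.

(** One inclusion between the two neighbourhood filters always holds, by [open_stable]. What
    isolation adds is that metric balls are logic neighbourhoods. *)
Lemma isolatedP T n M (a : 'I_n -> M) : isolated_typ T (tp a) <->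
  types T n (tp a) /\ forall e, 0 < e -> exists P : condition L n,
    [/\ is_open P, P M a & forall N (b : 'I_n -> N),
      models N T -> P N b -> (dist_typ T (tp a) (tp b) < e%:E)%E].
Proof.
split=> [[ta H]|[ta H]]; split=> //.
  move=> e e0; have [_] := H [set q | (dist_typ T (tp a) q < e%:E)%E].
  by move=> /(_ (ex_intro2 _ _ e e0 (fun q _ h => h))) /nbhs_open.
move=> U; rewrite nbhs_open; split=> [[P [oP Pa PU]]|[e e0 eU]].
  have [d d0 dP] := open_stable oP Pa; exists d => // q tq.
  move=> /(dist_typ_ltP _ _ _ d0)[N [NT [a' [b [a'p bq ab]]]]].
  by rewrite -bq; apply: PU => //; exact: (dP N a').
have [P [oP Pa PU]] := H e e0; exists P; split=> // N b NT Pb.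
by apply: eU; [exists N; split=> //; exists b|exact: PU].
Qed.

Lemma open_around n (P : condition L n) e : is_open P ->
  is_open (fun M (a : 'I_n -> M) => exists y, P M y /\ close y a e).
Proof. exact: (@open_near R L n n n P id id e). Qed.

(* A priori weaker than [isolated_typ]: balls around the type have nonempty
   interior, but the type itself need not be in these interiors. *)
Definition almost_isolated T n (p : typ L n) : Prop :=
  forall e, 0 < e -> exists P : condition L n, [/\ is_open P,
    (exists M, models M T /\ exists a : 'I_n -> M, P M a) &
    forall N (b : 'I_n -> N), models N T -> P N b -> (dist_typ T p (tp b) < e%:E)%E].

Lemma isolated_almost T n (p : typ L n) :
  isolated_typ T p -> almost_isolated T p.
Proof.
move=> /[dup] [[[M [MT [a ->]]] _]] /isolatedP[_ H] e e0.
have [P [oP Pa PU]] := H e e0; exists P; split=> //.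
by exists M; split=> //; exists a.
Qed.

Lemma tp_of_limit T n M N (b : 'I_n -> N) (u : nat -> 'I_n -> M) l (e : nat -> R) :
  (forall d, 0 < d -> exists k, e k < d) -> (forall k, 0 < e k) ->
  (forall k, (dist_typ T (tp b) (tp (u k)) < (e k)%:E)%E) ->
  (forall k, close (u k) l (e k)) -> tp l = tp b.
Proof.
move=> esm e0 ub ul; apply/tp_eqP => phi; apply: egap_eq => d d0.
have d20 : 0 < d / 2 by rewrite divr_gt0.
have [c c0 cP] := eval_ucont phi d20; have [k kc] := esm c c0.
apply: le_trans (egap_triangle _ (eval phi (u k)) _) _; rewrite [leRHS]splitr.
apply: lerD.
  by rewrite egap_sym; apply: cP; apply: close_le (ul k) (ltW kc).
have /(dist_typ_ltP _ _ _ (e0 k))[N' [_ [b' [u' [bb uu b'u']]]]] := ub k.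
rewrite -(iffLR (tp_eqP _ _) bb) -(iffLR (tp_eqP _ _) uu) egap_sym; apply: cP.
exact: close_le b'u' (ltW kc).
Qed.

(** Starting from [c], each move halves the bound on the distance from the current type to [p], and
    the limit realises [p]. The moves have size at most [2 * e / 2 ^+ k], and [cauchy_limit_tuple]
    multiplies by 3: hence the factor 6. *)
Lemma almost_isolated_realise T n (p : typ L n) M (c : 'I_n -> M) (e : R) :
  (exists N (b : 'I_n -> N), tp b = p) -> almost_isolated T p -> models M T -> 0 < e ->
  (dist_typ T p (tp c) < e%:E)%E ->
  exists2 b : 'I_n -> M, tp b = p & close c b (6 * e).
Proof.
move=> [N [b bp]] ip MT e0 cp.
(* A copy of [x] has a realisation of [p] within [d]. In another model, a realisation of [p] has
   within [d'] a tuple of an open set contained in the [d']-ball around [p]. Equality of types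
   brings this tuple to the first model, and openness brings it to [M]. *)
have step (x : 'I_n -> M) (d d' : R) : 0 < d -> 0 < d' ->
    (dist_typ T p (tp x) < d%:E)%E ->
    exists y : 'I_n -> M, (dist_typ T p (tp y) < d'%:E)%E /\ close x y (d + d').
  move=> d0 d'0 /(dist_typ_ltP _ _ _ d0)[M1 [M1T [z [x' [zp xx' zx']]]]].
  have [P [oP [M0 [M0T [a0 Pa0]]] PU]] := ip d' d'0.
  have /(dist_typ_ltP _ _ _ d'0)[M2 [M2T [z' [y' [zp' yy' zy']]]]] := PU _ _ M0T Pa0.
  have [y [Py yz]] : exists y : 'I_n -> M1, P M1 y /\ close y z d'.
    apply: (open_tp (open_around d' oP) (_ : tp z' = tp z)); first by rewrite zp zp'.
    exists y'; split; last exact: close_sym.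
    exact: (open_tp oP (esym yy')).
  have [y1 [Py1 yx1]] : exists y : 'I_n -> M, P M y /\ close y x (d + d').
    apply: (open_tp (open_around (d + d') oP) xx').
    exists y; split => //; rewrite addrC; exact: close_trans yz zx'.
  exists y1; split; last exact: close_sym.
  exact: PU.
have e2 k : 0 < e / 2 ^+ k by rewrite divr_gt0// exprn_gt0.
have e2S k : e / 2 ^+ k.+1 = e / 2 ^+ k / 2 by rewrite exprS invfM mulrCA mulrC.
pose S k := {x : 'I_n -> M | (dist_typ T p (tp x) < (e / 2 ^+ k)%:E)%E}.
have nxt k (x : S k) : {y : S k.+1 | close (sval x) (sval y) (2 * e / 2 ^+ k)}.
  apply: cid; have [y [yp xy]] := step _ _ _ (e2 k) (e2 k.+1) (svalP x).
  exists (exist _ y yp) => /=; apply: close_le xy _.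
  by rewrite e2S; have := e2 k; rewrite -mulrA; lra.
have c' : (dist_typ T p (tp c) < (e / 2 ^+ 0)%:E)%E by rewrite expr0 divr1.
pose u := fix u k : S k := if k is j.+1 then sval (nxt j (u j)) else exist _ c c'.
have [||l lP] := @cauchy_limit_tuple M n (fun k => sval (u k)) (2 * e); first by rewrite mulr_gt0.
  by move=> k; exact: (svalP (nxt k (u k))).
exists l; last by have := lP 0; rewrite /= expr0 divr1; congr close; rewrite mulrA -natrM.
rewrite -bp; apply: (@tp_of_limit T n M N b (fun k => sval (u k)) l (fun k => 6 * e / 2 ^+ k)).
- by move=> d d0; exact: half_pow_small.
- by move=> k; rewrite -mulrA mulr_gt0.
- move=> k; rewrite bp; apply: lt_trans (svalP (u k)) _; rewrite lte_fin.
  by have := e2 k; rewrite -mulrA; lra.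
- by move=> k; have := lP k; congr close; rewrite mulrA -natrM.
Qed.

(** Enlarging the open set by [e / 7] captures the type itself. Any tuple of the enlarged set is
    within [e / 7] of one in [P], which is within [6 * (e / 7)] of a realisation of the type; the
    two add up to [e]. *)
Lemma almost_isolatedW T n (p : typ L n) :
  types T n p -> almost_isolated T p -> isolated_typ T p.
Proof.
move=> tpp ip; have [N [NT [a pa]]] := tpp; rewrite pa in ip *; apply/isolatedP.
split=> [|e e0]; first by rewrite -pa.
have e'0 : 0 < e / 7 by lra.
have [P [oP [M0 [M0T [a0 Pa0]]] PU]] := ip _ e'0.
exists (fun M x => exists y : 'I_n -> M, P M y /\ close y x (e / 7)).
split; first exact: open_around.
  have /(dist_typ_ltP _ _ _ e'0)[M2 [M2T [z [y [za yy zy]]]]] := PU _ _ M0T Pa0.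
  apply: (open_tp (open_around (e / 7) oP) za).
  by exists y; split; [exact: (open_tp oP (esym yy))|exact: close_sym].
move=> M x MT [y [Py yx]].
have [z za yz] := almost_isolated_realise (ex_intro _ N (ex_intro _ a erefl)) ip MT e'0 (PU _ _ MT Py).
apply/dist_typ_ltP => //; exists M; split=> //; exists z, x; split=> //.
by apply: close_le (close_trans (close_sym yz) yx) _; lra.
Qed.

Lemma isolated_realise T n (p : typ L n) M (c : 'I_n -> M) (e : R) :
  isolated_typ T p -> models M T -> 0 < e ->
  (dist_typ T p (tp c) < e%:E)%E ->
  exists2 b : 'I_n -> M, tp b = p & close c b (6 * e).
Proof.
move=> ip; apply: almost_isolated_realise; last exact: isolated_almost.
by have [[N [_ [b ->]]] _] := ip; exists N, b.
Qed.

(* [s] need not be injective. *)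
Lemma isolated_comp T m n M (a : 'I_n -> M) (s : 'I_m -> 'I_n) : models M T ->
  isolated_typ T (tp a) -> isolated_typ T (tp (a \o s)).
Proof.
move=> MT ia; apply/isolatedP.
split=> [|e e0]; first by exists M; split=> //; exists (a \o s).
have e'0 : 0 < e / 7 by lra.
have [_ /(_ _ e'0)[P [oP Pa PU]]] := iffLR (isolatedP T a) ia.
exists (fun N x => exists y : 'I_n -> N, P N y /\ close (y \o s) x (e / 7)).
split; first exact: (open_near s id).
  by exists a; split=> //; exact: close_refl.
move=> N x NT [y [Py yx]].
have [z za yz] := isolated_realise ia NT e'0 (PU _ _ NT Py).
apply/dist_typ_ltP => //; exists N; split=> //; exists (z \o s), x; split=> //.
  exact: tp_comp.
have yz' : close (z \o s) (y \o s) (6 * (e / 7)) by move=> i; exact: (close_sym yz).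
by apply: close_le (close_trans yz' yx) _; lra.
Qed.

End Types.

(** * Elementary substructures *)

Section Substructures.
Variables (R : realType) (L : language R).
Implicit Types (M N : structure L) (n m k : nat) (T : theory L).

Lemma carrier_point M : exists x : M, True.
Proof. by have [x] := carrier_inhabited M; exists x. Qed.

Definition mclosure M (A : set M) : set M :=
  [set x | forall e : R, 0 < e -> exists2 y, A y & (dist x y < e%:E)%E].

Lemma sub_mclosure M (A : set M) : A `<=` mclosure A.
Proof. by move=> x Ax e e0; exists x => //; rewrite dist_xx lte_fin. Qed.

Lemma mclosure_tuple M (A : set M) n (a : 'I_n -> M) (e : R) :
  (forall i, mclosure A (a i)) -> 0 < e ->
  exists2 b : 'I_n -> M, (forall i, A (b i)) & close a b e.
Proof.
move=> aA e0; have /choice[b bP] : forall i, exists y, A y /\ (dist (a i) y < e%:E)%E.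
  by move=> i; have [y] := aA i e e0; exists y.
by exists b => i; have [] := bP i.
Qed.

(** The test bears on open conditions, so that it can be met by a countable set; the elementary
    substructure will be the metric closure of that set. *)
Definition tarski_vaught M (A : set M) : Prop := A !=set0 /\
  forall n (P : condition L n.+1) (a : 'I_n -> M), is_open P -> (forall i, A (a i)) ->
    (exists x, P M (scons x a)) -> exists2 x, A x & P M (scons x a).

Lemma close_scons M n (x y : M) (a b : 'I_n -> M) e :
  (dist x y < e%:E)%E -> close a b e -> close (scons x a) (scons y b) e.
Proof.
move=> xy ab i; case: (unliftP ord0 i) => [j ->|->]; first by rewrite !scons_lift.
by rewrite !scons0.
Qed.

(** Parameters in the closure are replaced by nearby ones in [A]. The shrunken condition [P0]
    survives the move away from [a], and its margin pays for the way back. *)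
Lemma tarski_vaught_open M (A : set M) n (P : condition L n.+1) (a : 'I_n -> M) :
  tarski_vaught A -> is_open P -> (forall i, mclosure A (a i)) ->
  (exists x, P M (scons x a)) -> exists2 x, A x & P M (scons x a).
Proof.
move=> [_ tvA] oP aA [x Px].
have [P0 [d [oP0 d0 P0x dP]]] := open_shrink oP Px.
have [c c0 cP] := open_stable oP0 P0x.
have [|b bA ab] := mclosure_tuple aA (_ : 0 < Num.min d c); first by rewrite lt_min d0.
have [|y Ay Py] := tvA n P0 b oP0 bA.
  exists x; apply: (cP M (scons x a)) => //; apply: close_scons.
    by rewrite dist_xx lte_fin.
  by apply: close_le ab _; rewrite ge_min lexx orbT.
exists y => //; apply: dP Py _; apply: close_scons; first by rewrite dist_xx lte_fin.
by apply: close_sym; apply: close_le ab _; rewrite ge_min lexx.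
Qed.

Lemma mclosure_limit M (A : set M) (u : nat -> M) l :
  (forall n, mclosure A (u n)) ->
  (forall e : R, 0 < e -> exists k, forall n, (k <= n)%N -> (dist (u n) l < e%:E)%E) ->
  mclosure A l.
Proof.
move=> uA ul e e0; have e20 : 0 < e / 2 by rewrite divr_gt0.
have [n /(_ n (leqnn n)) nP] := ul _ e20; have [y Ay uy] := uA n _ e20.
exists y => //; rewrite [e]splitr; apply: dist_lt_triangle uy.
by rewrite dist_sym.
Qed.

(** Closure under a function symbol is the test applied to the open condition that [x] lies within
    [e] of the value. *)
Lemma tarski_vaught_substructure M (A : set M) :
  tarski_vaught A -> is_substructure (mclosure A).
Proof.
move=> tvA; split.
- by have [[x Ax] _] := tvA; exists x; exact: sub_mclosure.
- move=> s a aA e e0.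
  pose t : term L (far s).+1 := Tapp (fun i => Tvar L (lift ord0 i)).
  have oP := open_distt (Tvar L ord0) t e.
  have [|x Ax xP] := tarski_vaught_open tvA oP aA.
    exists (finterp M s a); rewrite /= scons0.
    rewrite (_ : (fun i => _) = a) ?dist_xx ?lte_fin//.
    by apply: funext => i; rewrite scons_lift.
  exists x => //; rewrite dist_sym; move: xP; rewrite /= scons0.
  by rewrite (_ : (fun i => _) = a)//; apply: funext => i; rewrite scons_lift.
- by move=> u l; exact: mclosure_limit.
Qed.

Lemma sval_sub_finterp M (A : set M) (subA : is_substructure A) (s : fsym L)
    (a : 'I_(far s) -> {x : M | A x}) :
  sval (sub_finterp subA a) = finterp M s (fun i => sval (a i)).
Proof. by rewrite /sub_finterp; case: subA. Qed.

Lemma sval_teval M (A : set M) (subA : is_substructure A) n (t : term L n)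
    (a : 'I_n -> substructure subA) :
  sval (teval a t) = teval (fun i => sval (a i)) t.
Proof.
elim: t => //= s ts IH; rewrite sval_sub_finterp; congr (finterp M s _).
exact: funext.
Qed.

Lemma sval_scons M (A : set M) n (x : {x : M | A x}) (a : 'I_n -> {x : M | A x}) :
  (fun i => sval (scons x a i)) = scons (sval x) (fun i => sval (a i)).
Proof.
apply: funext => i; case: (unliftP ord0 i) => [j ->|->]; first by rewrite !scons_lift.
by rewrite !scons0.
Qed.

Lemma tarski_vaught_elementary M (A : set M) (subA : is_substructure (mclosure A)) :
  tarski_vaught A -> @elementary R L (substructure subA) M (fun x => sval x).
Proof.
move=> tvA n phi a _; rewrite /comp; symmetry.
elim: phi a => {n} [n t1 t2|n s ts|n k u cu args IH|n psi IH|n psi IH] a /=.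
- by rewrite !sval_teval.
- by congr (pinterp M s _); apply: funext => i; rewrite sval_teval.
- by congr (u _); apply: funext => i; rewrite IH.
- apply/eqP; rewrite eq_le; apply/andP; split.
    apply: ge_ereal_sup => _ [x _ <-]; rewrite IH sval_scons.
    by apply: ereal_sup_ubound; exists (sval x).
  rewrite leNgt; apply/negP => /ereal_sup_gt[_ [x _ <-]] xP.
  set r := ereal_sup _ in xP.
  have [|y Ay] := tarski_vaught_open tvA (open_gt psi (contract r)) (fun i => svalP (a i)).
    by exists x; rewrite lt_contract.
  rewrite lt_contract ltNge => /negP; apply.
  apply: ereal_sup_ubound; exists (exist _ y (sub_mclosure Ay)) => //.
  by rewrite IH sval_scons.
- apply/eqP; rewrite eq_le; apply/andP; split; last first.
    apply: le_ereal_inf_tmp => _ [x _ <-]; rewrite IH sval_scons.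
    by apply: ereal_inf_lbound; exists (sval x).
  rewrite leNgt; apply/negP => /ereal_inf_lt[_ [x _ <-]] xP.
  set r := ereal_inf _ in xP.
  have [|y Ay] := tarski_vaught_open tvA (open_lt psi (contract r)) (fun i => svalP (a i)).
    by exists x; rewrite lt_contract.
  rewrite lt_contract ltNge => /negP; apply.
  apply: ereal_inf_lbound; exists (exist _ y (sub_mclosure Ay)) => //.
  by rewrite IH sval_scons.
Qed.

Lemma elementary_tp M N (f : M -> N) n (a : 'I_n -> M) :
  elementary f -> tp (f \o a) = tp a.
Proof. by move=> ef; apply/tp_eqP => phi; exact: ef. Qed.

Lemma elementary_tp_pair2 M N (f : M -> N) x y :
  elementary f -> tp (pair2 (f x) (f y)) = tp (pair2 x y).
Proof.
move=> ef; rewrite -(elementary_tp _ ef); congr tp.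
by apply: funext => i; rewrite /pair2 /=; case: ifP.
Qed.

Lemma elementary_dist M N (f : M -> N) x y :
  elementary f -> dist (f x) (f y) = dist x y.
Proof.
move=> ef; have /tp_eqP /(_ (Fdist (Tvar L ord0) (Tvar L ord_max))) := elementary_tp_pair2 x y ef.
by [].
Qed.

Lemma elementary_models M N (f : M -> N) T : elementary f -> models N T -> models M T.
Proof. by move=> ef NT sigma Ts a; rewrite -(NT _ Ts (f \o a)) ef. Qed.

Lemma elementary_models_fwd M N (f : M -> N) T :
  elementary f -> models M T -> models N T.
Proof.
move=> ef MT sigma Ts a; pose a0 : 'I_0 -> M := fun i => match notF (ltn_ord i) with end.
rewrite -(MT _ Ts a0) -(ef _ sigma a0)//; congr (eval sigma _).
by apply: funext => -[].
Qed.

Lemma elementary_comp M N (K : structure L) (f : M -> N) (g : N -> K) :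
  elementary f -> elementary g -> elementary (g \o f).
Proof. by move=> ef eg n phi a _; rewrite -(ef n phi a)// -(eg n phi). Qed.

Lemma countable_range (X : Type) (D : set X) (x0 : X) : countable D ->
  exists d : nat -> X, D `<=` range d.
Proof.
move=> /countable_injP[f fI].
have [g gK] : exists g : nat -> X, forall x, D x -> g (f x) = x.
  have /choice[g gP] : forall k, exists x, forall y, D y -> f y = k -> x = y.
    move=> k; have [[y [Dy fy]]|nk] := pselect (exists y, D y /\ f y = k).
      exists y => z Dz fz; apply: fI; rewrite ?inE// fz; exact: fy.
    by exists x0 => y Dy fy; exfalso; apply: nk; exists y.
  by exists g => x Dx; exact: gP.
by exists g => x Dx; exists (f x) => //; exact: gK.
Qed.

Lemma exists_witness (X : Type) (Q : X -> Prop) (x0 : X) :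
  exists y, (exists x, Q x) -> Q y.
Proof.
by have [[x xP]|nx] := pselect (exists x, Q x); [exists x|exists x0 => /nx].
Qed.

(** Countably many requirements suffice: a formula with contracted value [c < 0] is replaced by one
    of the dense sequence up to [- c / 4], and a rational between [3 / 4 * c] and [c / 2] serves as
    threshold. The requirement concludes with [<=] because this form survives limits. *)
Lemma tarski_vaught_test (f : forall n, nat -> fml L n) M (A : set M) :
  (forall n (psi : fml L n) (e : R), 0 < e -> exists k, forall N (a : 'I_n -> N),
    egap (eval psi a) (eval (f n k) a) <= e) ->
  A !=set0 ->
  (forall n k (r : rat) (a : 'I_n -> M), (forall i, A (a i)) ->
    (exists x, contract (eval (f n.+1 k) (scons x a)) < ratr r :> R) ->
    exists2 x, A x & contract (eval (f n.+1 k) (scons x a)) <= ratr r :> R) ->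
  tarski_vaught A.
Proof.
move=> fP A0 H; split=> // n P a [psi psiP] aA [x /psiP Px].
set c := contract (eval psi (scons x a)).
have c0 : c < 0 by rewrite /c contract_lt0.
have [|k kP] := fP n.+1 psi (- c / 4); first by lra.
have [|r rP] := @rat_in_itvoo R (3 / 4 * c) (c / 2); first by lra.
move: rP; rewrite in_itv/= => /andP[r1 r2].
have [|y Ay yr] := H n k r a aA.
  exists x; have [_] := egap_le_expand (kP M (scons x a)).
  by rewrite -/c; lra.
exists y => //; apply/psiP; rewrite -contract_lt0.
by have [H1 _] := egap_le_expand (kP M (scons y a)); lra.
Qed.

Lemma lowenheim_skolem M (d : nat -> M) : separable_language L ->
  exists A : set M, [/\ countable A, range d `<=` A & tarski_vaught A].
Proof.
move=> sL; pose f n := sval (cid (sL n)); have fP n := svalP (cid (sL n)).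
have [x0 _] := carrier_point M.
have /choice[sk skP] : forall z : (nat * nat * rat) * seq M, exists y : M,
    (exists x, contract (eval (f z.1.1.1.+1 z.1.1.2) (scons x (fun i => nth x0 z.2 i))) < ratr z.1.2 :> R) ->
    contract (eval (f z.1.1.1.+1 z.1.1.2) (scons y (fun i => nth x0 z.2 i))) < ratr z.1.2 :> R.
  move=> z; exact: (@exists_witness _ (fun y =>
    contract (eval (f z.1.1.1.+1 z.1.1.2) (scons y (fun i => nth x0 z.2 i))) < ratr z.1.2) x0).
(* The trees are Skolem terms: a leaf names a term of the given sequence, and the label of a node
   codes a formula of the dense sequence with a rational threshold. Being a countable type, they
   have a countable set of values. *)
pose val := fix val (t : GenTree.tree nat) : M := match t with
  | GenTree.Leaf i => d i
  | GenTree.Node c ts => if unpickle c is Some z then sk (z, map val ts) else x0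
  end.
exists (range val); split.
- exact: sub_countable (card_image_le val setT) (countableP _).
- by move=> _ [i _ <-]; exists (GenTree.Leaf i).
- apply: (tarski_vaught_test fP) => [|n k r a aA ex]; first by exists (d 0), (GenTree.Leaf 0).
  have /choice[t tP] : forall i, exists t, val t = a i by move=> i; have [t _] := aA i; exists t.
  pose ts := [seq t i | i <- enum 'I_n].
  have tsE : (fun i : 'I_n => nth x0 (map val ts) i) = a.
    apply: funext => i; rewrite -map_comp (nth_map i) ?size_enum_ord//=.
    by rewrite nth_ord_enum tP.
  exists (val (GenTree.Node (pickle (n, k, r)) ts)).
    by exists (GenTree.Node (pickle (n, k, r)) ts).
  have := skP ((n, k, r), map val ts); rewrite /= pickleK tsE => H.
  exact/ltW/H.
Qed.

(** The countable set [A] may miss the image of [f]. For each point of [A] and each [k], one point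
    of [M] is chosen whose image is within [1 / (k + 1)] of it, if there is any. *)
Lemma separable_isometry M N (f : M -> N) (A : set N) :
  (forall x y, dist (f x) (f y) = dist x y) -> countable A ->
  (forall x, mclosure A (f x)) -> separable_structure M.
Proof.
move=> fd cA fA; have [x0 _] := carrier_point M.
have /choice[g gP] : forall z : N * nat, exists x : M,
    (exists x, (dist (f x) z.1 < (z.2.+1%:R^-1)%:E)%E) -> (dist (f x) z.1 < (z.2.+1%:R^-1)%:E)%E.
  by move=> z; exact: (exists_witness _ x0).
exists (g @` (A `*` setT)); split.
  apply: sub_countable (card_image_le _ _) _.
  by apply: countableX => //; exact: countableP.
move=> x e e0; have e20 : 0 < e / 2 by rewrite divr_gt0.
have [k _ H] := near_infty_natSinv_lt (PosNum e20).
have kd := H k (leqnn k); rewrite /= in kd.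
have k0 : 0 < k.+1%:R^-1 :> R by rewrite invr_gt0.
have [y Ay xy] := fA x _ k0.
exists (g (y, k)); first by exists (y, k).
have gy : (dist (f (g (y, k))) y < (k.+1%:R^-1)%:E)%E by apply: (gP (y, k)); exists x.
rewrite dist_sym in gy; rewrite -fd; apply: dist_lt_trans (dist_lt_triangle xy gy) _.
by rewrite [leRHS]splitr; apply: lerD; exact: ltW.
Qed.

Lemma separable_substructure M (A C : set M) (subC : is_substructure C) :
  countable A -> C `<=` mclosure A -> separable_structure (substructure subC).
Proof.
move=> cA CA; apply: (@separable_isometry (substructure subC) M (fun x => sval x)) cA _ => //.
by move=> x; exact: CA (svalP x).
Qed.

Lemma separable_elementary M N (f : M -> N) :
  elementary f -> separable_structure N -> separable_structure M.
Proof.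
move=> ef [D [cD dD]]; apply: (@separable_isometry M N f D _ cD) => [x y|x e e0].
  exact: elementary_dist.
by have [y Dy xy] := dD (f x) e e0; exists y.
Qed.

Lemma separable_elementary_substructure M (d : nat -> M) : separable_language L ->
  exists (C : set M) (subC : is_substructure C),
  [/\ range d `<=` C, separable_structure (substructure subC) &
      @elementary R L (substructure subC) M (fun x => sval x)].
Proof.
move=> sL; have [A [cA dA tvA]] := lowenheim_skolem d sL.
have subC := tarski_vaught_substructure tvA.
exists (mclosure A), subC; split.
- by move=> x /dA; exact: sub_mclosure.
- exact: separable_substructure cA _.
- exact: tarski_vaught_elementary.
Qed.

End Substructures.

(** * Back-and-forth *)

Definition res (X : Type) n (a : nat -> X) : 'I_n -> X := fun i => a i.
Arguments res {X} n a i /.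

Section BackAndForth.
Variables (R : realType) (L : language R).
Implicit Types (M N : structure L) (n m k : nat) (T : theory L).

Lemma elementary_extension M N (I : Type) (A : I -> M) (B : I -> N) :
  (forall n (s : 'I_n -> I), tp (A \o s) = tp (B \o s)) ->
  (forall x (e : R), 0 < e -> exists i, (dist x (A i) < e%:E)%E) ->
  exists f : M -> N, elementary f /\ forall i, f (A i) = B i.
Proof.
move=> AB dA.
have ABd i j : dist (A i) (A j) = dist (B i) (B j).
  have := AB 2 (pair2 i j); have E (X : Type) (g : I -> X) : g \o pair2 i j = pair2 (g i) (g j).
    by apply: funext => k; rewrite /pair2 /=; case: ifP.
  by rewrite !E => /(tp_dist ord0 ord_max).
(* The image of [x] is specified by continuity along the family. It is thus independent of an
   approximating sequence, and [f (A i) = B i] follows at once. *)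
have /choice[f fP] : forall x, exists y, forall e : R, 0 < e -> exists2 d : R, 0 < d &
    forall i, (dist x (A i) < d%:E)%E -> (dist y (B i) < e%:E)%E.
  move=> x; have p2 k : 0 < 1 / 2 / 2 ^+ k :> R by rewrite divr_gt0// exprn_gt0.
  have /choice[s sP] : forall k, exists i, (dist x (A i) < (1 / 2 / 2 ^+ k)%:E)%E.
    by move=> k; exact: dA.
  have [||l lP] := @cauchy_limit R L N (fun k => B (s k)) 1; first by [].
    move=> k; rewrite -ABd; have H := sP k; rewrite dist_sym in H.
    apply: dist_lt_trans (dist_lt_triangle H (sP k.+1)) _.
    have q := p2 k; rewrite exprS invfM !mulrA; move: q.
    set t := (2 ^+ k)^-1; lra.
  exists l => e e0; have e40 : 0 < e / 4 by lra.
  have [k ke] := half_pow_small 1 e40.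
  have k0 : 0 < 1 / 2 ^+ k :> R by rewrite divr_gt0// exprn_gt0.
  exists (1 / 2 / 2 ^+ k) => // i xi.
  have si := sP k; rewrite dist_sym in si.
  have := dist_lt_triangle si xi; rewrite ABd => H.
  have := lP k; rewrite dist_sym => H1.
  apply: dist_lt_trans (dist_lt_triangle H1 H) _.
  by move: ke; set t := (2 ^+ k)^-1; lra.
exists f; split=> [n phi a _|i]; last first.
  apply: dist_small_eq => e e0; have [d d0 H] := fP (A i) e e0.
  by apply: H; rewrite dist_xx lte_fin.
apply: egap_eq => e e0; have e20 : 0 < e / 2 by lra.
have [c c0 cP] := eval_ucont phi e20.
have /choice[s sP] : forall i, exists j, (dist (f (a i)) (B j) < c%:E)%E /\ (dist (a i) (A j) < c%:E)%E.
  move=> i; have [d d0 H] := fP (a i) c c0.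
  have dc0 : 0 < Num.min d c by rewrite lt_min d0.
  have [j jP] := dA (a i) _ dc0; exists j; split.
    by apply: H; apply: dist_lt_trans jP _; rewrite ge_min lexx.
  by apply: dist_lt_trans jP _; rewrite ge_min lexx orbT.
apply: le_trans (egap_triangle _ (eval phi (B \o s)) _) _; rewrite [leRHS]splitr; apply: lerD.
  by apply: cP => i; have [] := sP i.
have /tp_eqP <- := AB _ s; rewrite egap_sym; apply: cP => i; by have [] := sP i.
Qed.

Lemma elementary_surjective M N (f : M -> N) (I : Type) (A : I -> M) :
  elementary f -> (forall y (e : R), 0 < e -> exists i, (dist y (f (A i)) < e%:E)%E) ->
  forall y, exists x, f x = y.
Proof.
move=> ef dB y; have p2 k : 0 < 1 / 2 / 2 ^+ k :> R by rewrite divr_gt0// exprn_gt0.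
have /choice[s sP] : forall k, exists i, (dist y (f (A i)) < (1 / 2 / 2 ^+ k)%:E)%E.
  by move=> k; exact: dB.
have [||l lP] := @cauchy_limit R L M (fun k => A (s k)) 1; first by [].
  move=> k; rewrite -(elementary_dist _ _ ef); have H := sP k; rewrite dist_sym in H.
  apply: dist_lt_trans (dist_lt_triangle H (sP k.+1)) _.
  have q := p2 k; rewrite exprS invfM !mulrA; move: q.
  set t := (2 ^+ k)^-1; lra.
exists l; apply: dist_small_eq => e e0; have e40 : 0 < e / 4 by lra.
have [k ke] := half_pow_small 1 e40.
have k0 : 0 < 1 / 2 ^+ k :> R by rewrite divr_gt0// exprn_gt0.
have := lP k; rewrite -(elementary_dist _ _ ef) dist_sym => H.
have H1 := sP k; rewrite dist_sym in H1.
apply: dist_lt_trans (dist_lt_triangle H H1) _.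
by move: ke k0; set t := (2 ^+ k)^-1; lra.
Qed.

Lemma elementary_surj_isomorphic M N (f : M -> N) :
  elementary f -> (forall y, exists x, f x = y) -> isomorphic M N.
Proof.
move=> ef sf; exists f; split=> //.
- by move=> x y; exact: elementary_dist.
- move=> s a; apply/dist_eq0.
  (* The graph of [s] is defined by the vanishing of a distance, and so is preserved by elementary
     maps. *)
  pose t : term L (far s).+1 := Tapp (fun i => Tvar L (lift ord0 i)).
  have := ef _ (Fdist (Tvar L ord0) t) (scons (finterp M s a) a) (fun=> I).
  rewrite /= scons0.
  rewrite (_ : (fun i => scons (finterp M s a) a (lift ord0 i)) = a); last first.
    by apply: funext => i; rewrite scons_lift.
  rewrite dist_xx => <-; congr (dist _ (finterp N s _)).
  by apply: funext => i /=; rewrite scons_lift.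
- move=> s a; have := ef _ (Fpred (fun i => Tvar L i)) a (fun=> I).
  exact.
Qed.

Lemma isomorphic_elementary M N : isomorphic M N ->
  exists f : M -> N, elementary f /\ forall y, exists x, f x = y.
Proof.
move=> [f [sf fd ff fp]]; exists f; split=> // n phi a _.
have ft m (t : term L m) (b : 'I_m -> M) : teval (f \o b) t = f (teval b t).
  elim: t => //= s ts IH; rewrite ff; congr (finterp N s _); exact: funext.
have fs m x (b : 'I_m -> M) : scons (f x) (f \o b) = f \o scons x b.
  by apply: funext => i; rewrite /scons /=; case: (unlift ord0 i).
elim: phi a => {n} [n t1 t2|n s ts|n k u cu args IH|n psi IH|n psi IH] a /=.
- by rewrite !ft fd.
- by rewrite -fp; congr (pinterp N s _); apply: funext => i; rewrite ft.
- by congr (u _); apply: funext => i; rewrite IH.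
- congr ereal_sup; apply/seteqP; split=> _ [x _ <-].
    by have [y <-] := sf x; exists y => //; rewrite fs IH.
  by exists (f x) => //; rewrite fs IH.
- congr ereal_inf; apply/seteqP; split=> _ [x _ <-].
    by have [y <-] := sf x; exists y => //; rewrite fs IH.
  by exists (f x) => //; rewrite fs IH.
Qed.

Lemma isomorphic_sym M N : isomorphic M N -> isomorphic N M.
Proof.
move=> /isomorphic_elementary[f [ef sf]].
have [g gK] := choice sf.
have fI x y : f x = f y -> x = y.
  by move=> fxy; apply/dist_eq0; rewrite -(elementary_dist _ _ ef) fxy dist_xx.
apply: (@elementary_surj_isomorphic _ _ g) => [n phi a _|x]; last first.
  by exists (f x); apply: fI; rewrite gK.
rewrite -(ef n phi (g \o a))//; congr (eval phi _).
by apply: funext => i /=; rewrite gK.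
Qed.

Lemma isomorphic_trans M N (K : structure L) :
  isomorphic M N -> isomorphic N K -> isomorphic M K.
Proof.
move=> /isomorphic_elementary[f [ef sf]] /isomorphic_elementary[g [eg sg]].
apply: (elementary_surj_isomorphic (elementary_comp ef eg)) => z.
by have [y <-] := sg z; have [x <-] := sf y; exists x.
Qed.

Lemma tp_res M N n m (a : nat -> M) (b : nat -> N) : (m <= n)%N ->
  tp (res n a) = tp (res n b) -> tp (res m a) = tp (res m b).
Proof. by move=> mn /(tp_comp (widen_ord mn)). Qed.

Lemma cauchy_far M (u : nat -> M) (e : R) k : 0 < e ->
  (forall j, (k <= j)%N -> (dist (u j) (u j.+1) < (e / 2 ^+ j)%:E)%E) ->
  forall j, (dist (u k) (u (k + j)%N) < (2 * e / 2 ^+ k)%:E)%E.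
Proof.
move=> e0 uP j; elim: j k uP => [|j IH] k uP.
  by rewrite addn0 dist_xx lte_fin -mulrA mulr_gt0// divr_gt0// exprn_gt0.
apply: dist_lt_trans (dist_lt_triangle (uP k (leqnn k)) _) _.
  by rewrite -addSnnS; apply: IH => i ki; apply: uP; exact: ltnW.
rewrite exprS invfM mulrACA divff// mul1r.
lra.
Qed.

(** Entry [i] of a back-and-forth construction is meaningful only from some stage on. One limit is
    fixed, and the estimate then holds from every stage after which the steps are controlled. *)
Lemma eventually_cauchy_limit M (u : nat -> M) (e : R) k0 : 0 < e ->
  (forall j, (k0 <= j)%N -> (dist (u j) (u j.+1) < (e / 2 ^+ j)%:E)%E) ->
  exists l, forall k, (forall j, (k <= j)%N -> (dist (u j) (u j.+1) < (e / 2 ^+ j)%:E)%E) ->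
    (dist (u k) l < (3 * e / 2 ^+ k)%:E)%E.
Proof.
move=> e0 uP.
have [||l lP] := @cauchy_limit R L M (fun k => u (k0 + k)%N) (e / 2 ^+ k0).
- by rewrite divr_gt0// exprn_gt0.
- move=> k; rewrite addnS; have := uP (k0 + k)%N (leq_addr _ _).
  by rewrite exprD invfM mulrA.
exists l => k uk; have ek : 0 < e / 2 ^+ k by rewrite divr_gt0// exprn_gt0.
have [j jP] := half_pow_small (3 * (e / 2 ^+ k0)) ek.
have := cauchy_far e0 uk (k0 + j)%N; have := lP (k + j)%N.
rewrite addnCA => H1 H2; apply: dist_lt_trans (dist_lt_triangle H2 H1) _.
have : 3 * (e / 2 ^+ k0) / 2 ^+ (k + j) <= 3 * (e / 2 ^+ k0) / 2 ^+ j.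
  rewrite ler_pM2l; last by rewrite mulr_gt0// divr_gt0// exprn_gt0.
  by rewrite lef_pV2 ?posrE ?exprn_gt0// ler_weXn2l ?leq_addl// ler1n.
by move: jP; rewrite -!mulrA; lra.
Qed.

(** At stage [k] the first [c k] entries are matched, and later stages move them by a summable
    amount. Since [i < c i.+1], every entry is eventually under control, and uniform continuity
    carries equality of types to the limits. *)
Lemma limit_pair M N (c : nat -> nat) (a : nat -> nat -> M) (b : nat -> nat -> N) (e : R) :
  0 < e -> (forall i, (i < c i.+1)%N) -> {homo c : i j / (i <= j)%N} ->
  (forall k, tp (res (c k) (a k)) = tp (res (c k) (b k))) ->
  (forall k i, (i < c k)%N -> (dist (a k i) (a k.+1 i) < (e / 2 ^+ k)%:E)%E) ->
  (forall k i, (i < c k)%N -> (dist (b k i) (b k.+1 i) < (e / 2 ^+ k)%:E)%E) ->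
  exists (A : nat -> M) (B : nat -> N), [/\
    forall n (s : 'I_n -> nat), tp (A \o s) = tp (B \o s),
    forall k i, (i < c k)%N -> (dist (a k i) (A i) < (3 * e / 2 ^+ k)%:E)%E &
    forall k i, (i < c k)%N -> (dist (b k i) (B i) < (3 * e / 2 ^+ k)%:E)%E].
Proof.
move=> e0 ci cmono ab aP bP.
have lim (K : structure L) (d : nat -> nat -> K) :
    (forall k i, (i < c k)%N -> (dist (d k i) (d k.+1 i) < (e / 2 ^+ k)%:E)%E) ->
    exists D : nat -> K, forall k i, (i < c k)%N -> (dist (d k i) (D i) < (3 * e / 2 ^+ k)%:E)%E.
  move=> dP; have /choice[D DP] : forall i, exists l, forall k,
      (forall j, (k <= j)%N -> (dist (d j i) (d j.+1 i) < (e / 2 ^+ j)%:E)%E) ->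
      (dist (d k i) l < (3 * e / 2 ^+ k)%:E)%E.
    move=> i; apply: (@eventually_cauchy_limit K (fun k => d k i) e i.+1) => // j ij.
    by apply: dP; apply: leq_trans (ci i) _; exact: cmono.
  exists D => k i ik; apply: DP => j kj; apply: dP; apply: leq_trans ik _.
  exact: cmono.
have [A AP] := lim _ _ aP; have [B BP] := lim _ _ bP.
exists A, B; split=> //.
have AB n : tp (res n A) = tp (res n B).
  apply/tp_eqP => phi; apply: egap_eq => d d0; have d20 : 0 < d / 2 by lra.
  have [r r0 rP] := eval_ucont phi d20; have [k kr] := half_pow_small (3 * e) r0.
  pose j := maxn k n.
  have nj : (n <= c j)%N.
    have : (n <= c n)%N by case: (n) => // i; exact: ci.
    by move/leq_trans; apply; apply: cmono; exact: leq_maxr.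
  have jr : 3 * e / 2 ^+ j <= r.
    apply: le_trans (ltW kr); rewrite ler_pM2l ?mulr_gt0//.
    by rewrite lef_pV2 ?posrE ?exprn_gt0// ler_weXn2l ?leq_maxl// ler1n.
  have /tp_eqP/(_ phi) E := tp_res nj (ab j).
  apply: le_trans (egap_triangle _ (eval phi (res n (a j))) _) _.
  rewrite [leRHS]splitr; apply: lerD.
    rewrite egap_sym; apply: rP => i; apply: dist_lt_trans (AP _ _ _) jr.
    exact: leq_trans (ltn_ord i) nj.
  rewrite E; apply: rP => i; apply: dist_lt_trans (BP _ _ _) jr.
  exact: leq_trans (ltn_ord i) nj.
move=> n s; pose m := (\max_(i < n) s i).+1.
have sm i : (s i < m)%N by rewrite ltnS; exact: (@leq_bigmax _ s).
exact: (tp_comp (fun i => Ordinal (sm i)) (AB m)).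
Qed.

(** The open set around the type of [(x, a)] is met above [b], by equality of types. Realising the
    isolated type from there moves the whole tuple, including [b]; so [b] is not extended exactly,
    only up to [e]. *)
Lemma forth T M N n (a : 'I_n -> M) (b : 'I_n -> N) (x : M) (e : R) :
  models N T -> isolated_typ T (tp (scons x a)) -> tp a = tp b -> 0 < e ->
  exists2 b' : 'I_n.+1 -> N, tp (scons x a) = tp b' & close b (b' \o lift ord0) e.
Proof.
move=> NT ia ab e0; have e60 : 0 < e / 6 by lra.
have [_ /(_ _ e60)[P [oP Px PU]]] := iffLR (isolatedP T (scons x a)) ia.
have [y Py] : exists y, P N (scons y b) by apply: (open_tp (open_ex oP) ab); exists x.
have [b' bb' bc] := isolated_realise ia NT e60 (PU _ _ NT Py).
exists b' => // i; have := bc (lift ord0 i); rewrite scons_lift => H.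
by apply: dist_lt_trans H _; lra.
Qed.

Definition upd (X : Type) (a : nat -> X) n (x : X) : nat -> X :=
  fun i => if i == n then x else a i.

Lemma seq_forth T M N n (a : nat -> M) (b : nat -> N) (x : M) (e : R) :
  models N T -> atomic T M -> tp (res n a) = tp (res n b) -> 0 < e ->
  exists2 b' : nat -> N, tp (res n.+1 (upd a n x)) = tp (res n.+1 b') &
    close (res n b) (res n b') e.
Proof.
move=> NT aM ab e0.
have [b' xb bb'] := forth NT (aM _ (scons x (res n a))) ab e0.
(* [forth] puts the new element at index 0; [s] moves it to the last place, where sequences grow. *)
pose s (i : 'I_n.+1) : 'I_n.+1 := if unlift ord_max i is Some j then lift ord0 j else ord0.
pose b1 (i : nat) : N := if (insub i : option 'I_n) is Some j then b' (lift ord0 j) else b' ord0.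
have liftE (j : 'I_n) : lift ord_max j = j :> nat := lift_max j.
have sE (i : 'I_n.+1) : s i = if (insub (i : nat) : option 'I_n) is Some j then lift ord0 j else ord0.
  rewrite /s; case: (unliftP ord_max i) => [j|] ->.
    rewrite liftE.
    by rewrite (insubT (fun i => i < n)%N (ltn_ord j)); congr lift; exact/val_inj.
  by rewrite insubF//= ltnn.
exists b1.
  have := tp_comp s xb; congr (_ = _); congr tp; apply: funext => i /=.
    rewrite /s /res /upd; case: (unliftP ord_max i) => [j|] ->.
      by rewrite scons_lift liftE ltn_eqF.
    by rewrite scons0 /= eqxx.
  by rewrite sE /res /b1; case: insub.
move=> i; rewrite /res /b1 (insubT (fun i => i < n)%N (ltn_ord i)).
by have := bb' i; rewrite /=; congr (dist _ (b' (lift _ _)) < _)%E; exact/val_inj.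
Qed.

Lemma dense_sequence M : separable_structure M ->
  exists d : nat -> M, forall x (e : R), 0 < e -> exists i, (dist x (d i) < e%:E)%E.
Proof.
move=> [D [cD dD]]; have [x0 _] := carrier_point M.
have [d Dd] := countable_range x0 cD; exists d => x e e0.
by have [y /Dd[i _ <-] xy] := dD x e e0; exists i.
Qed.

Lemma complete_tp0 T M N (a : 'I_0 -> M) (b : 'I_0 -> N) :
  complete_theory T -> models M T -> models N T -> tp a = tp b.
Proof. by move=> [_ cT] MT NT; apply/tp_eqP => phi; exact: cT. Qed.

Lemma separable_atomic_embeds T M N : complete_theory T ->
  models M T -> models N T -> separable_structure M -> atomic T M ->
  exists f : M -> N, elementary f.
Proof.
move=> cT MT NT /dense_sequence[d dd] aM; have [y0 _] := carrier_point N.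
pose S k := {b : nat -> N | tp (res k d) = tp (res k b)}.
have p2 k : 0 < 1 / 2 ^+ k :> R by rewrite divr_gt0// exprn_gt0.
have nxt k (b : S k) : {b' : S k.+1 | close (res k (sval b)) (res k (sval b')) (1 / 2 ^+ k)}.
  apply: cid; have [b' db' bb'] := seq_forth (d k) NT aM (svalP b) (p2 k).
  have dE : upd d k (d k) = d by apply: funext => i; rewrite /upd; case: eqP => // ->.
  by rewrite dE in db'; exists (exist _ b' db').
have b0 : tp (res 0 d) = tp (res 0 (fun=> y0)) by exact: complete_tp0 cT MT NT.
pose u := fix u k : S k := if k is j.+1 then sval (nxt j (u j)) else exist _ _ b0.
have [||||||A [B [AB dA _]]] := @limit_pair M N id (fun=> d) (fun k => sval (u k)) 1.
- by [].
- by [].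
- by [].
- by move=> k; exact: svalP (u k).
- by move=> k i _; rewrite dist_xx lte_fin.
- by move=> k i ik; have := svalP (nxt k (u k)) (Ordinal ik).
- have [|f [ef _]] := elementary_extension AB; last by exists f.
  have AE i : A i = d i.
    apply: dist_small_eq => e e0; have [k ke] := half_pow_small (3 * 1) e0.
    have := dA (maxn k i.+1) i (leq_maxr _ _); rewrite dist_sym => H.
    apply: dist_lt_trans H _; apply: le_trans (ltW ke); rewrite ler_pM2l ?mulr_gt0//.
    by rewrite lef_pV2 ?posrE ?exprn_gt0// ler_weXn2l ?leq_maxl// ler1n.
  by move=> x e e0; have [i xi] := dd x e e0; exists i; rewrite AE.
Qed.

(** Each point of a dense sequence must be treated at arbitrarily late stages, because only late
    stages approximate it well. *)
Lemma nat_recurrent : exists h : nat -> nat, forall i k, exists2 j, (k <= j)%N & h j = i.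
Proof.
exists (logn 2) => i k; exists (2 ^ i * 3 ^ k)%N.
  by apply: leq_trans (ltnW (ltn_expl k (isT : 1 < 3)%N)) _; rewrite leq_pmull// expn_gt0.
rewrite lognM ?expn_gt0// pfactorK// logn_coprime ?addn0//.
by rewrite coprimeXr.
Qed.

Lemma back_and_forth T M N n (a : 'I_n -> M) (b : 'I_n -> N) (e : R) :
  models M T -> models N T -> separable_structure M -> separable_structure N ->
  atomic T M -> atomic T N -> tp a = tp b -> 0 < e ->
  exists f : M -> N, [/\ elementary f, forall y, exists x, f x = y & close (f \o a) b e].
Proof.
move=> MT NT /dense_sequence[dM dMP] /dense_sequence[dN dNP] aM aN ab e0.
have [x0 _] := carrier_point M; have [y0 _] := carrier_point N.
have [h hP] := nat_recurrent.
(* Stage [k] starts with [n + 2k] matched entries and adds two, one near [dM (h k)] on the side of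
   [M] and one equal to [dN (h k)] on the side of [N]. *)
pose c k := (n + k.*2)%N.
pose S k := {z : (nat -> M) * (nat -> N) | tp (res (c k) z.1) = tp (res (c k) z.2)}.
(* With steps [e / 6 / 2 ^+ k], the limit on each side stays within [3 * (e / 6)], half of [e], of
   the given tuple. *)
have e'0 : 0 < e / 6 by lra.
have p2 k : 0 < e / 6 / 2 ^+ k :> R by rewrite divr_gt0// exprn_gt0.
have nxt k (z : S k) : {z' : S k.+1 | [/\
    close (res (c k) (sval z).1) (res (c k) (sval z').1) (e / 6 / 2 ^+ k),
    close (res (c k) (sval z).2) (res (c k) (sval z').2) (e / 6 / 2 ^+ k),
    (dist (dM (h k)) ((sval z').1 (c k)) < (e / 6 / 2 ^+ k)%:E)%E &
    (dist (dN (h k)) ((sval z').2 (c k).+1) < (e / 6 / 2 ^+ k)%:E)%E]}.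
  apply: cid; have [b1 ab1 bb1] := seq_forth (dM (h k)) NT aM (svalP z) (p2 k).
  have [a1 ba1 aa1] := seq_forth (dN (h k)) MT aN (esym ab1) (p2 k).
  have tpS : tp (res (c k.+1) a1) = tp (res (c k.+1) (upd b1 (c k).+1 (dN (h k)))).
    by rewrite /c doubleS !addnS; exact/esym.
  exists (exist _ (a1, upd b1 (c k).+1 (dN (h k))) tpS); split=> /=.
  - move=> i; have := aa1 (widen_ord (leqnSn _) i).
    by rewrite /res /upd /= ltn_eqF.
  - move=> i; have := bb1 i; rewrite /res /upd ltn_eqF// ltnS; exact: ltnW.
  - by have := aa1 ord_max; rewrite /res /upd /= eqxx.
  - by rewrite /upd eqxx dist_xx lte_fin.
pose ext (X : Type) (x : X) (s : 'I_n -> X) (i : nat) : X :=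
  if (insub i : option 'I_n) is Some j then s j else x.
have extE (X : Type) (x : X) (s : 'I_n -> X) : res n (ext X x s) = s.
  apply: funext => i; rewrite /res /ext (insubT (fun i => i < n)%N (ltn_ord i)).
  by congr s; exact/val_inj.
have z0 : tp (res (c 0) (ext M x0 a)) = tp (res (c 0) (ext N y0 b)).
  by rewrite /c double0 addn0 !extE.
pose u := fix u k : S k := if k is j.+1 then sval (nxt j (u j)) else exist _ (ext M x0 a, ext N y0 b) z0.
have uP k := svalP (nxt k (u k)).
have [||||||A [B [AB dA dB]]] := @limit_pair M N c (fun k => (sval (u k)).1) (fun k => (sval (u k)).2) (e / 6).
- by [].
- by move=> i; rewrite /c -addnn; lia.
- by move=> i j ij; rewrite /c leq_add2l leq_double.
- by move=> k; exact: svalP (u k).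
- by move=> k i ik; have [H _ _ _] := uP k; exact: (H (Ordinal ik)).
- by move=> k i ik; have [_ H _ _] := uP k; exact: (H (Ordinal ik)).
have dense (K : structure L) (d : nat -> K) (D : nat -> K) (v : nat -> nat -> K) (t : nat -> nat) :
    (forall x (e : R), 0 < e -> exists i, (dist x (d i) < e%:E)%E) ->
    (forall k, (t k < c k.+1)%N) ->
    (forall k, (dist (d (h k)) (v k.+1 (t k)) < (e / 6 / 2 ^+ k)%:E)%E) ->
    (forall k i, (i < c k)%N -> (dist (v k i) (D i) < (3 * (e / 6) / 2 ^+ k)%:E)%E) ->
    forall x (e : R), 0 < e -> exists i, (dist x (D i) < e%:E)%E.
  move=> dd tc dv vD x r r0; have r20 : 0 < r / 2 by lra.
  have [i xi] := dd x _ r20; have [k kr] := half_pow_small (e / 6 + 3 * (e / 6)) r20.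
  have [j kj hj] := hP i k; exists (t j).
  have H1 := dv j; rewrite hj in H1; have H2 := vD j.+1 (t j) (tc j).
  apply: dist_lt_trans (dist_lt_triangle xi (dist_lt_triangle H1 H2)) _.
  have q0 : 0 < (2 ^+ j)^-1 :> R by rewrite invr_gt0 exprn_gt0.
  have : (2 ^+ j)^-1 <= (2 ^+ k)^-1 :> R.
    by rewrite lef_pV2 ?posrE ?exprn_gt0// ler_weXn2l// ler1n.
  move: kr q0; rewrite exprS invfM; set q := (2 ^+ j)^-1; set q' := (2 ^+ k)^-1.
  move=> kr q0 qq'.
  have : e / 6 * q + 3 * (e / 6) * q <= (e / 6 + 3 * (e / 6)) * q'.
    by rewrite -mulrDl ler_pM2l//; lra.
  have : 3 * (e / 6) * (2^-1 * q) <= 3 * (e / 6) * q.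
    by rewrite ler_pM2l; [lra|lra].
  by lra.
have [|f [ef fA]] := elementary_extension AB.
  apply: (dense _ dM _ (fun k => (sval (u k)).1) c) => // k; last by have [_ _] := uP k.
  by rewrite /c doubleS !addnS.
exists f; split=> //.
  apply: (elementary_surjective (A := A) ef) => y r r0.
  have [i yi] : exists i, (dist y (B i) < r%:E)%E.
    apply: (dense _ dN B (fun k => (sval (u k)).2) (fun k => (c k).+1)) => // k.
      by rewrite /c doubleS !addnS.
    by have [_ _ _] := uP k.
  by exists i; rewrite fA.
move=> i; have ic : (i < c 0)%N by rewrite /c addn0 ltn_ord.
have := dA 0 i ic; have := dB 0 i ic; rewrite /= expr0 divr1.
have -> : ext M x0 a i = a i by have := extE M x0 a => /(congr1 (@^~ i)).
have -> : ext N y0 b i = b i by have := extE N y0 b => /(congr1 (@^~ i)).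
rewrite -(elementary_dist _ _ ef) fA dist_sym => H1 H2.
by apply: dist_lt_trans (dist_lt_triangle H2 H1) _; lra.
Qed.

End BackAndForth.

(** * Ultrapowers *)

Section Ultralimits.
Variables (R : realType) (U : set_system nat).
Hypothesis UU : UltraFilter U.
Implicit Types (f g : nat -> \bar R).

Let PU : ProperFilter U. Proof. exact: ultra_proper. Qed.

Definition ulim f : \bar R := sval (cid (ultra_ereal_cvg f UU)).

Lemma ulimP f e : 0 < e -> U [set k | egap (ulim f) (f k) < e].
Proof. exact: (svalP (cid (ultra_ereal_cvg f UU))). Qed.

Lemma ulim_unique l f :
  (forall e, 0 < e -> U [set k | egap l (f k) <= e]) -> ulim f = l.
Proof.
move=> lf; apply: egap_eq => e e0; have e20 : 0 < e / 2 by lra.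
have [k [k1 k2]] := filter_ex (filterI (ulimP f e20) (lf _ e20)).
apply: le_trans (egap_triangle _ (f k) _) _; rewrite (egap_sym (f k)) [leRHS]splitr.
by apply: lerD => //; exact: ltW.
Qed.

Lemma ulim_lt f r : (ulim f < r)%E -> U [set k | (f k < r)%E].
Proof.
move=> fr; have e0 : 0 < contract r - contract (ulim f) by rewrite subr_gt0 lt_contract.
apply: filterS (ulimP f e0) => k /=; rewrite /egap ltr_distlC => /andP[_].
by rewrite addrC subrK lt_contract.
Qed.

Lemma ulim_gt f r : (r < ulim f)%E -> U [set k | (r < f k)%E].
Proof.
move=> fr; have e0 : 0 < contract (ulim f) - contract r by rewrite subr_gt0 lt_contract.
apply: filterS (ulimP f e0) => k /=; rewrite /egap ltr_distlC => /andP[+ _].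
by rewrite opprB addrC subrK lt_contract.
Qed.

Lemma ulim_le f g : U [set k | (f k <= g k)%E] -> (ulim f <= ulim g)%E.
Proof.
move=> fg; rewrite leNgt; apply/negP => gf.
pose c := (contract (ulim f) + contract (ulim g)) / 2.
have lf : contract (ulim g) < contract (ulim f) by rewrite lt_contract.
have H1 := @ulimP f (contract (ulim f) - c); have H2 := @ulimP g (c - contract (ulim g)).
have [||k [[k1 k2] k3]] := filter_ex (filterI (filterI (H1 _) (H2 _)) fg).
- by rewrite /c; lra.
- by rewrite /c; lra.
have : contract (f k) <= contract (g k) by rewrite le_contract.
by move: k1 k2; rewrite /egap /= !ltr_distlC => /andP[+ _] /andP[_ +]; lra.
Qed.

Lemma ulim_cst r : ulim (fun=> r) = r.
Proof.
apply: ulim_unique => e e0; apply: filterS (@filterT _ U _) => k _ /=.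
by rewrite egapxx ltW.
Qed.

Lemma ulim_le_cst f r : U [set k | (f k <= r)%E] -> (ulim f <= r)%E.
Proof. by move=> fr; rewrite -(ulim_cst r); exact: ulim_le. Qed.

Lemma ulim_ge_cst f r : U [set k | (r <= f k)%E] -> (r <= ulim f)%E.
Proof. by move=> fr; rewrite -(ulim_cst r); exact: ulim_le. Qed.

Lemma ulim_gap f g e : U [set k | egap (f k) (g k) <= e] ->
  egap (ulim f) (ulim g) <= e.
Proof.
move=> fg; apply/ler_addgt0Pr => d d0; have d20 : 0 < d / 2 by lra.
have [k [[k1 k2] k3]] := filter_ex (filterI (filterI (ulimP f d20) (ulimP g d20)) fg).
apply: le_trans (egap_triangle _ (f k) _) _.
have := egap_triangle (f k) (g k) (ulim g); rewrite (egap_sym (g k) (ulim g)).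
by move: k1 k2 k3 => /=; lra.
Qed.

Lemma ereal_between (x y : \bar R) : (x < y)%E -> exists z, (x < z < y)%E.
Proof.
move=> xy; have xy' : contract x < contract y by rewrite lt_contract.
pose c := (contract x + contract y) / 2.
have := contract_le1 x; have := contract_le1 y; rewrite !ler_norml => /andP[? ?] /andP[? ?].
have c1 : `|c| <= 1 by rewrite ler_norml; apply/andP; rewrite /c; split; lra.
exists (expand c); rewrite -!lt_contract expandK ?inE// /c.
by apply/andP; split; lra.
Qed.

End Ultralimits.

Section Ultrapower.
Variables (R : realType) (L : language R) (M : structure L).
Variables (U : set_system nat).
Hypothesis UU : UltraFilter U.

Let PU : ProperFilter U. Proof. exact: ultra_proper. Qed.
Let X := nat -> M.

Definition udist (x y : X) : \bar R := ulim UU (fun k => dist (x k) (y k)).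

Lemma udist_ge0 x y : (0 <= udist x y)%E.
Proof.
by apply: ulim_ge_cst; apply: filterS (@filterT _ U _) => k _ /=; exact: dist_ge0.
Qed.

Lemma udist_xx x : udist x x = 0%E.
Proof.
rewrite /udist (_ : (fun k => _) = fun=> 0%E) ?ulim_cst//.
by apply: funext => k; rewrite dist_xx.
Qed.

Lemma udist_sym x y : udist x y = udist y x.
Proof. by congr ulim; apply: funext => k; rewrite dist_sym. Qed.

Lemma udist_le x y (e : R) : U [set k | (dist (x k) (y k) <= e%:E)%E] -> (udist x y <= e%:E)%E.
Proof. exact: ulim_le_cst. Qed.

Lemma udist_lt x y (e : R) : (udist x y < e%:E)%E -> U [set k | (dist (x k) (y k) < e%:E)%E].
Proof. exact: ulim_lt. Qed.

Lemma udist_triangle x y z : (udist x z <= udist x y + udist y z)%E.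
Proof.
have := udist_ge0 x y; have := udist_ge0 y z.
case Exy : (udist x y) => [a| |] //; case Eyz : (udist y z) => [b| |] // _ _; try by rewrite leey.
apply/lee_addgt0Pr => e e0; have e20 : 0 < e / 2 by lra.
have H1 : U [set k | (dist (x k) (y k) < (a + e / 2)%:E)%E].
  by apply: udist_lt; rewrite Exy lte_fin; lra.
have H2 : U [set k | (dist (y k) (z k) < (b + e / 2)%:E)%E].
  by apply: udist_lt; rewrite Eyz lte_fin; lra.
apply: udist_le; apply: filterS (filterI H1 H2) => k /= [h1 h2].
by apply/ltW/(dist_lt_trans (dist_lt_triangle h1 h2)); lra.
Qed.

Definition ueq (x y : X) : Prop := udist x y = 0%E.

Lemma udist_ueq x x' y y' : ueq x x' -> ueq y y' -> udist x y = udist x' y'.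
Proof.
have half u u' v v' : ueq u u' -> ueq v v' -> (udist u v <= udist u' v')%E.
  move=> uu' vv'; apply: le_trans (udist_triangle u u' v) _; rewrite uu' add0e.
  by apply: le_trans (udist_triangle u' v' v) _; rewrite (udist_sym v') vv' adde0.
move=> xx' yy'; apply/eqP; rewrite eq_le !half// /ueq udist_sym//.
Qed.

Definition ucls (x : X) : set X := [set y | ueq x y].
Definition ucarrier := {S : set X | exists x, S = ucls x}.
Definition uclass (x : X) : ucarrier := exist _ (ucls x) (ex_intro _ x erefl).
Definition urep (q : ucarrier) : X := sval (cid (svalP q)).

Lemma uclass_eq x y : ueq x y -> uclass x = uclass y.
Proof.
move=> xy; apply: eq_exist; apply/seteqP; split=> z xz.
  by rewrite /ucls /= /ueq -(udist_ueq xy (udist_xx z)).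
by rewrite /ucls /= /ueq (udist_ueq xy (udist_xx z)).
Qed.

Lemma urep_class x : ueq x (urep (uclass x)).
Proof.
rewrite /urep; case: cid => y /= E.
by have : ucls x y by rewrite E; exact: udist_xx.
Qed.

Lemma uclass_rep q : uclass (urep q) = q.
Proof. by case: q => S SP; apply: eq_exist; rewrite /urep; case: cid => y /= ->. Qed.

Lemma unif_close (s : nat) (x y : 'I_s -> X) (e : R) :
  (forall i, (udist (x i) (y i) < e%:E)%E) ->
  U [set k | forall i, (dist (x i k) (y i k) < e%:E)%E].
Proof. by move=> xy; apply: filter_forall => i; exact: udist_lt. Qed.

Definition ufinterp (s : fsym L) (a : 'I_(far s) -> ucarrier) : ucarrier :=
  uclass (fun k => finterp M s (fun i => urep (a i) k)).

Definition upinterp (s : psym L) (a : 'I_(par s) -> ucarrier) : \bar R :=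
  ulim UU (fun k => pinterp M s (fun i => urep (a i) k)).

Definition uqdist (p q : ucarrier) : \bar R := udist (urep p) (urep q).

Lemma uqdist_class x y : uqdist (uclass x) (uclass y) = udist x y.
Proof. by apply/esym/udist_ueq; exact: urep_class. Qed.

Lemma uqdist_eq0 p q : uqdist p q = 0%E <-> p = q.
Proof.
split=> [pq|->]; last exact: udist_xx.
by rewrite -(uclass_rep p) -(uclass_rep q); exact: uclass_eq.
Qed.

Lemma udist_finterp (s : fsym L) (x y : 'I_(far s) -> X) (e : R) : 0 < e ->
  (forall i, (udist (x i) (y i) < (fmodulus s e)%:E)%E) ->
  (udist (fun k => finterp M s (fun i => x i k)) (fun k => finterp M s (fun i => y i k)) <= e%:E)%E.
Proof.
move=> e0 xy; apply: udist_le; apply: filterS (unif_close xy) => k /= H.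
exact: finterp_ucont.
Qed.

Lemma ulim_pinterp (s : psym L) (x y : 'I_(par s) -> X) (e : R) : 0 < e ->
  (forall i, (udist (x i) (y i) < (pmodulus s e)%:E)%E) ->
  egap (ulim UU (fun k => pinterp M s (fun i => x i k)))
       (ulim UU (fun k => pinterp M s (fun i => y i k))) <= e.
Proof.
move=> e0 xy; apply: ulim_gap; apply: filterS (unif_close xy) => k /= H.
exact: pinterp_ucont.
Qed.

Hypothesis Uoo : forall k0, U [set k | (k0 <= k)%N].

Lemma last_below (P : nat -> Prop) k : P 0%N ->
  exists J, P J /\ forall j, (j <= k)%N -> P j -> (j <= J)%N.
Proof.
move=> P0; elim: k => [|k [J [PJ JP]]]; first by exists 0%N.
have [Pk|nPk] := pselect (P k.+1); first by exists k.+1.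
exists J; split=> // j; rewrite leq_eqVlt => /predU1P[->//|]; exact: JP.
Qed.

Lemma chain_bound (v : nat -> M) j m : (j <= m)%N ->
  (forall i, (i < m)%N -> (dist (v i) (v i.+1) < (1 / 2 ^+ i)%:E)%E) ->
  (dist (v j) (v m) < (2 / 2 ^+ j)%:E)%E.
Proof.
move=> jm vP; have := @cauchy_far R L M (fun i => v (minn i m)) 1 j ltr01.
have H i : (j <= i)%N -> (dist (v (minn i m)) (v (minn i.+1 m)) < (1 / 2 ^+ i)%:E)%E.
  move=> _; have [im|mi] := ltnP i m.
    by rewrite (minn_idPl im); exact: vP.
  by rewrite (minn_idPr (leqW mi)) dist_xx lte_fin divr_gt0// exprn_gt0.
move=> /(_ H (m - j)%N); rewrite subnKC// minnn (minn_idPl jm).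
by rewrite mulr1.
Qed.

(** A diagonal argument. After passing to a subsequence with gaps below [1 / 2 ^+ j], coordinate [k]
    follows it up to the last index [J k <= k] for which all earlier gaps are this small at [k].
    Each index is reached for almost all [k], because the ultrafilter contains the final
    segments. *)
Lemma uqdist_complete (u : nat -> ucarrier) :
  (forall e : R, 0 < e -> exists N, forall m n, (N <= m)%N -> (N <= n)%N ->
     (uqdist (u m) (u n) < e%:E)%E) ->
  exists l, forall e : R, 0 < e -> exists N, forall n, (N <= n)%N ->
     (uqdist (u n) l < e%:E)%E.
Proof.
move=> uC; have p2 j : 0 < 1 / 2 ^+ j :> R by rewrite divr_gt0// exprn_gt0.
have /choice[s sP] : forall j, exists N, forall m n, (N <= m)%N -> (N <= n)%N ->
    (uqdist (u m) (u n) < (1 / 2 ^+ j)%:E)%E by move=> j; exact: uC.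
pose t j := (\max_(i < j.+1) s i)%N.
have st j : (s j <= t j)%N by exact: (@leq_bigmax _ (fun i : 'I_j.+1 => s i) ord_max).
have tt j : (t j <= t j.+1)%N.
  apply/bigmax_leqP => i _.
  exact: (@leq_bigmax _ (fun i : 'I_j.+2 => s i) (widen_ord (leqnSn _) i)).
pose v j : X := urep (u (t j)).
have vP j : (udist (v j) (v j.+1) < (1 / 2 ^+ j)%:E)%E.
  by apply: sP => //; exact: leq_trans (st j) (tt j).
pose good k j := forall i, (i < j)%N -> (dist (v i k) (v i.+1 k) < (1 / 2 ^+ i)%:E)%E.
have Ugood j : U [set k | good k j].
  elim: j => [|j IH]; first by apply: filterS (@filterT _ U _) => k _ i.
  apply: filterS (filterI IH (udist_lt (vP j))) => k /= [H1 H2] i.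
  by rewrite ltnS leq_eqVlt => /predU1P[->//|]; exact: H1.
have /choice[J JP] : forall k, exists J, good k J /\ forall j, (j <= k)%N -> good k j -> (j <= J)%N.
  by move=> k; exact: last_below.
pose y k := v (J k) k.
have vy j : (udist (v j) y <= (2 / 2 ^+ j)%:E)%E.
  apply: udist_le; apply: filterS (filterI (Ugood j) (Uoo j)) => k /= [H1 H2].
  have [JG JM] := JP k; apply/ltW/(chain_bound (v := fun i => v i k)) => //.
  exact: JM.
exists (uclass y) => e e0; have [j je] := half_pow_small 3 e0.
exists (s j) => n sn; rewrite -(uclass_rep (u n)) uqdist_class.
apply: le_lt_trans (udist_triangle _ (v j) _) _.
have H : (udist (urep (u n)) (v j) < (1 / 2 ^+ j)%:E)%E by exact: sP.
apply: lt_le_trans (lte_leD _ H (vy j)) _.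
  by have := udist_ge0 (v j) y; have := le_lt_trans (vy j) (ltry _); case: (udist _ _).
by rewrite -EFinD lee_fin; move: je; set q := (2 ^+ j)^-1; lra.
Qed.

Lemma ufinterp_ucont (s : fsym L) (e : R) (x y : 'I_(far s) -> ucarrier) : 0 < e ->
  (forall i, (uqdist (x i) (y i) < (fmodulus s e)%:E)%E) ->
  (uqdist (ufinterp x) (ufinterp y) <= e%:E)%E.
Proof. by move=> e0 xy; rewrite /ufinterp uqdist_class; exact: udist_finterp. Qed.

Lemma upinterp_ucont (s : psym L) (e : R) (x y : 'I_(par s) -> ucarrier) : 0 < e ->
  (forall i, (uqdist (x i) (y i) < (pmodulus s e)%:E)%E) ->
  egap (upinterp x) (upinterp y) <= e.
Proof. by move=> e0 xy; exact: ulim_pinterp. Qed.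

Lemma ucarrier_inhabited : inhabited ucarrier.
Proof. by have [x _] := carrier_point M; exists; exact: (uclass (fun=> x)). Qed.

Definition ultrapower : structure L :=
  {| carrier := ucarrier;
     carrier_inhabited := ucarrier_inhabited;
     dist := uqdist;
     finterp := ufinterp;
     pinterp := upinterp;
     dist_ge0 := fun p q => udist_ge0 (urep p) (urep q);
     dist_eq0 := uqdist_eq0;
     dist_sym := fun p q => udist_sym (urep p) (urep q);
     dist_triangle := fun p q r => udist_triangle (urep p) (urep q) (urep r);
     dist_complete := uqdist_complete;
     finterp_ucont := ufinterp_ucont;
     pinterp_ucont := upinterp_ucont |}.

Lemma ultrapower_teval n (t : term L n) (a : 'I_n -> X) :
  teval (fun i => uclass (a i) : ultrapower) t =
  uclass (fun k => teval (fun i => a i k) t).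
Proof.
elim: t => //= s ts IH; apply: uclass_eq; apply/eqP; rewrite eq_le udist_ge0 andbT.
apply/lee_addgt0Pr => e e0; rewrite add0e.
apply: (@udist_finterp s (fun i => urep (teval (fun i => uclass (a i) : ultrapower) (ts i)))
  (fun i k => teval (fun j => a j k) (ts i))) => // i.
rewrite IH udist_sym (urep_class _ : udist _ _ = 0%E) lte_fin; exact: fmodulus_gt0.
Qed.

Lemma scons_swap n (x : X) (a : 'I_n -> X) k :
  (fun i => scons x a i k) = scons (x k) (fun i => a i k).
Proof.
apply: funext => i; case: (unliftP ord0 i) => [j ->|->]; first by rewrite !scons_lift.
by rewrite !scons0.
Qed.

Lemma scons_class n (x : X) (a : 'I_n -> X) :
  (fun i => uclass (scons x a i) : ultrapower) = scons (uclass x) (fun i => uclass (a i)).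
Proof.
apply: funext => i; case: (unliftP ord0 i) => [j ->|->]; first by rewrite !scons_lift.
by rewrite !scons0.
Qed.

(** Connectives pass to the ultralimit by uniform continuity. For a quantifier, near-optimal
    witnesses chosen at each coordinate form a witness in the ultrapower. *)
Lemma los n (phi : fml L n) (a : 'I_n -> X) :
  eval phi (fun i => uclass (a i) : ultrapower) =
  ulim UU (fun k => eval phi (fun i => a i k)).
Proof.
elim: phi a => {n} [n t1 t2|n s ts|n k u cu args IH|n psi IH|n psi IH] a /=.
- by rewrite !ultrapower_teval uqdist_class.
- apply: egap_eq => e e0.
  apply: (@ulim_pinterp s (fun i => urep (teval (fun i => uclass (a i) : ultrapower) (ts i)))
    (fun i k => teval (fun j => a j k) (ts i))) => // i.
  rewrite ultrapower_teval udist_sym (urep_class _ : udist _ _ = 0%E) lte_fin; exact: pmodulus_gt0.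
- apply/esym/ulim_unique => e e0; have [d d0 dP] := conn_ucont cu e0.
  have H : U [set m | forall i, egap (eval (args i) (fun i => uclass (a i) : ultrapower))
      (eval (args i) (fun i => a i m)) < d].
    by apply: filter_forall => i; rewrite IH; exact: ulimP.
  by apply: filterS H => m /=; exact: dP.
- apply/eqP; rewrite eq_le; apply/andP; split.
    apply: ge_ereal_sup => _ [q _ <-]; rewrite -(uclass_rep q) -scons_class IH.
    apply: ulim_le; apply: filterS (@filterT _ U _) => k _ /=; rewrite scons_swap.
    by apply: ereal_sup_ubound; exists (urep q k).
  rewrite leNgt; apply/negP => /ereal_between[r /andP[r1 r2]].
  have /choice[x xP] : forall k, exists x : M,
      (exists x, (r < eval psi (scons x (fun i => a i k)))%E) -> (r < eval psi (scons x (fun i => a i k)))%E.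
    by move=> k; have [x0 _] := carrier_point M; exact: (exists_witness _ x0).
  have : (r <= eval psi (scons (uclass x : ultrapower) (fun i => uclass (a i))))%E.
    rewrite -scons_class IH; apply: ulim_ge_cst; apply: filterS (ulim_gt r2) => k /= /ereal_sup_gt[_ [z _ <-] rz].
    by rewrite scons_swap; apply/ltW/xP; exists z.
  apply/negP; rewrite -ltNge; apply: le_lt_trans r1.
  by apply: ereal_sup_ubound; exists (uclass x).
- apply/eqP; rewrite eq_le; apply/andP; split; last first.
    apply: le_ereal_inf_tmp => _ [q _ <-]; rewrite -(uclass_rep q) -scons_class IH.
    apply: ulim_le; apply: filterS (@filterT _ U _) => k _ /=; rewrite scons_swap.
    by apply: ereal_inf_lbound; exists (urep q k).
  rewrite leNgt; apply/negP => /ereal_between[r /andP[r1 r2]].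
  have /choice[x xP] : forall k, exists x : M,
      (exists x, (eval psi (scons x (fun i => a i k)) < r)%E) -> (eval psi (scons x (fun i => a i k)) < r)%E.
    by move=> k; have [x0 _] := carrier_point M; exact: (exists_witness _ x0).
  have : (eval psi (scons (uclass x : ultrapower) (fun i => uclass (a i))) <= r)%E.
    rewrite -scons_class IH; apply: ulim_le_cst; apply: filterS (ulim_lt r1) => k /= /ereal_inf_lt[_ [z _ <-] rz].
    by rewrite scons_swap; apply/ltW/xP; exists z.
  apply/negP; rewrite -ltNge; apply: lt_le_trans r2 _.
  by apply: ereal_inf_lbound; exists (uclass x).
Qed.

End Ultrapower.

(** The interface through which ultrapowers are used from here on. The index type [I] is arbitrary,
    so that pairs of tuples and infinite sequences have limits too. *)
Lemma ultra_realise (R : realType) (L : language R) (M : structure L)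
    (I : Type) (a : nat -> I -> M) : exists (N : structure L) (A : I -> N),
  (exists f : M -> N, elementary f) /\
  forall n (s : 'I_n -> I) (P : condition L n), is_open P -> P N (A \o s) ->
    forall k0, exists2 k, (k0 <= k)%N & P M (a k \o s).
Proof.
have [U UU Uoo] := ultra_eventually; have PU : ProperFilter U by exact: ultra_proper.
exists (ultrapower M UU Uoo), (fun i => uclass UU (fun k => a k i)); split.
  exists (fun x => uclass UU (fun=> x)) => n phi b _.
  by rewrite (los UU Uoo phi (fun i _ => b i)) ulim_cst.
move=> n s P [psi psiP] /psiP; rewrite (los UU Uoo psi (fun i k => a k (s i))) => /ulim_lt H k0.
by have [k [k1 k2]] := filter_ex (filterI H (Uoo k0)); exists k => //; apply/psiP.
Qed.

(** * Compactness and omitting types *)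

Section Compactness.
Variables (R : realType) (L : language R) (T : theory L).
Hypothesis sL : separable_language L.
Hypothesis cT : complete_theory T.
Implicit Types (M N : structure L) (n m k : nat).

Lemma open_consistent m (P : condition L m) N : is_open P ->
  (exists M, models M T /\ exists a : 'I_m -> M, P M a) -> models N T ->
  exists a : 'I_m -> N, P N a.
Proof.
move=> oP [M [MT [a Pa]]] NT.
pose e0 (X : Type) : 'I_0 -> X := fun i => match notF (ltn_ord i) with end.
(* With no entries to compare, [open_near] is plain existential quantification. It gives a condition
   on the empty tuple, whose type is fixed by completeness. *)
have oE := open_near (e0 'I_m) (e0 'I_0) 0 oP.
have [|b [Pb _]] := open_tp oE (complete_tp0 (e0 M) (e0 N) cT MT NT); last by exists b.
by exists a; split=> // -[].
Qed.

Let f n : nat -> fml L n := sval (cid (sL n)).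

Let fP n (psi : fml L n) (e : R) : 0 < e -> exists k, forall N (a : 'I_n -> N),
  egap (eval psi a) (eval (f n k) a) <= e.
Proof. exact: (svalP (cid (sL n))). Qed.

(** These are countably many basic neighbourhoods of the type of [a], cofinal among all by
    [approx_gap]; this is where the separability of the language enters. *)
Definition approx n M (a : 'I_n -> M) k : condition L n := fun N x =>
  forall j : 'I_k, egap (eval (f n j) a) (eval (f n j) x) < k.+1%:R^-1.

Lemma open_approx n M (a : 'I_n -> M) k : is_open (approx a k).
Proof. by apply: open_forall => j; exact: open_gap. Qed.

Lemma approx_refl n M (a : 'I_n -> M) k : approx a k a.
Proof. by move=> j; rewrite egapxx invr_gt0. Qed.

Lemma approx_gap n M (a : 'I_n -> M) (phi : fml L n) (e : R) : 0 < e ->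
  exists k0, forall k N (x : 'I_n -> N), (k0 <= k)%N -> approx a k x ->
    egap (eval phi a) (eval phi x) < e.
Proof.
move=> e0; have e40 : 0 < e / 4 by lra.
have [j jP] := fP phi e40.
have [k1 _ H] := near_infty_natSinv_lt (PosNum e40).
exists (maxn k1 j.+1) => k N x; rewrite geq_max => /andP[k1k jk] ax.
have H1 := H k k1k; rewrite /= in H1; have H2 := ax (Ordinal jk); rewrite /= in H2.
have := egap_triangle (eval phi a) (eval (f n j) a) (eval phi x).
have := egap_triangle (eval (f n j) a) (eval (f n j) x) (eval phi x).
rewrite (egap_sym (eval (f n j) x)); have := jP M a; have := jP N x.
have := lt_trans H2 H1; lra.
Qed.

Lemma ultra_tp n M (a : 'I_n -> M) N (b : 'I_n -> N) :
  (forall P : condition L n, is_open P -> P N b -> forall k0, exists2 k, (k0 <= k)%N &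
     exists N' (x : 'I_n -> N'), approx a k x /\ P N' x) -> tp b = tp a.
Proof.
move=> H; apply/tp_eqP => phi; apply: egap_eq => e e0; rewrite leNgt; apply/negP => gap.
have e20 : 0 < e / 2 by lra.
have [k0 k0P] := approx_gap a phi e20.
have [k k0k [N' [x [ax]]]] := H _ (open_gap phi (eval phi b) (e / 2)) (eq_ind_r (fun t => t < _) e20 (egapxx _)) k0.
move=> /= xb; have ax' := k0P k N' x k0k ax.
have := egap_triangle (eval phi b) (eval phi x) (eval phi a).
by rewrite (egap_sym (eval phi x)); lra.
Qed.

(** Lower semicontinuity of the type metric. Completeness puts close pairs approximating both types
    into the single model [M], and their limit in an ultrapower is an exact pair at distance at most
    [e]; the factor 2 only makes the bound strict. *)
Lemma dist_typ_lsc n M N (a : 'I_n -> M) (b : 'I_n -> N) (e : R) :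
  models M T -> 0 < e ->
  (forall P Q : condition L n, is_open P -> is_open Q -> P M a -> Q N b ->
     exists M', models M' T /\ exists x y : 'I_n -> M', [/\ P M' x, Q M' y & close x y e]) ->
  (dist_typ T (tp a) (tp b) < (2 * e)%:E)%E.
Proof.
move=> MT e0 H.
have /choice[z zP] : forall k, exists z : 'I_n + 'I_n -> M,
    [/\ approx a k (z \o inl), approx b k (z \o inr) & close (z \o inl) (z \o inr) e].
  move=> k; pose P : condition L (n + n) := fun N z => (approx a k (z \o lshift n) /\
    approx b k (z \o @rshift n n)) /\ forall i, (dist (z (lshift n i)) (z (rshift n i)) < e%:E)%E.
  have oP : is_open P.
    apply: open_and; last by apply: open_forall => i; exact: open_dist.
    by apply: open_and; apply: open_ren; exact: open_approx.
  have [|z [[z1 z2] z3]] := open_consistent oP _ MT.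
    have [M' [M'T [x [y [xP yQ xy]]]]] := H _ _ (open_approx a k) (open_approx b k)
      (@approx_refl _ _ a k) (@approx_refl _ _ b k).
    exists M'; split=> //; exists (tcat x y); split=> [|i]; last by rewrite tcat_lshift tcat_rshift.
    split.
      by rewrite (_ : _ \o _ = x)//; apply: funext => i /=; rewrite tcat_lshift.
    by rewrite (_ : _ \o _ = y)//; apply: funext => i /=; rewrite tcat_rshift.
  by exists (fun i => match i with inl j => z (lshift n j) | inr j => z (rshift n j) end).
have [N' [A [[g eg] AP]]] := ultra_realise z.
have e20 : 0 < 2 * e by lra.
apply/dist_typ_ltP => //; exists N'; split; first exact: elementary_models_fwd eg MT.
exists (A \o inl), (A \o inr); split.
- apply: ultra_tp => P oP PA k0; have [k k0k Pk] := AP n inl P oP PA k0.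
  by exists k => //; exists M, (z k \o inl); split=> //; have [] := zP k.
- apply: ultra_tp => P oP PA k0; have [k k0k Pk] := AP n inr P oP PA k0.
  by exists k => //; exists M, (z k \o inr); split=> //; have [] := zP k.
move=> i; apply: (@le_lt_trans _ _ e%:E); last by rewrite lte_fin; lra.
rewrite leNgt; apply/negP => gap.
have oG := open_gt (Fdist (Tvar L (ord0 : 'I_2)) (Tvar L ord_max)) (contract e%:E).
pose s : 'I_2 -> 'I_n + 'I_n := pair2 (inl i) (inr i).
have [|k _] := AP 2 s _ oG _ 0%N; first by rewrite lt_contract.
rewrite lt_contract; apply/negP; rewrite -leNgt ltW//.
by have [_ _] := zP k; apply.
Qed.

(** In an ultrapower of [M], the tuple [a] stays constant while [b] is the limit of tuples of [M]
    approximating its type. *)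
Lemma joint_realisation n m M N (a : 'I_n -> M) (b : 'I_m -> N) :
  models M T -> models N T -> exists K : structure L, models K T /\
    exists (a' : 'I_n -> K) (b' : 'I_m -> K), tp a' = tp a /\ tp b' = tp b.
Proof.
move=> MT NT.
have /choice[z zP] : forall k, exists z : 'I_m -> M, approx b k z.
  move=> k; apply: (open_consistent (open_approx b k)) => //.
  by exists N; split=> //; exists b; exact: approx_refl.
pose c k (i : 'I_n + 'I_m) : M := match i with inl j => a j | inr j => z k j end.
have [K [A [[g eg] AP]]] := ultra_realise c.
exists K; split; first exact: elementary_models_fwd eg MT.
exists (A \o inl), (A \o inr); split.
  apply: ultra_tp => P oP PA k0; have [k k0k Pk] := AP n inl P oP PA k0.
  by exists k => //; exists M, a; split=> //; exact: approx_refl.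
apply: ultra_tp => P oP PA k0; have [k k0k Pk] := AP m inr P oP PA k0.
by exists k => //; exists M, (z k); split.
Qed.

(** Conditions on a sequence of Henkin constants; a forcing condition will be one that is open and
    bears on finitely many terms. *)
Definition scondition := forall M, (nat -> M) -> Prop.

Definition seq_open (P : scondition) := exists m (Q : condition L m),
  is_open Q /\ forall M (a : nat -> M), P M a <-> Q M (res m a).

Definition consistent (P : scondition) :=
  exists M, models M T /\ exists a : nat -> M, P M a.

Lemma seq_open_ge (P : scondition) : seq_open P ->
  exists m0, forall m, (m0 <= m)%N -> exists Q : condition L m,
    is_open Q /\ forall M (a : nat -> M), P M a <-> Q M (res m a).
Proof.
move=> [m0 [Q [oQ PQ]]]; exists m0 => m m0m.
exists (fun M x => Q M (x \o widen_ord m0m)); split; first exact: open_ren.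
by move=> M a; rewrite PQ.
Qed.

Lemma seq_open_and (P Q : scondition) : seq_open P -> seq_open Q ->
  seq_open (fun M a => P M a /\ Q M a).
Proof.
move=> /seq_open_ge[m Pm] /seq_open_ge[m' Qm'].
have [P' [oP' PP']] := Pm _ (leq_maxl m m'); have [Q' [oQ' QQ']] := Qm' _ (leq_maxr m m').
exists (maxn m m'), (fun M x => P' M x /\ Q' M x); split; first exact: open_and.
by move=> M a; rewrite PP' QQ'.
Qed.

Lemma seq_open_comp n (P : condition L n) (s : 'I_n -> nat) : is_open P ->
  seq_open (fun M a => P M (a \o s)).
Proof.
move=> oP; pose m := (\max_(i < n) s i).+1.
have sm i : (s i < m)%N by rewrite ltnS; exact: (@leq_bigmax _ s).
exists m, (fun M x => P M (x \o (fun i => Ordinal (sm i)))).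
by split; [exact: open_ren|].
Qed.

Lemma consistent_realise (P : scondition) N : seq_open P -> consistent P ->
  models N T -> exists a : nat -> N, P N a.
Proof.
move=> [m [Q [oQ PQ]]] [M [MT [a /PQ Pa]]] NT.
have [|x Qx] := open_consistent oQ _ NT; first by exists M; split=> //; exists (res m a).
have [y0 _] := carrier_point N.
exists (fun i => if (insub i : option 'I_m) is Some j then x j else y0); apply/PQ.
rewrite (_ : res m _ = x)//; apply: funext => i /=.
by rewrite (insubT (fun i => i < m)%N (ltn_ord i)); congr x; exact/val_inj.
Qed.

Lemma seq_open_fresh (P : scondition) : seq_open P ->
  exists m, forall M (a : nat -> M) j x, (m <= j)%N -> P M (upd a j x) <-> P M a.
Proof.
move=> [m [Q [oQ PQ]]]; exists m => M a j x mj; rewrite !PQ.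
rewrite (_ : res m (upd a j x) = res m a)//; apply: funext => i /=.
by rewrite /upd ltn_eqF// (leq_trans (ltn_ord i)).
Qed.

(* [P'] forces the requirement [Q], uniformly enough for [Q] to survive in
   limits: it excludes an open condition whose failure entails [Q]. *)
Definition forces (P P' Q : scondition) := [/\ seq_open P', consistent P',
  forall M a, P' M a -> P M a &
  exists D : scondition, [/\ seq_open D,
    forall M a, models M T -> P' M a -> ~ D M a &
    forall M a, models M T -> ~ D M a -> Q M a]].

(** If no sequence satisfying [P] has a witness below [r], then [P] already forces the implication.
    Otherwise a fresh constant becomes a witness. The excluded open condition is [r < ...], which is
    why the conclusion reads [<= r]. *)
Lemma forces_witness (P : scondition) n k (r : R) (s : 'I_n -> nat) :
  seq_open P -> consistent P ->
  exists P', forces P P' (fun M a =>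
    (exists x, contract (eval (f n.+1 k) (scons x (a \o s))) < r) ->
    exists j, contract (eval (f n.+1 k) (scons (a j) (a \o s))) <= r).
Proof.
move=> oP cP; pose H : scondition := fun M a =>
  exists x, contract (eval (f n.+1 k) (scons x (a \o s))) < r.
have oH : seq_open H := (seq_open_comp s (open_ex (open_lt (f n.+1 k) r))).
have [[M [MT [a [Pa [x xr]]]]]|nPH] := pselect (consistent (fun M a => P M a /\ H M a)); last first.
  exists P; split=> //; exists H; split=> // M a MT Pa Ha.
  by apply: nPH; exists M; split=> //; exists a.
have [m mP] := seq_open_fresh oP.
(* The index [j] lies beyond the terms constrained by [P] and beyond all parameters. *)
pose j := (maxn m (\max_(i < n) s i).+1).
have sj i : (s i < j)%N.
  by apply: leq_trans (leq_maxr _ _); rewrite ltnS; exact: (@leq_bigmax _ s).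
have sE N (b : nat -> N) : b \o (scons j s) = scons (b j) (b \o s).
  by apply: funext => i; rewrite /scons /=; case: (unlift ord0 i).
exists (fun N b => P N b /\ contract (eval (f n.+1 k) (b \o (scons j s))) < r); split.
- by apply: seq_open_and => //; exact: (seq_open_comp (scons j s) (open_lt (f n.+1 k) r)).
- exists M; split=> //; exists (upd a j x); split; first by apply/mP => //; exact: leq_maxl.
  rewrite sE /upd eqxx (_ : _ \o s = a \o s)//.
  by apply: funext => i /=; rewrite ltn_eqF.
- by move=> N b [].
- exists (fun N b => r < contract (eval (f n.+1 k) (b \o (scons j s)))); split.
  + exact: (seq_open_comp (scons j s) (open_gt (f n.+1 k) r)).
  + by move=> N b _ [_ br] /(lt_trans br); rewrite ltxx.
  + by move=> N b _ /negP; rewrite -leNgt sE => br _; exists j.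
Qed.

(** Some tuple [b] near constants allowed by [P] has a type at distance at least [e] from that of
    [p]. By lower semicontinuity there are neighbourhoods [W] of [p] and [W'] of [b] without members
    at distance below [e / 2]. Then [P'] puts the constants within [e / 4] of [W'], which excludes
    the open condition of being within [e / 4] of [W]. Nearness replaces equality in [O] to keep it
    open even when [s] repeats indices. *)
Lemma forces_omit (P : scondition) n M (p : 'I_n -> M) (e : R) (s : 'I_n -> nat) :
  0 < e -> models M T ->
  (forall Q : condition L n, is_open Q ->
    (exists M', models M' T /\ exists a : 'I_n -> M', Q M' a) ->
    exists N, models N T /\ exists b : 'I_n -> N,
      Q N b /\ ~ (dist_typ T (tp p) (tp b) < e%:E)%E) ->
  seq_open P -> consistent P ->
  exists P', forces P P' (fun M a => forall x : 'I_n -> M, tp x = tp p ->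
    ~ close x (a \o s) (e / 4)).
Proof.
move=> e0 MT pP oP [M0 [M0T [a0 Pa0]]].
have e40 : 0 < e / 4 by lra.
have [m0 m0P] := seq_open_ge oP.
pose m := maxn m0 (\max_(i < n) s i).+1.
have sm i : (s i < m)%N.
  by apply: leq_trans (leq_maxr _ _); rewrite ltnS; exact: (@leq_bigmax _ s).
have [Q [oQ PQ]] := m0P m (leq_maxl _ _).
pose O : condition L n := fun N z => exists y : 'I_m -> N, Q N y /\
  forall i, (dist (y (Ordinal (sm i))) (z i) < (e / 4)%:E)%E.
have oO : is_open O by exact: (@open_near _ _ m n n Q (fun i => Ordinal (sm i)) id).
have [|N [NT [b [[y [Qy yb]] pb]]]] := pP O oO.
  exists M0; split=> //; exists (a0 \o s), (res m a0); split; first exact/PQ.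
  by move=> i /=; rewrite dist_xx lte_fin.
have [W [W' [oW oW' Wp W'b WW']]] : exists W W' : condition L n,
    [/\ is_open W, is_open W', W M p, W' N b &
    forall (K : structure L) (x z : 'I_n -> K), models K T -> W K x -> W' K z -> ~ close x z (e / 2)].
  apply: contrapT => nW; apply: pb.
  have -> : e = 2 * (e / 2) by rewrite mulrCA divff// mulr1.
  apply: dist_typ_lsc => //; first by lra.
  move=> W W' oW oW' Wp W'b; apply: contrapT => nK; apply: nW.
  exists W, W'; split=> // K x z KT Wx W'z xz; apply: nK; exists K; split=> //.
  by exists x, z.
exists (fun K a => P K a /\ exists z, W' K z /\ close z (a \o s) (e / 4)); split.
- by apply: seq_open_and => //; apply: (seq_open_comp s (open_around (e / 4) oW')).
- have [y0 _] := carrier_point N.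
  pose c i := if (insub i : option 'I_m) is Some j then y j else y0.
  have cE : res m c = y.
    apply: funext => i /=; rewrite /c (insubT (fun i => i < m)%N (ltn_ord i)).
    by congr y; exact/val_inj.
  exists N; split=> //; exists c; split; first by apply/PQ; rewrite cE.
  exists b; split=> // i; have := yb i; rewrite -cE dist_sym /=; exact.
- by move=> K a [].
- exists (fun K a => exists x, W K x /\ close x (a \o s) (e / 4)); split.
  + exact: (seq_open_comp s (open_around (e / 4) oW)).
  + move=> K a KT [_ [z [W'z za]]] [x [Wx xa]]; apply: (WW' K x z KT Wx W'z).
    by apply: close_le (close_trans xa (close_sym za)) _; lra.
  + move=> K a _ nD x xp xa; apply: nD; exists x; split=> //.
    exact: open_tp oW (esym xp) Wp.
Qed.

(** Every stage is realised in one model, by completeness, and the limit of these realisations in an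
    ultrapower serves as the generic sequence. If an excluded condition held of the limit, it would
    hold at some later stage, being open. *)
Lemma forcing (Req : nat -> scondition) :
  (forall c P, seq_open P -> consistent P -> exists P', forces P P' (Req c)) ->
  exists N (A : nat -> N), models N T /\ forall c, Req c N A.
Proof.
move=> step; have [[M0 M0T] _] := cT.
pose S := {P : scondition | seq_open P /\ consistent P}.
have nxt c (P : S) : {P' : S | forces (sval P) (sval P') (Req c)}.
  apply: cid; have [oP cP] := svalP P; have [P' fP'] := step c _ oP cP.
  have [oP' cP' _ _] := fP'; by exists (exist _ P' (conj oP' cP')).
have P0 : seq_open (fun M a => True) /\ consistent (fun M a => True).
  split; first by exists 0%N, (fun M a => True); split=> //; exact: open_true.
  by have [x _] := carrier_point M0; exists M0; split=> //; exists (fun=> x).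
pose u := fix u k : S := if k is j.+1 then sval (nxt j (u j)) else exist _ _ P0.
have uP k : forces (sval (u k)) (sval (u k.+1)) (Req k) := svalP (nxt k (u k)).
have umono j k M a : (j <= k)%N -> sval (u k) M a -> sval (u j) M a.
  elim: k => [|k IH]; first by rewrite leqn0 => /eqP ->.
  rewrite leq_eqVlt => /predU1P[->//|jk] ua; apply: IH => //.
  by have [_ _ H _] := uP k; exact: H.
have /choice[a aP] : forall k, exists a : nat -> M0, sval (u k) M0 a.
  by move=> k; have [ok ck] := svalP (u k); exact: consistent_realise.
have [N [A [[g eg] AP]]] := ultra_realise a.
have NT : models N T by exact: elementary_models_fwd eg M0T.
exists N, A; split=> // c.
have [_ _ _ [D [[m [Q [oQ DQ]]] PD DR]]] := uP c.
apply: DR => // /DQ QA; have [k ck Qk] := AP m (fun i => i) Q oQ QA c.+1.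
apply: (PD M0 (a k) M0T); first exact: umono ck (aP k).
exact/DQ.
Qed.

(** By [almost_isolatedW], non-isolation gives one [e] such that every consistent open condition,
    not only those around [p], contains a type at distance at least [e] from [p]. So any forcing
    condition can be refined away from [p]. *)
Lemma omitting_types n (p : typ L n) : types T n p -> ~ isolated_typ T p ->
  exists N, [/\ models N T, separable_structure N & forall a : 'I_n -> N, tp a <> p].
Proof.
move=> tpp ip; have [M [MT [p0 pp0]]] := tpp.
have [e [e0 pP]] : exists e, 0 < e /\ forall Q : condition L n, is_open Q ->
    (exists M', models M' T /\ exists a : 'I_n -> M', Q M' a) ->
    exists N, models N T /\ exists b : 'I_n -> N,
      Q N b /\ ~ (dist_typ T (tp p0) (tp b) < e%:E)%E.
  apply: contrapT => ne; apply: ip; apply: almost_isolatedW => // e e0.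
  apply: contrapT => nQ; apply: ne; exists e; split=> // Q oQ cQ.
  apply: contrapT => nN; apply: nQ; exists Q; split=> // N b NT Qb.
  by apply: contrapT => nb; apply: nN; exists N; split=> //; exists b; rewrite -pp0.
pose Req (c : nat) : scondition := fun N a =>
  match (unpickle c : option ((nat * nat * rat * seq nat) + seq nat)) with
  | Some (inl (m, k, r, s)) =>
      (exists x, contract (eval (f m.+1 k) (scons x (a \o (fun i : 'I_m => nth 0%N s i)))) < ratr r) ->
      exists j, contract (eval (f m.+1 k) (scons (a j) (a \o (fun i : 'I_m => nth 0%N s i)))) <= ratr r
  | Some (inr s) => forall x : 'I_n -> N, tp x = tp p0 ->
      ~ close x (a \o (fun i : 'I_n => nth 0%N s i)) (e / 4)
  | None => True
  end.
have [c P oP cP|N [A [NT AR]]] := @forcing Req.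
  rewrite /Req; case: unpickle => [[[[[m k] r] s]|s]|].
  - exact: forces_witness.
  - exact: (forces_omit _ e0 MT).
  - exists P; split=> //; exists (fun M a => False); split; [|by move=> ? ? ? ? []|by []].
    (* The empty condition is open: contracted values are at least -1, hence never below -2. *)
    pose z : condition L 0 := fun M a => False.
    exists 0%N, z; split=> //.
    have oz := open_lt (Fsup (Fdist (Tvar L (ord0 : 'I_1)) (Tvar L ord0))) (- 2).
    apply: open_ext oz => K a; split=> //.
    have := contract_le1 (eval (Fsup (Fdist (Tvar L ord0) (Tvar L ord0))) a).
    by rewrite ler_norml => /andP[]; lra.
have idx m (a : 'I_m -> N) : (forall i, range A (a i)) ->
    exists s : seq nat, a = A \o (fun i : 'I_m => nth 0%N s i).
  move=> aA; have /choice[t tP] : forall i, exists j, A j = a i by move=> i; have [j] := aA i; exists j.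
  exists [seq t i | i <- enum 'I_m]; apply: funext => i /=.
  by rewrite (nth_map i) ?size_enum_ord// nth_ord_enum tP.
have tvA : tarski_vaught (range A).
  apply: (tarski_vaught_test fP) => [|m k r a /idx[s ->] ex]; first by exists (A 0%N), 0%N.
  have := AR (pickle (inl (m, k, r, s) : (nat * nat * rat * seq nat) + seq nat)).
  by rewrite /Req pickleK => /(_ ex)[j jr]; exists (A j) => //; exists j.
have subC := tarski_vaught_substructure tvA.
have eC := @tarski_vaught_elementary _ _ _ _ subC tvA.
exists (substructure subC); split.
- exact: elementary_models eC NT.
- apply: (@separable_substructure _ _ _ (range A)) => //.
  exact: sub_countable (card_image_le A setT) (countableP _).
(* A realisation in the closure would have constants within [e / 4], against the requirement for
   them. *)
- move=> a ap; have e40 : 0 < e / 4 by lra.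
  have [b bA ab] := mclosure_tuple (fun i => svalP (a i)) e40.
  have [s bE] := idx _ _ bA; rewrite bE in ab.
  have := AR (pickle (inr s : (nat * nat * rat * seq nat) + seq nat)).
  rewrite /Req pickleK => /(_ (fun i => sval (a i))); apply=> //.
  by rewrite -pp0 -ap -(elementary_tp a eC).
Qed.

End Compactness.

Lemma isolated_tp0 (R : realType) (L : language R) (T : theory L)
    (M : structure L) (a : 'I_0 -> M) :
  complete_theory T -> models M T -> isolated_typ T (tp a).
Proof.
move=> cT MT; apply/isolatedP; split; first by exists M; split=> //; exists a.
move=> e e0; exists (fun N x => True); split=> //; first exact: open_true.
move=> N b NT _; apply/dist_typ_ltP => //; exists M; split=> //; exists a, a.
by split=> //; [exact: complete_tp0 cT MT NT|exact: close_refl].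
Qed.

(** * From isolated types to weak locality *)

Section InvariantEquivalence.
Variables (R : realType) (L : language R) (T : theory L) (E : set (typ L 2)).
Hypothesis invE : invariant_equivalence T E.
Implicit Types (M N : structure L) (n m k : nat).

Lemma sim_refl M (x : M) : models M T -> sim E x x.
Proof. by case: invE => _ H MT; have [r _ _] := H M MT; exact: r. Qed.

Lemma sim_sym M (x y : M) : models M T -> sim E x y -> sim E y x.
Proof. by case: invE => _ H MT; have [_ s _] := H M MT; exact: s. Qed.

Lemma sim_trans M (x y z : M) : models M T -> sim E x y -> sim E y z -> sim E x z.
Proof. by case: invE => _ H MT; have [_ _ t] := H M MT; exact: t. Qed.

Lemma sim_tp M N n (a : 'I_n -> M) (b : 'I_n -> N) i j :
  tp a = tp b -> sim E (a i) (a j) -> sim E (b i) (b j).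
Proof. by move=> ab; rewrite /sim (tp_pair2 i j ab). Qed.

Lemma sim_elementary M N (f : M -> N) x y : elementary f ->
  sim E (f x) (f y) <-> sim E x y.
Proof. by move=> ef; rewrite /sim elementary_tp_pair2. Qed.

Lemma local_sim M : models M T -> (local E M <-> forall x y : M, sim E x y).
Proof.
move=> MT; split=> [[C CE] x y|H].
  have Cx : component E x = C.
    have : components E M (component E x) by exists x.
    by rewrite CE.
  have Cy : component E y = C.
    have : components E M (component E y) by exists y.
    by rewrite CE.
  have : component E y y by exact: sim_refl.
  by rewrite Cy -Cx.
have [x0 _] := carrier_point M; exists setT; apply/seteqP; split=> [_ [x _ <-]|_ ->] /=.
  by apply/seteqP; split=> // y _; exact: H.
by exists x0 => //; apply/seteqP; split=> // y _; exact: H.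
Qed.

Lemma component_eq M (x y : M) : models M T -> sim E x y -> component E x = component E y.
Proof.
move=> MT xy; apply/seteqP; split=> z; last exact: sim_trans.
by apply: sim_trans => //; exact: sim_sym.
Qed.

Lemma component_inj M (x y : M) : models M T -> component E x = component E y -> sim E x y.
Proof. by move=> MT xy; rewrite -[sim E x y]/(component E x y) xy; exact: sim_refl. Qed.

Lemma component_local M (x : M) (subC : is_substructure (component E x)) :
  models M T -> @elementary R L (substructure subC) M (fun x => sval x) ->
  local E (substructure subC).
Proof.
move=> MT eC; apply/local_sim; first exact: elementary_models eC MT.
move=> [y xy] [z xz]; apply/(sim_elementary _ _ eC) => /=.
by apply: sim_trans xz => //; exact: sim_sym.
Qed.

Lemma local_elementary M N (f : M -> N) : models N T -> elementary f ->
  local E N -> local E M.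
Proof.
move=> NT ef /(local_sim NT) lN; apply/local_sim; first exact: elementary_models ef NT.
by move=> x y; apply/(sim_elementary _ _ ef).
Qed.

End InvariantEquivalence.

Section LocallyIsolated.
Variables (R : realType) (L : language R) (T : theory L) (E : set (typ L 2)).
Hypothesis invE : invariant_equivalence T E.
Hypothesis cT : complete_theory T.
Hypothesis liT : forall n (p : typ L n), types T n p -> locally_isolated T p.
Hypothesis simP : forall M : structure L, models M T -> forall a b : M,
  sim E a b <-> isolated_typ T (tp (pair2 a b)).
Implicit Types (M N : structure L) (n m k : nat).

Lemma typ_relE M n (a : 'I_n -> M) i j : models M T ->
  typ_rel T (tp a) i j <-> sim E (a i) (a j).
Proof. by move=> MT; rewrite /typ_rel restr_tp pair2_comp simP. Qed.

(** All entries form one class, whose restriction is isolated. That restriction lists the class by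
    [enum_val], so the tuple is recovered by reindexing. *)
Lemma clique_isolated M n (a : 'I_n -> M) : models M T ->
  (forall i j, sim E (a i) (a j)) -> isolated_typ T (tp a).
Proof.
move=> MT; case: n a => [|n] a aa.
  exact: isolated_tp0.
have [|_ _ H _] := @liT _ (tp a); first by exists M; split=> //; exists a.
have := H ord0; rewrite /restr_set restr_tp => iI.
have I0 i : i \in typ_class T (tp a) ord0.
  by rewrite inE; apply/asboolP/typ_relE => //.
rewrite (_ : a = (a \o (fun k : 'I_#|typ_class T (tp a) ord0| => enum_val k)) \o enum_rank_in (I0 ord0)).
  exact: isolated_comp.
by apply: funext => i /=; rewrite enum_rankK_in.
Qed.

(** The uniqueness clause of local isolation, freed from the enumeration of classes: arbitrary
    families of pairwise equivalent entries take their place. *)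
Lemma locally_isolated_tp M N n (a : 'I_n -> M) (b : 'I_n -> N) :
  models M T -> models N T ->
  (forall i j, sim E (a i) (a j) <-> sim E (b i) (b j)) ->
  (forall m (s : 'I_m -> 'I_n), (forall i j, sim E (a (s i)) (a (s j))) ->
     tp (a \o s) = tp (b \o s)) ->
  tp a = tp b.
Proof.
move=> MT NT ab H.
have [|_ _ _ U] := @liT _ (tp b); first by exists N; split=> //; exists b.
apply: U; first by exists M; split=> //; exists a.
  by move=> i j; rewrite !typ_relE.
move=> i; rewrite /restr_set !restr_tp; apply: H => k l.
have inI j : j \in typ_class T (tp b) i -> sim E (a i) (a j).
  by rewrite inE => /asboolP /(typ_relE _ _ _ NT) /ab.
apply: (sim_trans invE MT (y := a i)); last exact/inI/enum_valP.
exact/(sim_sym invE MT)/inI/enum_valP.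
Qed.

(* Near [a] there is [b] whose type is far from that of [a]. Each class of [b]
   moves slightly to realise the isolated restriction of [tp a]. Were no two
   classes merged, local isolation would make the type of the result [tp a]. *)
Lemma merge_classes M n (a : 'I_n -> M) (W : condition L n) :
  models M T -> ~ isolated_typ T (tp a) -> is_open W -> W M a ->
  exists N (b : 'I_n -> N), [/\ models N T, W N b,
    forall m (s : 'I_m -> 'I_n), (forall i j, sim E (a (s i)) (a (s j))) ->
      tp (a \o s) = tp (b \o s) &
    exists i j, ~ sim E (a i) (a j) /\ sim E (b i) (b j)].
Proof.
move=> MT nia oW Wa.
have [W0 [d [oW0 d0 W0a W0W]]] := open_shrink oW Wa.
have [e [e0 H]] : exists e : R, 0 < e /\ forall P : condition L n, is_open P -> P M a ->
    exists N (b : 'I_n -> N), [/\ models N T, P N b & ~ (dist_typ T (tp a) (tp b) < e%:E)%E].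
  apply: contrapT => ne; apply: nia; apply/isolatedP.
  split; first by exists M; split=> //; exists a.
  move=> e e0; apply: contrapT => nP; apply: ne; exists e; split=> // P oP Pa.
  apply: contrapT => nN; apply: nP; exists P; split=> // N b NT Pb.
  by apply: contrapT => nb; apply: nN; exists N, b.
(* [isolated_realise] costs a factor 6; the moved tuple must stay within [d] to satisfy [W], and
   within [e] to contradict the choice of [b]. *)
pose c := Num.min d e / 6.
have c0 : 0 < c by rewrite divr_gt0// lt_min d0.
pose cl (i : 'I_n) : {set 'I_n} := [set j | `[< sim E (a i) (a j) >]]%SET.
have clP i j : j \in cl i <-> sim E (a i) (a j).
  by rewrite inE; split=> /asboolP.
have cl_eq i j : sim E (a i) (a j) -> cl i = cl j.
  move=> ij; apply/setP => k; rewrite !inE; apply/asboolP/asboolP.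
    by apply: (sim_trans invE MT); exact: (sim_sym invE MT).
  exact: (sim_trans invE MT).
pose ev (I : {set 'I_n}) (k : 'I_#|I|) : 'I_n := enum_val k.
have clq i (k l : 'I_#|cl i|) : sim E (a (ev _ k)) (a (ev _ l)).
  apply: (sim_trans invE MT (y := a i)); last exact/clP/enum_valP.
  exact/(sim_sym invE MT)/clP/enum_valP.
have /choice[Q QP] : forall i, exists Q : condition L n, [/\ is_open Q, Q M a &
    forall N (b : 'I_n -> N), models N T -> Q N b ->
    (dist_typ T (tp (a \o ev (cl i))) (tp (b \o ev (cl i))) < c%:E)%E].
  move=> i; have /isolatedP[_ /(_ _ c0)[P [oP Pa PU]]] := clique_isolated MT (clq i).
  exists (fun N b => P N (b \o ev (cl i))); split=> //; first exact: open_ren.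
  by move=> N b NT; exact: PU.
have [||N [b [NT [W0b Qb] nb]]] := H (fun N b => W0 N b /\ forall i, Q i N b).
- by apply: open_and => //; apply: open_forall => i; have [] := QP i.
- by split=> // i; have [] := QP i.
(* The tuple [y] is chosen for each class as a set, so that entries of the same class are moved by
   the same realisation. *)
have /choice[y yP] : forall I : {set 'I_n}, exists y : 'I_n -> N, forall i, I = cl i ->
    tp (y \o ev I) = tp (a \o ev I) /\ close (b \o ev I) (y \o ev I) (6 * c).
  move=> I; have [[i ->]|nI] := pselect (exists i, I = cl i); last first.
    by exists b => i Ii; exfalso; apply: nI; exists i.
  have [_ _ QU] := QP i; have iI := clique_isolated MT (clq i).
  have [z za bz] := isolated_realise iI NT c0 (QU N b NT (Qb i)).
  have [z' z'E] : exists z' : 'I_n -> N, z' \o ev (cl i) = z.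
    exists (fun j => if [pick k | ev (cl i) k == j] is Some k then z k else b j).
    apply: funext => k /=; case: pickP => [l /eqP/enum_val_inj -> //|/(_ k)].
    by rewrite eqxx.
  by exists z' => j _; rewrite z'E.
pose b' i := y (cl i) i.
have b'E i : b' \o ev (cl i) = y (cl i) \o ev (cl i).
  apply: funext => k /=; rewrite /b'; congr (y _ _); apply/esym/cl_eq/clP/enum_valP.
have bb' : close b b' (6 * c).
  move=> i; have ii : i \in cl i by apply/clP; exact: (sim_refl invE).
  have [_ /(_ (enum_rank_in ii i))] := yP (cl i) i erefl.
  by rewrite /= /ev enum_rankK_in.
have cd : 6 * c <= d by rewrite /c mulrC divfK// ge_min lexx.
have ce : 6 * c <= e by rewrite /c mulrC divfK// ge_min lexx orbT.
have ab' m (s : 'I_m -> 'I_n) : (forall i j, sim E (a (s i)) (a (s j))) ->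
    tp (a \o s) = tp (b' \o s).
  case: m s => [|m] s ss; first exact: complete_tp0 cT MT NT.
  have sI i : s i \in cl (s ord0) by apply/clP.
  pose t i := enum_rank_in (sI ord0) (s i).
  have [H1 _] := yP _ (s ord0) erefl.
  rewrite (_ : a \o s = (a \o ev (cl (s ord0))) \o t); last first.
    by apply: funext => i /=; rewrite /ev enum_rankK_in.
  rewrite (_ : b' \o s = (y (cl (s ord0)) \o ev (cl (s ord0))) \o t); last first.
    apply: funext => i /=; rewrite /ev enum_rankK_in// /b'; congr (y _ _).
    exact/esym/cl_eq.
  exact: tp_comp (esym H1).
exists N, b'; split=> //; first exact: W0W W0b (close_le bb' cd).
apply: contrapT => nij; apply: nb; apply/dist_typ_ltP => //.
exists N; split=> //; exists b', b; split=> //; last exact: close_le (close_sym bb') ce.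
apply/esym/locally_isolated_tp => // i j; split=> [ij|b'ij]; last first.
  by apply: contrapT => nsij; apply: nij; exists i, j.
have := ab' 2 (pair2 i j); rewrite !pair2_comp => H1.
rewrite /sim -H1// => k l; rewrite /pair2.
by case: ifP => _; case: ifP => _ //; [exact: (sim_refl invE)|exact: (sim_sym invE)|exact: (sim_refl invE)].
Qed.

(** Induction on the number of inequivalent pairs: a merge keeps equivalent pairs equivalent, since
    types of equivalent entries are preserved, and makes at least one more pair equivalent. *)
Lemma isolated_dense M n (a : 'I_n -> M) (W : condition L n) :
  models M T -> is_open W -> W M a ->
  exists N (b : 'I_n -> N), [/\ models N T, W N b & isolated_typ T (tp b)].
Proof.
pose bad M (a : 'I_n -> M) := [set ij : 'I_n * 'I_n | ~~ `[< sim E (a ij.1) (a ij.2) >]]%SET.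
have [k] := ubnP #|bad M a|; elim: k M a => // k IH M a ak MT oW Wa.
have [ia|nia] := pselect (isolated_typ T (tp a)); first by exists M, a.
have [N [b [NT Wb ab [i [j [nij ij]]]]]] := merge_classes MT nia oW Wa.
apply: (IH N b) => //; rewrite ltnS in ak; apply: leq_trans ak.
apply: proper_card; apply/properP; split.
  apply/fintype.subsetP => -[u v]; rewrite !inE /= => /negP nb; apply/negP => /asboolP auv.
  apply: nb; apply/asboolP; have := ab 2 (pair2 u v); rewrite !pair2_comp => H1.
  rewrite /sim -H1// => p q; rewrite /pair2.
  by case: ifP => _; case: ifP => _ //; [exact: (sim_refl invE)|exact: (sim_sym invE)|exact: (sim_refl invE)].
by exists (i, j); rewrite !inE /=; [by apply/negP => /asboolP|rewrite negbK; exact/asboolP].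
Qed.

Definition tp1 M (x : M) : typ L 1 := tp (fun=> x).

Lemma tp1_tp M N n (a : 'I_n -> M) (b : 'I_n -> N) i : tp a = tp b -> tp1 (a i) = tp1 (b i).
Proof. by move=> /(tp_comp (fun _ : 'I_1 => i)). Qed.

(* All inequivalent pairs of realisations of a given 1-type have the same
   type, hence they are at the same positive distance. *)
Lemma sim_close_tp1 M (x : M) : exists2 d : R, 0 < d &
  forall N (u v : N), models N T -> tp1 u = tp1 x -> tp1 v = tp1 x ->
    (dist u v < d%:E)%E -> sim E u v.
Proof.
have [[N [u [v [NT ux vx nuv]]]]|nN] := pselect (exists N (u v : N),
    [/\ models N T, tp1 u = tp1 x, tp1 v = tp1 x & ~ sim E u v]); last first.
  exists 1 => // N u v NT ux vx _; apply: contrapT => nuv.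
  by apply: nN; exists N, u, v.
have [d d0 duv] : exists2 d : R, 0 < d & (d%:E <= dist u v)%E.
  have : dist u v != 0%E by apply/eqP => /dist_eq0 uv; apply: nuv; rewrite uv; exact: (sim_refl invE).
  have := dist_ge0 u v; case: (dist u v) => [r| |]//.
  - by rewrite lee_fin => r0 rn0; exists r => //; rewrite lt_neqAle r0 andbT eq_sym.
  - by move=> _ _; exists 1; rewrite // leey.
exists d => // N' u' v' N'T u'x v'x; rewrite ltNge => dlt.
apply: contrapT => nuv'; move/negP: dlt; apply.
suff /(tp_dist ord0 ord_max) : tp (pair2 u' v') = tp (pair2 u v) by rewrite /pair2 /= => ->.
have nsim (K : structure L) (x1 x2 : K) (i j : 'I_2) : models K T -> ~ sim E x1 x2 ->
    sim E (pair2 x1 x2 i) (pair2 x1 x2 j) -> i = j.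
  move=> KT nx; case: i j => [[|[|//]] i] [[|[|//]] j]; rewrite /pair2 /= => H.
  - exact/val_inj.
  - by [].
  - by exfalso; apply: nx; exact: (sim_sym invE).
  - exact/val_inj.
apply: locally_isolated_tp => // [i j|m s ss].
  by split=> /nsim H; rewrite H//; exact: (sim_refl invE).
case: m s ss => [|m] s ss; first exact: complete_tp0 cT N'T NT.
have sE K (w : 'I_2 -> K) : w \o s = (fun _ : 'I_1 => w (s ord0)) \o (fun _ : 'I_m.+1 => ord0).
  apply: funext => i /=; congr w; exact: (nsim N' u' v' _ _ N'T nuv' (ss i ord0)).
rewrite !sE; apply: tp_comp; rewrite /pair2; case: ifP => _.
  exact: (etrans u'x (esym ux)).
exact: (etrans v'x (esym vx)).
Qed.

Lemma scons_pair2 (X : Type) n (x : X) (a : 'I_n.+1 -> X) :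
  scons x a \o (pair2 ord0 (lift ord0 ord0) : 'I_2 -> 'I_n.+2) = pair2 x (a ord0).
Proof. by rewrite pair2_comp scons_lift scons0. Qed.

(* Merge the class of [b] with that of [a]; the resulting type is isolated, hence
   realised close to [b, a], and the realisation of [a] is in its component. *)
Lemma enter_component M n (b : M) (a : 'I_n.+1 -> M) (W : condition L n.+2) :
  models M T -> (forall i j, sim E (a i) (a j)) -> is_open W -> W M (scons b a) ->
  exists c, [/\ sim E (a ord0) c, tp1 c = tp1 b & W M (scons c a)].
Proof.
move=> MT aa oW Wba.
have [ab|nab] := pselect (sim E (a ord0) b); first by exists b.
have [W0 [d [oW0 d0 W0ba W0W]]] := open_shrink oW Wba.
(* Within [eta], points with the 1-type of [a ord0] are equivalent; this keeps the realisation [z]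
   found below in the component of [a]. *)
have [eta eta0 etaP] := sim_close_tp1 (a ord0).
have nia : ~ isolated_typ T (tp (scons b a)).
  move=> /(isolated_comp (pair2 ord0 (lift ord0 ord0)) MT); rewrite scons_pair2 => /(simP MT) ba.
  exact/nab/(sim_sym invE MT).
have [N [b' [NT W0b' bab' [i [j [nij b'ij]]]]]] := merge_classes MT nia oW0 W0ba.
have tpl : tp a = tp (b' \o lift ord0).
  have aE : scons b a \o lift ord0 = a by apply: funext => k /=; rewrite scons_lift.
  by rewrite -[in LHS]aE; apply: bab' => k l; rewrite !scons_lift.
have tp0 : tp1 b = tp1 (b' ord0).
  have bE : (fun _ : 'I_1 => b) = scons b a \o (fun=> ord0).
    by apply: funext => k /=; rewrite scons0.
  by rewrite /tp1 bE; apply: bab' => k l; rewrite scons0; exact: (sim_refl invE).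
have b'l (k l : 'I_n.+1) : sim E (b' (lift ord0 k)) (b' (lift ord0 l)).
  exact: (sim_tp (b := b' \o lift ord0) tpl (aa k l)).
(* Entries of [a] are already equivalent, so the merged pair consists of the head and an entry of
   the tail. *)
have b'0 : exists k : 'I_n.+1, sim E (b' ord0) (b' (lift ord0 k)).
  case: (unliftP ord0 i) nij b'ij => [k ->|->]; case: (unliftP ord0 j) => [l ->|->].
  - by rewrite !scons_lift => /(_ (aa k l)).
  - by move=> _ H; exists k; exact: (sim_sym invE).
  - by move=> _ H; exists l.
  - by rewrite scons0 => /(_ (sim_refl invE b MT)).
have [k0 b'k0] := b'0.
have b'0l (l : 'I_n.+1) : sim E (b' ord0) (b' (lift ord0 l)) by exact: (sim_trans invE NT b'k0).
have ib' : isolated_typ T (tp b').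
  apply: clique_isolated => // u v.
  case: (unliftP ord0 u) => [k ->|->]; case: (unliftP ord0 v) => [l ->|->] //.
    exact: (sim_sym invE).
  exact: (sim_refl invE).
pose c := Num.min d eta / 6.
have c0 : 0 < c by rewrite divr_gt0// lt_min d0.
have cd : 6 * c <= d by rewrite /c mulrC divfK// ge_min lexx.
have ce : 6 * c <= eta by rewrite /c mulrC divfK// ge_min lexx orbT.
have [_ /(_ _ c0)[P [oP Pb' PU]]] := iffLR (isolatedP T b') ib'.
have [x [Px W0x]] : exists x, P M (scons x a) /\ W0 M (scons x a).
  apply: (open_tp (open_ex (open_and oP oW0)) (esym tpl)); exists (b' ord0).
  by rewrite -[scons _ _](scons_eta b').
have [z zb' xz] := isolated_realise ib' MT c0 (PU _ _ MT Px).
exists (z ord0); split.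
- have zl : (dist (a ord0) (z (lift ord0 ord0)) < eta%:E)%E.
    by have := xz (lift ord0 ord0); rewrite scons_lift => /dist_lt_trans; exact.
  apply: (sim_trans invE MT (y := z (lift ord0 ord0))).
    apply: etaP zl => //; apply: etrans (tp1_tp _ zb') _.
    exact/esym/(tp1_tp ord0 tpl).
  exact: (sim_tp (esym zb') (sim_sym invE NT (b'0l ord0))).
- by rewrite tp0; exact: tp1_tp.
- apply: W0W W0x _; apply: close_scons; last exact: close_refl.
  by have := xz ord0; rewrite scons0 => /dist_lt_trans; exact.
Qed.

(** Here only [u] has the given 1-type. [enter_component] provides [c] equivalent to [v], with the
    1-type of [u] and close to [v], so [sim_close_tp1] applies to [u] and [c]; two distances are
    added, hence [d / 2]. *)
Lemma sim_close M (x : M) : exists2 d : R, 0 < d &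
  forall N (u v : N), models N T -> tp1 u = tp1 x -> (dist u v < d%:E)%E -> sim E u v.
Proof.
have [d d0 dP] := sim_close_tp1 x; exists (d / 2); first by lra.
move=> N u v NT ux uv.
have oW := @open_dist R L 2 ord0 ord_max (d / 2).
have [||c [vc cu cv]] := enter_component (b := u) (a := fun _ : 'I_1 => v) NT _ oW.
- by move=> _ _; exact: (sim_refl invE).
- by rewrite scons0 (_ : ord_max = lift ord0 ord0) ?scons_lift//; exact/val_inj.
move: cv; rewrite scons0 (_ : ord_max = lift ord0 ord0) ?scons_lift; last exact/val_inj.
rewrite dist_sym => cv.
apply: (sim_trans invE NT (y := c)); last exact: (sim_sym invE).
apply: dP => //; first by rewrite cu.
by apply: dist_lt_trans (dist_lt_triangle uv cv) _; lra.
Qed.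

Lemma component_elementary M (x : M) : models M T ->
  elementary_substructure (component E x).
Proof.
move=> MT; have clC : mclosure (component E x) = component E x.
  apply/seteqP; split; last exact: sub_mclosure.
  move=> y yC; have [d d0 dP] := sim_close y; have [z xz yz] := yC d d0.
  by apply: (sim_trans invE MT xz); apply: (sim_sym invE) => //; exact: (dP M y z).
have tvC : tarski_vaught (component E x).
  split=> [|n P a oP aC [b Pba]]; first by exists x; exact: (sim_refl invE).
  (* [enter_component] takes a nonempty tuple of parameters, so [x] is put in front of [a]; [s]
     skips it when [P] is read. *)
  pose s : 'I_n.+1 -> 'I_n.+2 := scons ord0 (fun i => lift ord0 (lift ord0 i)).
  have sE y : scons y (scons x a) \o s = scons y a.
    apply: funext => i /=; rewrite /s; case: (unliftP ord0 i) => [j ->|->].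
      by rewrite !scons_lift.
    by rewrite !scons0.
  have [||c [xc _ Pca]] := enter_component (b := b) (a := scons x a) MT _ (open_ren s oP).
  - move=> i j; case: (unliftP ord0 i) => [k ->|->]; case: (unliftP ord0 j) => [l ->|->];
      rewrite ?scons_lift ?scons0.
    + exact: (sim_trans invE MT (sim_sym invE MT (aC k)) (aC l)).
    + exact: (sim_sym invE MT (aC k)).
    + exact: aC.
    + exact: (sim_refl invE).
  - by rewrite sE.
  rewrite sE in Pca; rewrite scons0 in xc; by exists c.
have : elementary_substructure (mclosure (component E x)).
  have subC := tarski_vaught_substructure tvC.
  by exists subC; exact: tarski_vaught_elementary.
by rewrite clC.
Qed.

Lemma locally_isolated_weakly_local : weakly_local T E.
Proof.
split=> [M MT _ [x _ <-]|M N MT NT f]; first exact: component_elementary.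
split=> [ef|[fC fsim] n phi a _].
  split=> [C _ n phi a _|x y]; [exact: ef|exact: sim_elementary].
suff /tp_eqP : tp (f \o a) = tp a by [].
apply/esym/locally_isolated_tp => // [i j|m s ss]; first by rewrite fsim.
case: m s ss => [|m] s ss; first exact: complete_tp0 cT MT NT.
apply/esym/tp_eqP => psi.
have aC : components E M (component E (a (s ord0))) by exists (a (s ord0)).
by have := fC _ aC _ psi (a \o s) (fun i => ss ord0 i).
Qed.

Lemma local_atomic M : models M T -> (local E M <-> atomic T M).
Proof.
move=> MT; rewrite (local_sim invE MT); split=> [lM n a|aM x y].
  exact: clique_isolated.
exact/simP.
Qed.

(** Below some radius, entries cannot leave their component. A type this close to an isolated one
    thus has a realisation with pairwise equivalent entries, and [clique_isolated] applies. *)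
Lemma isolated_open M n (a : 'I_n -> M) : models M T -> isolated_typ T (tp a) ->
  exists P : condition L n, [/\ is_open P, P M a & forall N (b : 'I_n -> N),
    models N T -> P N b -> isolated_typ T (tp b)].
Proof.
move=> MT ia.
have [|i|d d0 dP] := @fin_min_pos R n (fun i d => forall N (u v : N), models N T ->
    tp1 u = tp1 (a i) -> (dist u v < d%:E)%E -> sim E u v).
- by move=> i d d' d'd H N u v NT ux /dist_lt_trans uv; apply: H => //; exact: uv.
- exact: sim_close.
have [_ /(_ _ d0)[P [oP Pa PU]]] := iffLR (isolatedP T a) ia.
exists P; split=> // N b NT Pb.
have /(dist_typ_ltP _ _ _ d0)[K [KT [a' [b' [aa' bb' ab']]]]] := PU N b NT Pb.
rewrite -bb'; apply: clique_isolated => // i j.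
have a'a' u v : sim E (a' u) (a' v).
  apply/(simP KT); rewrite -pair2_comp; apply: isolated_comp => //.
  by rewrite aa'.
have a'b' u : sim E (a' u) (b' u).
  by apply: (dP u) (ab' u) => //; exact: tp1_tp.
apply: (sim_trans invE KT (sim_sym invE KT (a'b' i))).
exact: (sim_trans invE KT (a'a' i j)).
Qed.

End LocallyIsolated.

(** * Permuting and gluing local components *)

Lemma transposition (X : Type) (x y : X) : exists f : X -> X,
  [/\ injective f, f x = y & forall z, z <> x -> z <> y -> f z = z].
Proof.
exists (fun z => if pselect (z = x) then y else if pselect (z = y) then x else z).
split=> [z z'||z zx zy].
- by case: (pselect (z = x)) => ?; case: (pselect (z = y)) => ?;
    case: (pselect (z' = x)) => ?; case: (pselect (z' = y)) => ? /=; congruence.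
- by case: pselect.
- by case: pselect => //; case: pselect.
Qed.

(** An injection matching the remaining indices is corrected by one transposition. On the type of
    components, this extends a matching of the classes of two tuples to all components. *)
Lemma injection_extend (X : Type) n (u v : 'I_n -> X) :
  (forall i j, u i = u j <-> v i = v j) ->
  exists pi : X -> X, injective pi /\ forall i, pi (u i) = v i.
Proof.
elim: n u v => [|n IH] u v uv; first by exists id; split=> // -[].
have [pi [pI piu]] := IH (u \o lift ord0) (v \o lift ord0) (fun i j => uv _ _).
have [sw [swI sw0 swE]] := transposition (pi (u ord0)) (v ord0).
exists (sw \o pi); split=> [|i]; first exact: inj_comp.
case: (unliftP ord0 i) => [j ->|->] //=.
have {}piu : pi (u (lift ord0 j)) = v (lift ord0 j) := piu j.
have [vv|nvv] := pselect (v (lift ord0 j) = v ord0).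
  by rewrite (iffRL (uv _ _) vv) sw0.
rewrite piu swE// -piu => /pI /uv; exact: nvv.
Qed.

Section Gluing.
Variables (R : realType) (L : language R) (T : theory L) (E : set (typ L 2)).
Hypothesis invE : invariant_equivalence T E.
Implicit Types (M N K : structure L) (n m k : nat).

Lemma component_self M (x : M) : models M T -> component E x x.
Proof. exact: sim_refl. Qed.

Lemma component_of M (C : set M) x : models M T ->
  components E M C -> C x -> C = component E x.
Proof. by move=> MT [y _ <-] yx; exact: (component_eq invE MT yx). Qed.

Lemma component_sim M (C : set M) x y : models M T ->
  components E M C -> C x -> C y -> sim E x y.
Proof.
by move=> MT CE Cx Cy; apply: (component_inj invE MT); rewrite -!(component_of MT CE).
Qed.

(** Maps between substructures become maps between the ambient carriers, with a default value
    outside [C], so that maps on different components have the same type and can be glued. *)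
Lemma sub_map M N (C : set M) (D : set N) (subC : is_substructure C)
    (subD : is_substructure D) (f : substructure subC -> substructure subD) :
  @elementary R L (substructure subC) M (fun x => sval x) ->
  @elementary R L (substructure subD) N (fun x => sval x) ->
  elementary f ->
  exists g : M -> N, elementary_on g C /\
    forall x (Cx : C x), g x = sval (f (exist C x Cx)).
Proof.
move=> eC eD ef; have [y0 _] := carrier_point N.
pose g x := if pselect (C x) is left Cx then sval (f (exist C x Cx)) else y0.
have gE x (Cx : C x) : g x = sval (f (exist C x Cx)).
  by rewrite /g; case: pselect => // Cx'; congr (sval (f _)); exact: eq_exist.
exists g; split=> // n phi a aC.
pose a1 : 'I_n -> substructure subC := fun i => exist C (a i) (aC i).
rewrite -[in RHS](_ : (fun x => sval x) \o a1 = a)//.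
rewrite (eC n phi a1)// -(ef n phi a1)// -(eD n phi (f \o a1))//.
by congr (eval phi _); apply: funext => i /=; rewrite (gE _ (aC i)).
Qed.

Lemma glue M N (g : set M -> M -> N) :
  weakly_local T E -> models M T -> models N T ->
  (forall x, elementary_on (g (component E x)) (component E x)) ->
  (forall x y, sim E (g (component E x) x) (g (component E y) y) <-> sim E x y) ->
  elementary (fun x => g (component E x) x).
Proof.
move=> wl MT NT gC gsim; have [_ /(_ M N MT NT) H] := wl.
apply/H; split=> // _ [x _ <-] n phi a aC; rewrite -(gC x n phi a aC).
congr (eval phi _); apply: funext => i /=; congr (g _ _).
exact/(component_eq invE MT)/(sim_sym invE MT)/aC.
Qed.

(** Downward Loewenheim-Skolem inside the component of [a], which is an elementary substructure and
    local; locality passes to elementary substructures. *)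
Lemma separable_local_part M n (a : 'I_n.+1 -> M) :
  weakly_local T E -> separable_language L -> models M T ->
  (forall i j, sim E (a i) (a j)) ->
  exists K, [/\ models K T, separable_structure K, local E K &
    exists (g : K -> M) (b : 'I_n.+1 -> K), elementary g /\ forall i, g (b i) = a i].
Proof.
move=> [wl _] sL MT aa.
have [subC eC] := wl M MT _ (ex_intro2 _ _ (a ord0) I erefl : components E M (component E (a ord0))).
have CT := elementary_models eC MT.
have lC := component_local invE MT eC.
pose d (i : nat) : substructure subC :=
  exist _ (a (inord i)) (aa ord0 (inord i)).
have [D [subD [dD sD eD]]] := separable_elementary_substructure d sL.
exists (substructure subD); split=> //.
- exact: elementary_models eD CT.
- exact: (local_elementary invE CT eD).
exists (fun x => sval (sval x)), (fun i => exist D (d i) (dD _ (ex_intro2 _ _ (i : nat) I erefl))).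
split=> [|i] /=; last by rewrite inord_val.
exact: (elementary_comp eD eC).
Qed.

End Gluing.

(** * From local categoricity to isolated types *)

Section LocallyCategorical.
Variables (R : realType) (L : language R) (T : theory L) (E : set (typ L 2)).
Hypothesis invE : invariant_equivalence T E.
Hypothesis sL : separable_language L.
Implicit Types (M N K : structure L) (n m k : nat).

Section Unique.
Hypothesis wl : weakly_local T E.
Variable K : structure L.
Hypothesis KT : models K T.
Hypothesis lK : local E K.
Hypothesis uK : forall N, models N T -> separable_structure N -> local E N -> isomorphic K N.

Lemma categorical_realise M n (a : 'I_n.+1 -> M) : models M T ->
  (forall i j, sim E (a i) (a j)) -> exists (b : 'I_n.+1 -> K), tp b = tp a.
Proof.
move=> MT aa; have [K' [K'T sK' lK' [g [b [eg gb]]]]] := separable_local_part invE wl sL MT aa.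
have [f [ef _]] := isomorphic_elementary (isomorphic_sym (uK K'T sK' lK')).
exists (f \o b); rewrite elementary_tp//.
by rewrite -(elementary_tp b eg); congr tp; apply: funext => i /=; rewrite gb.
Qed.

Lemma categorical_elementary M : models M T -> exists f : K -> M, elementary f.
Proof.
move=> MT; have [x _] := carrier_point M.
have [|K' [K'T sK' lK' [g [_ [eg _]]]]] :=
    @separable_local_part _ _ _ _ invE M 0 (fun=> x) wl sL MT.
  by move=> _ _; exact: (sim_refl invE).
have [f [ef _]] := isomorphic_elementary (uK K'T sK' lK').
by exists (g \o f); exact: elementary_comp.
Qed.

Lemma categorical_complete : complete_theory T.
Proof.
split=> [|M N MT NT sigma a b]; first by exists K.
have [f ef] := categorical_elementary MT; have [g eg] := categorical_elementary NT.
pose c : 'I_0 -> K := fun i => match notF (ltn_ord i) with end.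
have -> : a = f \o c by apply: funext => -[].
have -> : b = g \o c by apply: funext => -[].
by rewrite ef// eg.
Qed.

Lemma categorical_clique_isolated M n (a : 'I_n.+1 -> M) : models M T ->
  (forall i j, sim E (a i) (a j)) -> isolated_typ T (tp a).
Proof.
move=> MT aa; apply: contrapT => nia.
have [|N [NT sN aN]] := omitting_types sL categorical_complete _ nia.
  by exists M; split=> //; exists a.
have [b ba] := categorical_realise MT aa.
have [f ef] := categorical_elementary NT.
by apply: (aN (f \o b)); rewrite elementary_tp.
Qed.

Lemma categorical_sim M (a b : M) : models M T ->
  sim E a b <-> isolated_typ T (tp (pair2 a b)).
Proof.
move=> MT; split=> [ab|iab].
  apply: categorical_clique_isolated => // i j; rewrite /pair2.
  by case: ifP => _; case: ifP => _ //; [exact: (sim_refl invE)|exact: (sim_sym invE)|exact: (sim_refl invE)].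
(* An isolated type is realised in the local model [K], where any two elements are equivalent; the
   radius 1 is arbitrary. *)
have [_ /(_ 1 ltr01)[P [oP Pab PU]]] := iffLR (isolatedP T (pair2 a b)) iab.
have [|c Pc] := open_consistent categorical_complete oP _ KT.
  by exists M; split=> //; exists (pair2 a b).
have [d dab _] := isolated_realise iab KT ltr01 (PU K c KT Pc).
exact: (sim_tp (i := ord0) (j := ord_max) dab (iffLR (local_sim invE KT) lK _ _)).
Qed.

Lemma categorical_component_atomic M (x : M) (subC : is_substructure (component E x)) :
  models M T -> @elementary R L (substructure subC) M (fun x => sval x) ->
  atomic T (substructure subC).
Proof.
move=> MT eC n a; rewrite -(elementary_tp a eC); case: n a => [|n] a; last first.
  apply: categorical_clique_isolated => // i j.
  apply: (sim_trans invE MT (y := x)); last exact: (svalP (a j)).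
  exact: (sim_sym invE MT (svalP (a i))).
exact: isolated_tp0 categorical_complete MT.
Qed.

(* With both tuples in one separable model, a permutation of its components
   matches their classes. The components are separable and atomic, so
   back-and-forth carries each class of [a] close to that of [b], and by weak
   locality these maps glue into an elementary one. *)
Lemma categorical_tp_eq M N n (a : 'I_n -> M) (b : 'I_n -> N) :
  models M T -> models N T ->
  (forall i j, sim E (a i) (a j) <-> sim E (b i) (b j)) ->
  (forall m (s : 'I_m -> 'I_n), (forall i j, sim E (a (s i)) (a (s j))) ->
     tp (a \o s) = tp (b \o s)) ->
  tp a = tp b.
Proof.
move=> MT NT ab H; have cT := categorical_complete.
have [P [PT [a1 [b1 [aa1 bb1]]]]] := joint_realisation sL cT a b MT NT.
have [x0 _] := carrier_point P.
pose d i := if (insub i : option 'I_(n + n)) is Some j then tcat a1 b1 j else x0.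
have [D [subD [dD sQ eQ]]] := separable_elementary_substructure d sL.
have ad i : D (a1 i).
  apply: dD; exists (lshift n i) => //; rewrite /d (insubT (fun k => k < n + n)%N (ltn_ord _)).
  by rewrite -[RHS](tcat_lshift a1 b1); congr tcat; exact/val_inj.
have bd i : D (b1 i).
  apply: dD; exists (rshift n i : 'I_(n + n)) => //.
  rewrite /d (insubT (fun k => k < n + n)%N (ltn_ord (rshift n i))).
  by rewrite -[RHS](tcat_rshift a1 b1); congr tcat; exact/val_inj.
set Q := substructure subD in sQ eQ.
have QT : models Q T := elementary_models eQ PT.
pose a2 i : Q := exist D (a1 i) (ad i); pose b2 i : Q := exist D (b1 i) (bd i).
have a2a : tp a2 = tp a by rewrite -aa1 -(elementary_tp a2 eQ).
have b2b : tp b2 = tp b by rewrite -bb1 -(elementary_tp b2 eQ).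
have sim_ab i j : sim E (a2 i) (a2 j) <-> sim E (b2 i) (b2 j).
  split=> [/(sim_tp a2a)/ab/(sim_tp (esym b2b))//|].
  by move=> /(sim_tp b2b)/ab/(sim_tp (esym a2a)).
(* Back-and-forth carries one tuple to another only up to [e], so equality of types is reduced to
   close copies. *)
rewrite -a2a -b2b; apply: tp_close => e e0.
pose S := {C : set Q | components E Q C}.
have svalI (p q : S) : sval p = sval q -> p = q.
  by case: p q => [p pE] [q qE] /= pq; exact: eq_exist.
pose u i : S := exist _ (component E (a2 i)) (ex_intro2 _ _ (a2 i) I erefl).
pose v i : S := exist _ (component E (b2 i)) (ex_intro2 _ _ (b2 i) I erefl).
(* Injectivity of [pi] is what weak locality asks for: distinct components go to distinct
   components. *)
have [|pi [piI piu]] := @injection_extend S n u v.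
  move=> i j; split=> /(congr1 sval) /(component_inj invE QT) ij; apply: eq_exist;
    by apply: (component_eq invE QT); exact/sim_ab.
have [wlC _] := wl.
have /choice[g gP] : forall C : set Q, exists g : Q -> Q, forall CE : components E Q C,
    [/\ elementary_on g C, forall x, C x -> sval (pi (exist _ C CE)) (g x) &
        forall i, C (a2 i) -> (dist (g (a2 i)) (b2 i) < e%:E)%E].
  move=> C; have [CE|nCE] := pselect (components E Q C); last by exists id.
  pose I : {set 'I_n} := [set i | `[< C (a2 i) >]]%SET.
  have CI (k : 'I_#|I|) : C (a2 (enum_val k)).
    by have := enum_valP k; rewrite inE => /asboolP.
  pose C' := sval (pi (exist _ C CE)).
  have C'I (k : 'I_#|I|) : C' (b2 (enum_val k)).
    rewrite /C' (_ : exist _ C CE = u (enum_val k)) ?piu; first exact: (component_self invE _ QT).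
    by apply: eq_exist; exact: (component_of invE QT CE (CI k)).
  have [[subC eC] [subC' eC']] := (wlC Q QT C CE, wlC Q QT C' (svalP (pi (exist _ C CE)))).
  pose a3 (k : 'I_#|I|) : substructure subC := exist C (a2 (enum_val k)) (CI k).
  pose b3 (k : 'I_#|I|) : substructure subC' := exist C' (b2 (enum_val k)) (C'I k).
  have ab3 : tp a3 = tp b3.
    rewrite -(elementary_tp a3 eC) -(elementary_tp b3 eC').
    rewrite (_ : _ \o a3 = a2 \o (fun k : 'I_#|I| => enum_val k))//.
    rewrite (_ : _ \o b3 = b2 \o (fun k : 'I_#|I| => enum_val k))//.
    rewrite (tp_comp _ a2a) (tp_comp _ b2b); apply: H => k l.
    by apply: (sim_tp a2a); exact: (component_sim invE QT CE).
  have at_ C1 (C1E : components E Q C1) (subC1 : is_substructure C1) :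
      @elementary R L (substructure subC1) Q (fun x => sval x) -> atomic T (substructure subC1).
    case: C1E subC1 => x _ <- subC1; exact: categorical_component_atomic.
  have [f [ef sf fab]] := back_and_forth (elementary_models eC QT) (elementary_models eC' QT)
    (separable_elementary eC sQ) (separable_elementary eC' sQ) (at_ _ CE _ eC)
    (at_ _ (svalP (pi (exist _ C CE))) _ eC') ab3 e0.
  have [g [eg gE]] := sub_map eC eC' ef.
  exists g => CE'; rewrite (Prop_irrelevance CE' CE); split=> // [x Cx|i Ci].
    by rewrite (gE x Cx); exact: svalP.
  have iI : i \in I by rewrite inE; apply/asboolP.
  have a3E : a3 (enum_rank_in iI i) = exist C (a2 i) Ci.
    by apply: eq_exist; rewrite enum_rankK_in.
  have fi : (dist (sval (f (a3 (enum_rank_in iI i))))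
      (b2 (enum_val (enum_rank_in iI i))) < e%:E)%E := fab _.
  by rewrite a3E -gE enum_rankK_in in fi.
pose cE (x : Q) : components E Q (component E x) := ex_intro2 _ _ x I erefl.
have eF : elementary (fun x => g (component E x) x).
  apply: (glue invE wl QT QT) => [x|x y]; first by have [] := gP _ (cE x).
  have [_ gx _] := gP _ (cE x); have [_ gy _] := gP _ (cE y).
  have {}gx := gx x (sim_refl invE x QT); have {}gy := gy y (sim_refl invE y QT).
  split=> [gxy|xy].
    apply: (component_inj invE QT).
    suff : pi (exist _ _ (cE x)) = pi (exist _ _ (cE y)) by move=> /piI/(congr1 sval).
    apply: svalI; rewrite (component_of invE QT (svalP (pi _)) gx).
    by rewrite (component_of invE QT (svalP (pi _)) gy); exact: (component_eq invE QT).
  apply: (component_sim invE QT (svalP (pi (exist _ _ (cE x)))) gx).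
  rewrite (_ : exist _ _ (cE x) = exist _ _ (cE y))//.
  by apply: eq_exist; exact: (component_eq invE QT).
exists Q, ((fun x => g (component E x) x) \o a2), b2; split=> //.
  exact: elementary_tp.
move=> i; have [_ _ H1] := gP _ (cE (a2 i)); exact: H1 (sim_refl invE _ QT).
Qed.

Lemma categorical_locally_isolated n (p : typ L n) : types T n p -> locally_isolated T p.
Proof.
move=> tpp; have [M [MT [a pa]]] := tpp.
have relE N (b : 'I_n -> N) i j : models N T -> typ_rel T (tp b) i j <-> sim E (b i) (b j).
  by move=> NT; rewrite /typ_rel restr_tp pair2_comp -categorical_sim.
have clE i j : j \in typ_class T (tp a) i <-> sim E (a i) (a j).
  by rewrite inE; split=> [/asboolP/relE H|ij]; [exact: H|apply/asboolP/relE].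
rewrite pa; split=> //; first by rewrite -pa.
- have [Er Es Et] : Equivalence (@sim R L E M) by have [_] := invE; exact.
  split=> [i|i j /(relE _ _ _ _ MT) ij|i j k /(relE _ _ _ _ MT) ij /(relE _ _ _ _ MT) jk];
    apply/(relE _ _ _ _ MT).
  + exact: (Er (a i)).
  + exact: (Es _ _ ij).
  + exact: (Et _ _ _ ij jk).
- move=> i; rewrite /restr_set restr_tp.
  have clq m (s : 'I_m -> 'I_n) : (0 < m)%N -> (forall k : 'I_m, s k \in typ_class T (tp a) i) ->
      isolated_typ T (tp (a \o s)).
    case: m s => // m s _ sI; apply: categorical_clique_isolated => // k l.
    apply: (sim_trans invE MT (y := a i)); last exact/clE.
    exact/(sim_sym invE MT)/clE.
  apply: clq => [|k]; last exact: enum_valP.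
  by rewrite card_gt0; apply/finset.set0Pn; exists i; apply/clE; exact: (sim_refl invE).
- move=> q [N [NT [b ->]]] relab res_ab; apply/esym.
  apply: categorical_tp_eq => // [i j|m s ss].
    split=> [/(relE _ _ _ _ MT)/relab/(relE _ _ _ _ NT)//|].
    by move=> /(relE _ _ _ _ NT)/relab/(relE _ _ _ _ MT).
  case: m s ss => [|m] s ss; first exact: complete_tp0 categorical_complete MT NT.
  have := res_ab (s ord0); rewrite /restr_set !restr_tp => H.
  have sI i : s i \in typ_class T (tp a) (s ord0) by apply/clE.
  pose t i := enum_rank_in (sI ord0) (s i).
  have sE X (w : 'I_n -> X) : w \o s =
      (w \o (fun k : 'I_#|typ_class T (tp a) (s ord0)| => enum_val k)) \o t.
    by apply: funext => i /=; rewrite enum_rankK_in.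
  by rewrite !sE; apply: tp_comp.
Qed.

End Unique.
End LocallyCategorical.

Lemma separable_atomic_isomorphic (R : realType) (L : language R) (T : theory L)
    (M N : structure L) : complete_theory T -> models M T -> models N T ->
  separable_structure M -> separable_structure N -> atomic T M -> atomic T N ->
  isomorphic M N.
Proof.
move=> cT MT NT sM sN aM aN.
pose c (X : Type) : 'I_0 -> X := fun i => match notF (ltn_ord i) with end.
have [f [ef sf _]] := back_and_forth MT NT sM sN aM aN
  (complete_tp0 (c M) (c N) cT MT NT) ltr01.
exact: elementary_surj_isomorphic ef sf.
Qed.

(** * Isomorphism types of models *)

Section Multiplicities.
Variables (R : realType) (L : language R) (T : theory L) (E : set (typ L 2)).
Hypothesis invE : invariant_equivalence T E.
Hypothesis wl : weakly_local T E.
Implicit Types (M N K : structure L).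

Lemma isomorphic_refl M : isomorphic M M.
Proof. by exists id; split=> // y; exists y. Qed.

Definition iso_sets M N (C : set M) (D : set N) := exists (subC : is_substructure C)
  (subD : is_substructure D), isomorphic (substructure subC) (substructure subD).

Lemma iso_sets_sym M N (C : set M) (D : set N) : iso_sets C D -> iso_sets D C.
Proof.
by move=> [subC [subD CD]]; exists subD, subC; exact: isomorphic_sym.
Qed.

Lemma iso_sets_trans M N K (C : set M) (D : set N) (F : set K) :
  iso_sets C D -> iso_sets D F -> iso_sets C F.
Proof.
move=> [subC [subD CD]] [subD' [subF DF]]; exists subC, subF.
by apply: isomorphic_trans CD _; rewrite (Prop_irrelevance subD subD').
Qed.

Lemma component_substructure M (C : set M) :
  models M T -> components E M C -> is_substructure C.
Proof. by have [wlC _] := wl; move=> MT CE; have [] := wlC M MT C CE. Qed.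

Lemma iso_sets_refl M (C : set M) : models M T -> components E M C -> iso_sets C C.
Proof.
move=> MT CE; have subC := component_substructure MT CE.
by exists subC, subC; exact: isomorphic_refl.
Qed.

Lemma components_iso_toE M N (C : set N) (subC : is_substructure C) :
  components_iso_to E M (substructure subC) =
  [set D | components E M D /\ iso_sets D C].
Proof.
apply/seteqP; split=> D [DE]; first by move=> [subD DC]; split=> //; exists subD, subC.
move=> [subD [subC' DC]]; split=> //; exists subD.
by rewrite (Prop_irrelevance subC subC').
Qed.

Lemma components_matching M N : models M T -> models N T ->
  (forall K, (components_iso_to E M K #= components_iso_to E N K)%card) ->
  exists D : set M -> set N, [/\
    forall C, components E M C -> components E N (D C) /\ iso_sets C (D C),
    forall C C', components E M C -> components E M C' -> D C = D C' -> C = C' &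
    forall D0, components E N D0 -> exists2 C, components E M C & D C = D0].
Proof.
move=> MT NT MN.
(* The bijection [D] is chosen for each pair of isomorphism classes [P], [Q],
   rather than for each component, to be independent of representatives. *)
pose P K (F : set K) : set (set M) := [set C | components E M C /\ iso_sets C F].
pose Q K (F : set K) : set (set N) := [set C | components E N C /\ iso_sets C F].
have PQ K (F : set K) : models K T -> components E K F -> (P K F #= Q K F)%card.
  move=> KT FE; have subF := component_substructure KT FE.
  by have := MN (substructure subF); rewrite !components_iso_toE.
have /choice[h hP] : forall z : set (set M) * set (set N), exists h : set M -> set N,
    (z.1 #= z.2)%card -> set_bij z.1 z.2 h.
  move=> z; have [/card_set_bijP[h hP]|nz] := pselect (z.1 #= z.2)%card; first by exists h.
  by exists (fun=> setT).
have PQ_eq K K' (F : set K) (F' : set K') : iso_sets F F' -> P K F = P K' F' /\ Q K F = Q K' F'.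
  move=> FF'; split; apply/seteqP; split=> C [CE CF]; split=> //.
  - exact: iso_sets_trans CF FF'.
  - exact: iso_sets_trans CF (iso_sets_sym FF').
  - exact: iso_sets_trans CF FF'.
  - exact: iso_sets_trans CF (iso_sets_sym FF').
pose D C := h (P M C, Q M C) C.
have bij C : components E M C -> set_bij (P M C) (Q M C) (h (P M C, Q M C)).
  by move=> CE; apply: (hP (P M C, Q M C)); exact: PQ.
have self C : components E M C -> P M C C by move=> CE; split=> //; exact: iso_sets_refl.
have DP C : components E M C -> components E N (D C) /\ iso_sets C (D C).
  move=> CE; have [hf _ _] := bij C CE; have [DE DC] := hf C (self C CE).
  by split=> //; exact: iso_sets_sym.
exists D; split=> // [C C' CE C'E DD|D0 D0E].
  have CC' : iso_sets C C'.
    have [_ CD] := DP C CE; have [_ C'D] := DP C' C'E; rewrite DD in CD.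
    exact: iso_sets_trans CD (iso_sets_sym C'D).
  have [PP QQ] := PQ_eq _ _ _ _ CC'; have [_ hI _] := bij C CE.
  have C'P : P M C C' by split=> //; exact: iso_sets_sym.
  have := hI C C'; rewrite !inE => /(_ (self C CE) C'P); apply.
  by move: DD; rewrite /D -PP -QQ.
(* The isomorphism class of [D0] is inhabited among the components of [N], hence, by equinumerosity,
   among those of [M], say by [C]; the bijection used for [C] then reaches [D0]. *)
have [h0 hh0 _] : exists2 h0, set_bij (P N D0) (Q N D0) h0 & True.
  by exists (h (P N D0, Q N D0)) => //; apply: (hP (P N D0, Q N D0)); exact: PQ.
have [_ _ hs0] := hh0.
have [C [CE CD0] _] := hs0 D0 (conj D0E (iso_sets_refl NT D0E)).
have [PP QQ] := PQ_eq _ _ _ _ CD0.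
have [_ _ hs] := bij C CE; have [|C1 [C1E C1C] C1D] := hs D0.
  by split=> //; exact: iso_sets_sym.
exists C1 => //; have [PP1 QQ1] := PQ_eq _ _ _ _ C1C.
by rewrite /D PP1 QQ1.
Qed.

Lemma multiplicities_isomorphic M N : models M T -> models N T ->
  (forall K, (components_iso_to E M K #= components_iso_to E N K)%card) ->
  isomorphic M N.
Proof.
move=> MT NT MN; have [D [DP DI DS]] := components_matching MT NT MN.
have [wlC _] := wl.
have /choice[g gP] : forall C : set M, exists g : M -> N, components E M C ->
    [/\ elementary_on g C, forall x, C x -> D C (g x) &
        forall y, D C y -> exists2 x, C x & g x = y].
  move=> C; have [CE|nCE] := pselect (components E M C); last first.
    by have [y0 _] := carrier_point N; exists (fun=> y0).
  have [DE [subC [subD /isomorphic_elementary[f [ef sf]]]]] := DP C CE.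
  have [subC' eC] := wlC M MT C CE; have [subD' eD] := wlC N NT _ DE.
  rewrite (Prop_irrelevance subC' subC) in eC; rewrite (Prop_irrelevance subD' subD) in eD.
  have [g [eg gE]] := sub_map eC eD ef; exists g => _; split=> // [x Cx|y Dy].
    by rewrite (gE x Cx); exact: svalP.
  have [[x Cx] fx] := sf (exist _ y Dy); exists x => //.
  by rewrite (gE x Cx) fx.
have cE x : components E M (component E x) by exists x.
have gx x : D (component E x) (g (component E x) x).
  by have [_ H _] := gP _ (cE x); apply: H; exact: (sim_refl invE).
have eF : elementary (fun x => g (component E x) x).
  apply: (glue invE wl MT NT) => [x|x y]; first by have [] := gP _ (cE x).
  have [DEx _] := DP _ (cE x); have [DEy _] := DP _ (cE y).
  split=> [gxy|xy].
    apply: (component_inj invE MT); apply: DI => //.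
    rewrite (component_of invE NT DEx (gx x)) (component_of invE NT DEy (gx y)).
    exact: (component_eq invE NT).
  apply: (component_sim invE NT DEx (gx x)).
  by rewrite (component_eq invE MT xy); exact: gx.
apply: (elementary_surj_isomorphic eF) => y.
have [|C CE CD] := DS (component E y); first by exists y.
have [_ _ /(_ y)[|x Cx gxy]] := gP C CE; first by rewrite CD; exact: (sim_refl invE).
by exists x; rewrite -(component_of invE MT CE Cx).
Qed.

End Multiplicities.

Theorem theorem3p8 (R : realType) (L : language R) (T : theory L)
    (E : set (typ L 2)) :
  separable_language L -> invariant_equivalence T E ->
  (locally_aleph0_categorical T E <->
   [/\ complete_theory T,
       forall n (p : typ L n), types T n p -> locally_isolated T p &
       forall M : structure L, models M T -> forall a b : M,
         sim E a b <-> isolated_typ T (tp (pair2 a b))]) /\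
  (locally_aleph0_categorical T E ->
   [/\ forall n : nat,
         (exists2 U : set (typ L n), open U &
            [set p : typ L n | isolated_typ T p] = types T n `&` U) /\
         types T n `<=` closure [set p : typ L n | isolated_typ T p],
       forall M : structure L, models M T -> (local E M <-> atomic T M),
       forall M : structure L, models M T ->
         (separable_structure M /\ local E M <-> prime_model T M) &
       forall M N : structure L, models M T -> models N T ->
         (forall K : structure L,
            (components_iso_to E M K #= components_iso_to E N K)%card) ->
         isomorphic M N]).
Proof.
move=> sL invE.
have lc_li : locally_aleph0_categorical T E ->
   [/\ complete_theory T,
       forall n (p : typ L n), types T n p -> locally_isolated T p &
       forall M : structure L, models M T -> forall a b : M,
         sim E a b <-> isolated_typ T (tp (pair2 a b))].
  move=> [wl _ [K [KT _ lK uK]]]; split.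
  - exact: (categorical_complete invE sL wl KT uK).
  - move=> n p; exact: (categorical_locally_isolated invE sL wl KT lK uK).
  - move=> M MT a b; exact: (categorical_sim invE sL wl KT lK uK).
split.
  split=> // -[cT liT simP].
  have wl := locally_isolated_weakly_local invE cT liT simP.
  have la := local_atomic invE cT liT simP.
  (* A separable local model is found inside a component of any model. It is unique by
     back-and-forth, since local models are atomic. *)
  split=> //; have [[M MT] _] := cT; have [x _] := carrier_point M.
  have [|K [KT sK lK _]] := @separable_local_part _ _ _ _ invE M 0 (fun=> x) wl sL MT.
    by move=> _ _; exact: (sim_refl invE).
  exists K; split=> // N NT sN lN.
  by apply: (separable_atomic_isomorphic cT) => //; exact/la.
move=> lc; have [cT liT simP] := lc_li lc; have [wl _ [K [KT sK lK uK]]] := lc.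
have la := local_atomic invE cT liT simP.
split=> //; last exact: multiplicities_isomorphic.
- move=> n; split.
    (* [V] singles out the basic open sets that contain only isolated types of [T]; the required
       open set is their union. *)
    pose V (psi : fml L n) : Prop := forall (N : structure L) (b : 'I_n -> N), models N T ->
      (eval psi b < 0)%E -> isolated_typ T (tp b).
    exists [set q : typ L n | exists psi, V psi /\ (q psi < 0)%E].
      rewrite openE => q [psi [Vpsi qpsi]].
      apply/ptws_nbhsP; exists [:: psi], (- contract (q psi)); split.
        by rewrite oppr_gt0 contract_lt0.
      move=> r /(_ psi (or_introl erefl)) qr; exists psi; split=> //.
      by rewrite -contract_lt0; move: qr; rewrite /egap ltr_distlC => /andP[_]; lra.
    apply/seteqP; split=> [p ip|p [[N [NT [b ->]]] [psi [Vpsi bpsi]]]]; last exact: Vpsi.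
    have [tpp _] := ip; split=> //; have [N [NT [b pb]]] := tpp; rewrite pb in ip *.
    have [P [[psi psiP] Pb PI]] := isolated_open invE cT liT simP NT ip.
    exists psi; split; last exact/psiP.
    by move=> N' b' N'T /psiP; exact: PI.
  move=> p [M [MT [a ->]]] B Ba.
  have /nbhs_open[P [oP Pa PB]] : within (types T n) (nbhs (tp a : typ L n)) B.
    by apply: filterS Ba => q Bq _.
  have [N [b [NT Pb ib]]] := isolated_dense invE cT liT simP MT oP Pa.
  by exists (tp b); split=> //; exact: PB.
- move=> M MT; split=> [[sM lM]|[_ pM]].
    split=> // N NT; apply: (separable_atomic_embeds cT MT NT sM); exact/la.
  (* A prime model embeds in the separable local model [K], and both properties pass down along
     elementary maps. *)
  have [f ef] := pM K KT; split; first exact: separable_elementary ef sK.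
  exact: (local_elementary invE KT ef lK).
Qed.
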